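(* Let $Q$ be a finite quiver without oriented cycles with $n$ vertices and let $\alpha\in\mathbb{N}^n$. There is an isomorphism of rings of semi-invariants $$SI^{(\alpha,\alpha-E^t\alpha)}(Q,\alpha)\cong SI(Q,\alpha)$$ which sends $C_V$ to $c_V$ (for all representations $V$ with $\langle\alpha,\underline{\dim}\,V\rangle=0$) if and only if the support of $\alpha-E^t\alpha$ is contained in the support of $\alpha$.
   Context: $\Bbbk$ is an algebraically closed field, $\mathbb{N}$ includes $0$; representations are finite dimensional over $\Bbbk$. The support of a vector is the set of vertices where it is nonzero. $P(v)$ is the indecomposable projective representation at $v$ ($P(v)_u$ has basis the paths from $v$ to $u$), $P(\gamma)=\coprod_vP(v)^{\gamma_v}$ for $\gamma\in\mathbb{N}^n$. Euler matrix: $E_{v,v}=1$, $E_{u,v}=-(\text{number of arrows }u\to v)$ for $u\ne v$; $\langle\alpha,\beta\rangle=\alpha^tE\beta$. For $\alpha\in\mathbb{N}^n$ one has $\alpha-E^t\alpha\in\mathbb{N}^n$. $R(\alpha)=\prod_{(u\to v)\in Q_1}\mathrm{Hom}_\Bbbk(\Bbbk^{\alpha_u},\Bbbk^{\alpha_v})$, with the group $G(\alpha)=\prod_vGL_{\alpha_v}(\Bbbk)$ acting by $(gM)_a=g_{ha}M_ag_{ta}^{-1}$ for each arrow $a:ta\to ha$. For a group acting on a variety, a semi-invariant with character $\chi$ is an element $f$ of the coordinate ring with $f(gx)=\chi(g)f(x)$; $SI(Q,\alpha)=\bigoplus_\chi SI(Q,\alpha)_\chi$ is the ring of semi-invariants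 of $G(\alpha)$ on $R(\alpha)$, graded by characters. $R(\alpha,\alpha-E^t\alpha)=\mathrm{Hom}_Q(P(\alpha-E^t\alpha),P(\alpha))$ with the action $(g^0,g^1)\varphi=g^0\varphi g^1$ of $\mathrm{Aut}(P(\alpha))\times\mathrm{Aut}(P(\alpha-E^t\alpha))^{op}$; $SI^{(\alpha,\alpha-E^t\alpha)}(Q,\alpha)$ is the ring of semi-invariants for this action, the direct sum over characters of the spaces of semi-invariants with that character. For $M\in R(\alpha)$, the canonical projective presentation is $0\to P(\alpha-E^t\alpha)=\coprod_{(u\to v)\in Q_1}P(v)^{\alpha_u}\xrightarrow{p_M}P(\alpha)\to M\to0$, where on the summand for the arrow $a:u\to v$, $p_M$ is $((-\mathrm{incl}_a)^{\alpha_u},M_a):P(v)^{\alpha_u}\to P(u)^{\alpha_u}\oplus P(v)^{\alpha_v}$, with $\mathrm{incl}_a:P(v)\hookrightarrow P(u)$ induced by $a$. For a representation $V$ with $\langle\alpha,\underline{\dim}\,V\rangle=0$, $C_V(\psi)=\det\mathrm{Hom}_Q(\psi,V)$ for $\psi\in R(\alpha,\alpha-E^t\alpha)$ and $c_V(M)=\det\mathrm{Hom}_Q(p_M,V)$ for $M\in R(\alpha)$ (determinants of square matrices $\mathrm{Hom}_Q(P(\alpha),V)\to\mathrm{Hom}_Q(P(\alpha-E^t\alpha),V)$ in the natural bases). *)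

(* Defs.v *)
From HB Require Import structures.
From mathcomp Require Import all_boot all_order all_algebra.
From mathcomp Require Import boolp functions.
From mathcomp Require Import mpoly.

Set Implicit Arguments.
Unset Strict Implicit.
Unset Printing Implicit Defensive.

Import Order.TTheory GRing.Theory Num.Theory.
Local Open Scope ring_scope.

(* An affine variety is given by its points together with finitely many
   coordinate functions generating its coordinate ring.  Only the product of
   the group and its action matter for the notion of semi-invariant. *)
Record gvariety (k : closedFieldType) := GVariety {
  pt : Type;
  coord_index : finType;
  coord : coord_index -> pt -> k;
  grp : Type;
  gmul : grp -> grp -> grp;
  gact : grp -> pt -> pt }.

Section SemiInvariants.
Variables (k : closedFieldType) (X : gvariety k).

(* Since k is infinite, the coordinate ring is the ring of polynomial
   functions. *)
Definition regular (f : pt X -> k) : Prop :=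
  exists p : {mpoly k[#|{: coord_index X}|]},
    forall x, f x = p.@[fun i => coord (enum_val i) x].

(* A character is a homomorphism to the multiplicative group of k.  It need
   not be required to be regular: if f is a nonzero semi-invariant with
   f x != 0, then chi g = f (g x) / f x is a regular function of g. *)
Definition character (chi : grp X -> k) : Prop :=
  (forall g, chi g != 0) /\ (forall g h, chi (gmul g h) = chi g * chi h).

Definition semi_invariant (chi : grp X -> k) (f : pt X -> k) : Prop :=
  regular f /\ (forall g x, f (gact g x) = chi g * f x).

(* The sum, inside the coordinate ring, of the spaces of semi-invariants of
   all characters (this sum is direct). *)
Definition SI_pred : {pred (pt X -> k)} := fun f =>
  `[< exists (m : nat) (F : 'I_m -> pt X -> k),
        (forall i, exists2 chi, character chi & semi_invariant chi (F i)) /\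
        f = \sum_i F i >].

Lemma regularM f g : regular f -> regular g -> regular (f * g).
Proof.
move=> [p hp] [q hq]; exists (p * q) => x.
by rewrite mevalM -hp -hq.
Qed.

Lemma regularN f : regular f -> regular (- f).
Proof. by move=> [p hp]; exists (- p) => x; rewrite mevalN -hp. Qed.

Lemma regular1 : regular 1.
Proof. by exists 1 => x; rewrite meval1. Qed.

Fact SI_subring : subring_closed SI_pred.
Proof.
split.
- apply/asboolP; exists 1%N, (fun=> 1); split; last by rewrite big_ord1.
  move=> _; exists (fun=> 1); first by split=> *; rewrite ?oner_neq0 ?mulr1.
  by split; [exact: regular1 | move=> g x; rewrite mulr1].
- move=> f g /asboolP[m [F [hF ->]]] /asboolP[m' [G [hG ->]]]; apply/asboolP.
  exists (m + m')%N, (fun i : 'I_(m + m') =>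
    match fintype.split i with inl j => F j | inr j => (- (G j)) end).
  split.
    move=> i; case: (fintype.split i) => j; first exact: hF.
    have [chi hchi [rG hGj]] := hG j; exists chi => //.
    split; first exact: regularN.
    by move=> a x; rewrite /GRing.opp /= hGj mulrN.
  rewrite big_split_ord /= -sumrN; congr (_ + _); apply: eq_bigr => j _.
    by rewrite -/(unsplit (inl j)) unsplitK.
  by rewrite -/(unsplit (inr j)) unsplitK.
- move=> f g /asboolP[m [F [hF ->]]] /asboolP[m' [G [hG ->]]]; apply/asboolP.
  exists #|{: 'I_m * 'I_m'}|, (fun i => F (enum_val i).1 * G (enum_val i).2).
  split.
    move=> i; have [chi [c0 cM] [rF hFi]] := hF (enum_val i).1.
    have [psi [p0 pM] [rG hGi]] := hG (enum_val i).2.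
    exists (fun a => chi a * psi a).
      by split=> *; rewrite ?mulf_neq0 // cM pM mulrACA.
    split; first exact: regularM.
    by move=> a x; rewrite /GRing.mul /= hFi hGi mulrACA.
  rewrite mulr_suml -(big_enum_val (fun x => F x.1 * G x.2)) /=.
  rewrite (eq_bigr (fun i => \sum_j F i * G j)); last first.
    by move=> i _; rewrite mulr_sumr.
  by rewrite pair_big; apply: eq_bigl => x; rewrite inE.
Qed.

HB.instance Definition _ :=
  GRing.isSubringClosed.Build (pt X -> k) SI_pred SI_subring.

(* The ring of semi-invariants of the group of X on X, as a subring of the
   ring of functions on X. *)
Record SI := MkSI { SI_val :> pt X -> k; SI_valP : SI_val \in SI_pred }.

HB.instance Definition _ := [isSub for SI_val].
HB.instance Definition _ := [Choice of SI by <:].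
HB.instance Definition _ := GRing.SubChoice_isSubComPzRing.Build
  (pt X -> k) SI_pred SI SI_subring.

End SemiInvariants.

Record quiver (n : nat) := Quiver {
  arrow : finType;
  tl : arrow -> 'I_n;
  hd : arrow -> 'I_n }.

Section Quiver.
Variables (n : nat) (Q : quiver n).

(* Paths are listed in the order in which they are travelled. *)
Fixpoint is_path (v u : 'I_n) (p : seq (arrow Q)) : bool :=
  if p is a :: p' then (tl a == v) && is_path (hd a) u p' else v == u.

Definition acyclic : Prop := forall v p, is_path v v p -> p = [::].

(* In an acyclic quiver with n vertices every path has length less than n, so
   the bound on the length leaves out no path. *)
Definition qpath (v u : 'I_n) := {p : n.-bseq (arrow Q) | is_path v u p}.
Definition qpath_nil (v : 'I_n) : qpath v v := exist _ [bseq] (eqxx v).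

Definition euler_mx : 'M[int]_n :=
  \matrix_(u, v) if u == v then 1
                 else - (#|[pred a : arrow Q | (tl a == u) && (hd a == v)]|)%:Z.

Definition zvec (alpha : 'I_n -> nat) : 'cV[int]_n := \col_v (alpha v)%:Z.

Definition euler_form (alpha beta : 'I_n -> nat) : int :=
  ((zvec alpha)^T *m euler_mx *m zvec beta) 0 0.

Definition zcoexp (alpha : 'I_n -> nat) : 'cV[int]_n :=
  zvec alpha - euler_mx^T *m zvec alpha.

(* alpha - E^t alpha as a vector of natural numbers; see zvec_coexp. *)
Definition coexp (alpha : 'I_n -> nat) (v : 'I_n) : nat := `|zcoexp alpha v 0%R|%N.

(* The slots into v index a basis of the coproduct of the k^(alpha u) over the
   arrows a : u -> v. *)
Definition arrow_slot (alpha : 'I_n -> nat) := {a : arrow Q & 'I_(alpha (tl a))}.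
Definition slots_into (alpha : 'I_n -> nat) (v : 'I_n) : pred (arrow_slot alpha) :=
  [pred x | hd (tag x) == v].
Arguments slots_into : clear implicits.

Hypothesis Q_acyclic : acyclic.

Lemma no_loop (a : arrow Q) : hd a != tl a.
Proof.
apply/eqP => h; have := @Q_acyclic (tl a) [:: a].
by rewrite /= h eqxx /= => /(_ isT).
Qed.

Lemma card_slots_into alpha v :
  #|slots_into alpha v| = (\sum_(a : arrow Q | hd a == v) alpha (tl a))%N.
Proof.
rewrite -sum1_card (eq_bigl (fun x : arrow_slot alpha => (hd (tag x) == v) && true));
  last by move=> x; rewrite andbT.
rewrite -(sig_big_dep (fun a : arrow Q => hd a == v) (fun _ _ => true) (fun _ _ => 1%N)) /=.
by apply: eq_bigr => a _; rewrite sum1_card card_ord.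
Qed.

Lemma zcoexpE alpha v : zcoexp alpha v 0 = #|slots_into alpha v|%:Z.
Proof.
rewrite card_slots_into !mxE (bigD1 v) //= !mxE eqxx mul1r opprD addrA subrr add0r.
rewrite -sumrN (partition_big (@tl _ Q) (fun u => u != v)) /=; last first.
  by move=> a /eqP <-; rewrite eq_sym no_loop.
rewrite (big_morph Posz PoszD (erefl _)); apply: eq_bigr => u uv.
rewrite !mxE (negPf uv) mulNr opprK -PoszM; congr Posz.
rewrite -sum1_card big_distrl /=.
by apply: eq_big => [a|a /andP[/eqP <- _]]; rewrite ?mul1n // andbC.
Qed.

Lemma zvec_coexp alpha : zvec (coexp alpha) = zcoexp alpha.
Proof. by apply/matrixP => v j; rewrite mxE ord1 /coexp zcoexpE. Qed.

Lemma coexpE alpha v : coexp alpha v = #|slots_into alpha v|.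
Proof. by rewrite /coexp zcoexpE. Qed.

(* The identification of P(alpha - E^t alpha) with the coproduct over the
   arrows a : u -> v of the P(v)^(alpha u) *)
Definition slot (alpha : 'I_n -> nat) (v : 'I_n) (i : 'I_(coexp alpha v)) :
    arrow_slot alpha :=
  enum_val (cast_ord (coexpE alpha v) i).

Lemma slotP alpha v i : hd (tag (@slot alpha v i)) = v.
Proof. by apply/eqP; exact: (enum_valP (cast_ord (coexpE alpha v) i)). Qed.

Lemma path_uniq v u p : is_path v u p -> uniq (v :: map (@hd _ Q) p).
Proof.
elim: p v => [|a p IH] v //= /andP[/eqP <- hp].
have /= /andP[-> ->] := IH _ hp; rewrite !andbT inE negb_or eq_sym no_loop /=.
apply/mapP => -[b bp hb].
have [p1 [p2 [ep hb2]]] : exists p1 p2, p = rcons p1 b ++ p2 /\ True.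
  by case/splitPr: bp => p1 p2; exists p1, p2; rewrite cat_rcons.
have : is_path (tl a) (hd b) (a :: rcons p1 b).
  rewrite /= eqxx /=; move: hp; rewrite ep; elim: (p1) (hd a) => [|c q IHq] w /=.
    by move=> /andP[-> _]; rewrite eqxx.
  by move=> /andP[-> /IHq].
by rewrite -hb => /Q_acyclic.
Qed.

Lemma path_size v u p : is_path v u p -> (size p < n)%N.
Proof.
move=> /path_uniq /card_uniqP /= h.
by rewrite size_map in h; rewrite -h -[X in (_ <= X)%N]card_ord max_card.
Qed.

Lemma is_path_rcons v u p a :
  is_path v u (rcons p a) = is_path v (tl a) p && (hd a == u).
Proof.
elim: p v => [|b p IH] v /=; first by rewrite eq_sym.
by rewrite IH andbA.
Qed.

End Quiver.

Section Representations.
Variables (k : closedFieldType) (n : nat) (Q : quiver n).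

(* The representation space R(d), acting on column vectors *)
Definition rep (d : 'I_n -> nat) := forall a : arrow Q, 'M[k]_(d (hd a), d (tl a)).

Record hom d1 d2 (V : rep d1) (W : rep d2) := Hom {
  hom_mx :> forall v, 'M[k]_(d2 v, d1 v);
  hom_comm : forall a, hom_mx (hd a) *m V a = W a *m hom_mx (tl a) }.

Fact comp_comm d1 d2 d3 (U : rep d1) (V : rep d2) (W : rep d3)
    (g : hom V W) (f : hom U V) a :
  (g (hd a) *m f (hd a)) *m U a = W a *m (g (tl a) *m f (tl a)).
Proof. by rewrite -mulmxA hom_comm mulmxA hom_comm mulmxA. Qed.

Definition hom_comp d1 d2 d3 (U : rep d1) (V : rep d2) (W : rep d3)
  (g : hom V W) (f : hom U V) : hom U W :=
  @Hom _ _ U W (fun v => g v *m f v) (comp_comm g f).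

Definition is_iso d1 d2 (V : rep d1) (W : rep d2) (g : hom V W) : Prop :=
  exists h : hom W V, forall v, h v *m g v = 1%:M /\ g v *m h v = 1%:M.

Record aut d (V : rep d) := Aut { aut_hom :> hom V V; autP : is_iso aut_hom }.

Fact aut_mul_iso d (V : rep d) (g h : aut V) : is_iso (hom_comp g h).
Proof.
have [g' g'P] := autP g; have [h' h'P] := autP h.
exists (hom_comp h' g') => v /=; have [g1 g2] := g'P v; have [h1 h2] := h'P v.
by split; [rewrite -mulmxA (mulmxA (g' v)) g1 mul1mx
          | rewrite -mulmxA (mulmxA (h v)) h2 mul1mx].
Qed.

Definition aut_mul d (V : rep d) (g h : aut V) : aut V := Aut (aut_mul_iso g h).

Record gl d := GL { gl_mx :> forall v : 'I_n, 'M[k]_(d v);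
                    glP : forall v, gl_mx v \in unitmx }.

Fact gl_mulP d (g h : gl d) v : g v *m h v \in unitmx.
Proof. by rewrite unitmx_mul !glP. Qed.

Definition gl_mul d (g h : gl d) : gl d :=
  @GL d (fun v => g v *m h v) (gl_mulP g h).

Definition rep_act d (g : gl d) (M : rep d) : rep d :=
  fun a => g (hd a) *m M a *m invmx (g (tl a)).

Definition rep_variety (d : 'I_n -> nat) : gvariety k :=
  @GVariety k (rep d) {a : arrow Q & 'I_(d (hd a)) * 'I_(d (tl a))}%type
    (fun x M => M (tag x) (tagged x).1 (tagged x).2)
    (gl d) (@gl_mul d) (@rep_act d).

(* Basis of P(gamma) at u: a vertex v, the index of a copy of P(v), and a path
   from v to u. *)
Definition Pbasis (gamma : 'I_n -> nat) (u : 'I_n) : finType :=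
  {v : 'I_n & 'I_(gamma v) * qpath Q v u}%type.

Definition Pgen gamma u (x : Pbasis gamma u) : {v : 'I_n & 'I_(gamma v)} :=
  Tagged (fun v => 'I_(gamma v)) (tagged x).1.

Definition Ppath gamma u (x : Pbasis gamma u) : seq (arrow Q) :=
  val (val (tagged x).2).

Definition Pdim (gamma : 'I_n -> nat) (u : 'I_n) : nat := #|{: Pbasis gamma u}|.

Lemma Pbasis_inj gamma u (x y : Pbasis gamma u) :
  Pgen x = Pgen y -> Ppath x = Ppath y -> x = y.
Proof.
case: x y => [v [i p]] [w [j q]]; rewrite /Pgen /Ppath /= => e.
have ew : v = w by exact: (congr1 tag e).
case: w / ew in j q e *.
move/eqP: e; rewrite eq_Tagged /= => /eqP -> e.
by rewrite (val_inj (val_inj e) : p = q).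
Qed.

Lemma Pbasis_belast gamma u a p (y : Pbasis gamma u) : Ppath y = rcons p a ->
  exists2 x : Pbasis gamma (tl a), Pgen x = Pgen y & Ppath x = p.
Proof.
case: y => [v [i [q hq]]]; rewrite /Pgen /Ppath /= => e.
have := hq; rewrite e is_path_rcons => /andP[hp _].
have sz : (size p <= n)%N.
  by apply: leq_trans (size_bseq q); rewrite e size_rcons.
by exists (Tagged (fun v' => 'I_(gamma v') * qpath Q v' (tl a))%type
             (i, exist _ (Bseq sz) hp)).
Qed.

Definition projrep (gamma : 'I_n -> nat) : rep (Pdim gamma) := fun a =>
  \matrix_(i, j)
    let y := enum_val i in let x := enum_val j in
    ((Pgen y == Pgen x) && (Ppath y == rcons (Ppath x) a))%:R.

(* Position of the i-th generator (trivial path) of P(gamma) at v *)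
Definition Pone (gamma : 'I_n -> nat) (v : 'I_n) (i : 'I_(gamma v)) :
    'I_(Pdim gamma v) :=
  enum_rank (Tagged (fun v' => 'I_(gamma v') * qpath Q v' v)%type
                    (i, qpath_nil Q v) : Pbasis gamma v).

(* R(gamma0, gamma1) = Hom(P(gamma1), P(gamma0)) with the action
   (g0, g1) phi = g0 phi g1 of Aut(P(gamma0)) * Aut(P(gamma1))^op.  The coordinate
   ring of this linear subspace of the space of families of matrices consists of
   the restrictions of polynomial functions. *)
Definition pres_act gamma0 gamma1 (g : aut (projrep gamma0) * aut (projrep gamma1))
    (phi : hom (projrep gamma1) (projrep gamma0)) :
    hom (projrep gamma1) (projrep gamma0) :=
  hom_comp g.1 (hom_comp phi g.2).

Definition pres_variety (gamma0 gamma1 : 'I_n -> nat) : gvariety k :=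
  @GVariety k (hom (projrep gamma1) (projrep gamma0))
    {v : 'I_n & 'I_(Pdim gamma0 v) * 'I_(Pdim gamma1 v)}%type
    (fun x phi => phi (tag x) (tagged x).1 (tagged x).2)
    (aut (projrep gamma0) * aut (projrep gamma1))%type
    (fun g h => (aut_mul g.1 h.1, aut_mul h.2 g.2))
    (@pres_act gamma0 gamma1).

(* The map V_p along a path p from u to v.  Recall that conform_mx 0 A is A
   when the dimensions agree; they do along a path from u to v. *)
Fixpoint path_mx d (V : rep d) (u v : 'I_n) (p : seq (arrow Q)) : 'M[k]_(d v, d u) :=
  if p is a :: p' then path_mx V (hd a) v p' *m conform_mx 0 (V a)
  else conform_mx 0 (1%:M : 'M_(d u)).

(* Hom(P(gamma), V) is the coproduct of the V_v^(gamma v); a basis element is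
   given by a generator of P(gamma) and a basis vector of V at its vertex. *)
Definition Hbasis (gamma d : 'I_n -> nat) : finType :=
  {v : 'I_n & 'I_(gamma v) * 'I_(d v)}%type.

(* The morphism P(gamma) -> V that maps the generator of x to the basis vector
   of x and all other generators to 0 *)
Definition Hvec gamma d (V : rep d) (x : Hbasis gamma d) (u : 'I_n) :
    'M[k]_(d u, Pdim gamma u) :=
  \matrix_(r, c)
    let y := enum_val c : Pbasis gamma u in
    if Pgen y == Tagged (fun v => 'I_(gamma v)) (tagged x).1
    then path_mx V (tag x) u (Ppath y) r (tagged x).2 else 0.

(* The matrix of Hom(psi, V) : Hom(P(gamma0), V) -> Hom(P(gamma1), V),
   h |-> h psi; see HmxE.  A morphism P(gamma1) -> V has as coordinates the
   entries of the images of the generators. *)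
Definition Hmx gamma0 gamma1 d (V : rep d)
    (psi : hom (projrep gamma1) (projrep gamma0)) :
    'M[k]_(#|{: Hbasis gamma1 d}|, #|{: Hbasis gamma0 d}|) :=
  \matrix_(i, j)
    let y := enum_val i : Hbasis gamma1 d in
    (Hvec V (enum_val j) (tag y) *m psi (tag y))
      (tagged y).2 (Pone (tagged y).1).

Definition Hcoord gamma d (V : rep d) (h : hom (projrep gamma) V) :
    'cV[k]_#|{: Hbasis gamma d}| :=
  \col_i let y := enum_val i : Hbasis gamma d in
         h (tag y) (tagged y).2 (Pone (tagged y).1).

Lemma path_mx_rcons d (V : rep d) u a p : is_path u (tl a) p ->
  path_mx V u (hd a) (rcons p a) = V a *m path_mx V u (tl a) p.
Proof.
elim: p u => [|b p IH] u /=; last by move=> /andP[_ /IH ->]; rewrite mulmxA.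
by move=> /eqP ->; rewrite !conform_mx_id mulmx1 mul1mx.
Qed.

Lemma hom_path gamma d (V : rep d) (h : hom (projrep gamma) V) u (y : Pbasis gamma u) r :
  h u r (enum_rank y) =
  (path_mx V (tag y) u (Ppath y) *m h (tag y)) r (Pone (tagged y).1).
Proof.
move: {2}(Ppath y) (erefl (Ppath y)) => p; elim/last_ind: p => [|p a IH] in u y r *.
  case: y => [v [i [p hp]]]; rewrite /Ppath /= => p0.
  have vu : v = u by move: hp; rewrite p0 => /eqP.
  case: u / vu in hp r *; rewrite p0 /= conform_mx_id mul1mx; congr (h v r _).
  by congr enum_rank; apply: Pbasis_inj.
move=> py; have hy : is_path (tag y) u (rcons p a) by rewrite -py; exact: valP (tagged y).2.
move: hy; rewrite is_path_rcons => /andP[hp /eqP au].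
case: u / au in y r py hp *.
have [x gx px] := Pbasis_belast py.
rewrite py path_mx_rcons //.
have -> : h (hd a) r (enum_rank y) = (h (hd a) *m projrep gamma a) r (enum_rank x).
  rewrite mxE (bigD1 (enum_rank y)) //= big1 ?addr0.
    by rewrite mxE /= !enum_rankK gx px py !eqxx mulr1.
  move=> l ly; rewrite [X in _ * X]mxE /= enum_rankK; case: eqP => [gl|_]; last by rewrite mulr0.
  case: eqP => [pl|_]; last by rewrite mulr0.
  case/eqP: ly; rewrite -[l]enum_valK; congr enum_rank.
  by apply: Pbasis_inj; rewrite ?gl ?pl ?gx ?px.
rewrite hom_comm -mulmxA mxE [RHS]mxE; apply: eq_bigr => m _; congr (_ * _).
rewrite (IH _ _ _ px) px.
case: x y gx {px py} hp => [v [i1 q1]] [w [i2 q2]]; rewrite /Pgen /= => e _.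
have ew : v = w by exact: (congr1 tag e).
case: w / ew in i2 q2 e *.
by move/eqP: e; rewrite eq_Tagged /= => /eqP ->.
Qed.

Lemma HmxE gamma0 gamma1 d (V : rep d) (psi : hom (projrep gamma1) (projrep gamma0))
    (h : hom (projrep gamma0) V) :
  Hcoord (hom_comp h psi) = Hmx V psi *m Hcoord h.
Proof.
pose W v := ('I_(gamma0 v) * 'I_(d v))%type.
pose g v (z : W v) := Tagged (fun v => 'I_(gamma0 v)) z.1.
have hE u r l : h u r l = \sum_j Hvec V (enum_val j) u r l * Hcoord h j 0.
  rewrite -[l]enum_valK hom_path; set y := enum_val l.
  under eq_bigr do rewrite !mxE enum_rankK.
  pose F v (z : W v) := (if Pgen y == g v z
    then path_mx V v u (Ppath y) r z.2 else 0) * h v z.2 (Pone z.1).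
  rewrite -(big_enum_val (A := {: Hbasis gamma0 d}) (fun x => F (tag x) (tagged x))) /=.
  rewrite -(sig_big_dep xpredT (fun _ => xpredT) F) (bigD1 (tag y)) //=.
  rewrite [X in _ + X]big1 ?addr0 => [|v vy]; last first.
    apply: big1 => z _; rewrite /F; case: eqP; rewrite ?mul0r // => e.
    by case/eqP: vy; exact: (esym (congr1 tag e)).
  rewrite -(pair_bigA _ (fun i m => F (tag y) (i, m))) /= (bigD1 (tagged y).1) //=.
  rewrite [X in _ + X]big1 ?addr0 => [|i iy]; last first.
    apply: big1 => m _; rewrite /F /g /Pgen eq_Tagged /= eq_sym (negPf iy).
    by rewrite mul0r.
  by rewrite mxE; apply: eq_bigr => m _; rewrite /F /g eqxx.
apply/matrixP => i j; rewrite ord1 !mxE {j} /= mxE.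
set y := enum_val i.
under [LHS]eq_bigr => l _ do rewrite hE mulr_suml.
rewrite exchange_big /=; apply: eq_bigr => j _.
rewrite [X in _ = X * _]mxE /= [X in _ = X * _]mxE mulr_suml.
by apply: eq_bigr => l _; rewrite mulrAC.
Qed.

Hypothesis Q_acyclic : acyclic Q.

Lemma card_Hbasis gamma d : #|{: Hbasis gamma d}| = (\sum_v gamma v * d v)%N.
Proof.
rewrite card_tagged sumnE big_map big_enum /=; apply: eq_bigr => v _.
by rewrite card_prod !card_ord.
Qed.

Fact Hbasis_square alpha d : euler_form Q alpha d = 0 ->
  #|{: Hbasis (coexp Q alpha) d}| = #|{: Hbasis alpha d}|.
Proof.
rewrite /euler_form -[X in _ *m X *m _]trmxK -trmx_mul.
have -> : (euler_mx Q)^T *m zvec alpha = zvec alpha - zvec (coexp Q alpha).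
  by rewrite zvec_coexp // /zcoexp subKr.
rewrite linearB mulmxBl !mxE => /eqP; rewrite subr_eq0 => /eqP e.
have zE gamma : (\sum_j (zvec gamma)^T 0 j * zvec d j 0 = #|{: Hbasis gamma d}|%:Z).
  rewrite card_Hbasis (big_morph Posz PoszD (erefl _)).
  by apply: eq_bigr => v _; rewrite !mxE.
by move: e; rewrite !zE => -[].
Qed.

(* C_V *)
Definition detC alpha d (V : rep d) (h : euler_form Q alpha d = 0)
    (psi : hom (projrep (coexp Q alpha)) (projrep alpha)) : k :=
  \det (castmx (Hbasis_square h, erefl) (Hmx V psi)).

(* p_M.  On the generator (v, i) of P(alpha - E^t alpha) that corresponds to the
   l-th generator of the summand P(v)^(alpha u) for the arrow a : u -> v, its
   value is M_a applied to e_l minus the path a in the l-th copy of P(u). *)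
Definition canon_mx alpha (M : rep alpha) (u : 'I_n) :
    'M[k]_(Pdim alpha u, Pdim (coexp Q alpha) u) :=
  \matrix_(i, j)
    let y := enum_val i : Pbasis alpha u in
    let x := enum_val j : Pbasis (coexp Q alpha) u in
    let s := slot Q_acyclic (tagged x).1 in
    let a := tag s in
    \sum_(m < alpha (hd a)) M a m (tagged s) *+
      ((Pgen y == Tagged (fun v => 'I_(alpha v)) m) && (Ppath y == Ppath x))
    - ((Pgen y == Tagged (fun v => 'I_(alpha v)) (tagged s)) &&
       (Ppath y == a :: Ppath x))%:R.

Lemma Pbasis_rcons gamma a (x : Pbasis gamma (tl a)) :
  exists2 y : Pbasis gamma (hd a), Pgen y = Pgen x & Ppath y = rcons (Ppath x) a.
Proof.
case: x => [v [i [p hp]]]; rewrite /Pgen /Ppath /=.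
have hpa : is_path v (hd a) (rcons p a) by rewrite is_path_rcons hp eqxx.
have sz : (size (rcons p a) <= n)%N by exact: ltnW (path_size Q_acyclic hpa).
by exists (Tagged (fun v' => 'I_(gamma v') * qpath Q v' (hd a))%type
             (i, exist _ (Bseq sz) hpa)).
Qed.

Fact canon_comm alpha (M : rep alpha) a :
  canon_mx M (hd a) *m projrep (coexp Q alpha) a = projrep alpha a *m canon_mx M (tl a).
Proof.
apply/matrixP => i j; rewrite !mxE.
have [x' gx' px'] := Pbasis_rcons (enum_val j).
rewrite (bigD1 (enum_rank x')) //= big1 ?addr0; last first.
  move=> l lx; rewrite [X in _ * X]mxE /=; case: eqP => [gl|_]; last by rewrite mulr0.
  case: eqP => [pl|_]; last by rewrite mulr0.
  case/eqP: lx; rewrite -[l]enum_valK; congr enum_rank.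
  by apply: Pbasis_inj; rewrite ?gl ?pl.
rewrite !mxE enum_rankK /= gx' px' !eqxx mulr1 /=.
have -> : slot Q_acyclic (tagged x').1 = slot Q_acyclic (tagged (enum_val j)).1.
  case: x' (enum_val j) gx' {px'} => [v [i1 p]] [w [i2 q]]; rewrite /Pgen /= => e.
  have ew : v = w by exact: (congr1 tag e).
  case: w / ew in i2 q e *.
  by move/eqP: e; rewrite eq_Tagged /= => /eqP ->.
set s := slot _ _.
case/lastP pi: (Ppath (enum_val i)) => [|p b].
  have nr q : ([::] == rcons q a) = false by case: q.
  rewrite [RHS]big1 => [|l _]; last by rewrite mxE /= pi nr andbF mul0r.
  by rewrite andbF subr0 big1 // => m _; rewrite nr andbF.
have [eb|nb] := eqVneq b a; last first.
  rewrite -rcons_cons !eqseq_rcons (negPf nb) !andbF subr0.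
  rewrite [RHS]big1 => [|l _].
    by rewrite big1 // => m _; rewrite ?andbF.
  by rewrite mxE /= pi eqseq_rcons (negPf nb) !andbF mul0r.
move: pi; rewrite {b}eb => pi.
have [y gy py] := Pbasis_belast pi.
rewrite [RHS](bigD1 (enum_rank y)) //= [X in _ = _ + X]big1 ?addr0; last first.
  move=> l ly; rewrite [X in X * _]mxE /=; case: eqP => [gl|_]; last by rewrite mul0r.
  case: eqP => [|_]; last by rewrite mul0r.
  rewrite pi => /rcons_inj[pl]; case/eqP: ly; rewrite -[l]enum_valK; congr enum_rank.
  by apply: Pbasis_inj; rewrite ?gy ?gl ?py ?pl.
rewrite !mxE enum_rankK /= gy py pi !eqxx mul1r.
by rewrite -rcons_cons !eqseq_rcons eqxx !andbT.
Qed.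

Definition canon alpha (M : rep alpha) : hom (projrep (coexp Q alpha)) (projrep alpha) :=
  @Hom _ _ (projrep (coexp Q alpha)) (projrep alpha) (canon_mx M) (canon_comm M).

(* c_V *)
Definition detc alpha d (V : rep d) (h : euler_form Q alpha d = 0) (M : rep alpha) : k :=
  detC V h (canon M).

End Representations.

(* Main.v *)
From HB Require Import structures.
From mathcomp Require Import all_boot all_order all_fingroup all_algebra.
From mathcomp Require Import boolp functions.
From mathcomp Require Import mpoly ring.
Require Import Defs.

(** The isomorphism is the restriction f |-> f o canon to canonical
    presentations.  It is a morphism of rings of semi-invariants because [canon]
    is equivariant for a homomorphism [rho] from GL(alpha) to the group acting on
    presentations ([canon_equivariant]), and it maps C_V to c_V by definition.
    Write gamma for alpha - E^t alpha.

    A presentation phi is good when, at every vertex v, the columns of phi_v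
    and the generators of P(alpha) at v form a basis of P(alpha)_v.  Good
    presentations form a nonempty principal open set; the cokernel of a good
    phi has the images of the generators as basis, hence is a point M of
    R(alpha), and phi = canon(M) b for an automorphism b of P(gamma)
    ([canon_factor]).

    Injectivity.  A semi-invariant is thus determined by its restriction and
    its character.  Since a sum of semi-invariants with several characters has
    to be recovered from its restriction, one needs that the characters of
    nonzero semi-invariants are separated by their restrictions to GL(alpha)
    ([restriction_determines_right]).  These characters are products of powers
    of determinants of the blocks on generators, with exponents z0_v on the
    side of P(alpha) and z1_v on the side of P(gamma).  The automorphisms
    1 + psi h and 1 + h psi are intertwined by psi, which gives z0_v = z1_v
    whenever both alpha_v and gamma_v are positive ([homotopy_weights]).  Under
    the support condition this concerns every v with gamma_v > 0, and the
    exponents can be computed from the restricted character by induction along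
    the quiver.

    Surjectivity.  A semi-invariant F of R(alpha) with weight sigma extends to
    good presentations as the value of F at the cokernel times the product of
    the powers sigma_v of the determinants of the bases above ([good_ext]).  To
    extend it to all presentations one removes the vertices from the denominator
    one at a time, from the ends of the longest paths backwards
    ([hartogs_vertex]).  On the line through a general presentation in the
    direction of the canonical presentation of 0 at the vertex j, the extension
    has no pole: at each zero of the denominator some automorphism of P(alpha)
    moves the point off the divisor, and the extension is semi-invariant.  This
    is where alpha_j > 0 is needed; such automorphisms exist because a general
    pair of a square matrix and a row vector is observable ([krylov_shift]).
    Divisibility on general lines gives divisibility in the coordinate ring up to
    the top coefficient of the denominator, which only involves the remaining
    vertices ([hartogs_step]).

    Necessity.  If gamma_v > 0 = alpha_v, take V = I_v, the injective
    representation at v.  Then c_V is a nonzero constant, because Hom(-, I_v) is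
    dual to evaluation at v, whereas C_V vanishes at 0.  So c_V is a unit and
    C_V is not ([support_necessary]). *)

Set Implicit Arguments.
Unset Strict Implicit.
Unset Printing Implicit Defensive.
Import GRing.Theory.
Local Open Scope ring_scope.

(** * Polynomials over an algebraically closed field *)
Section ClosedFieldPoly.
Variable k : closedFieldType.
Implicit Types p q d : {poly k}.

Lemma horner_ext p q : (forall x, p.[x] = q.[x]) -> p = q.
Proof.
move=> e; apply/eqP; rewrite -subr_eq0; apply: contraT => /closed_nonrootP[x].
by rewrite /root hornerD hornerN e subrr eqxx.
Qed.

Lemma nowhere_zero_poly p : (forall x, p.[x] != 0) -> p = (p.[0])%:P.
Proof.
move=> nz; have /size_poly1P[c _ ->] : size p == 1%N; last by rewrite hornerC.
apply: contraT => /closed_rootP[x /rootP px].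
by have := nz x; rewrite px eqxx.
Qed.

Lemma only_zero_root p : (forall x, x != 0 -> p.[x] != 0) ->
  exists (c : k) (e : nat), p = c *: 'X^e.
Proof.
have [n] := ubnP (size p); elim: n p => // n IH p; rewrite ltnS => sp nz.
have [p0|] := eqVneq p.[0] 0; last first.
  move=> p0; exists p.[0], 0%N; rewrite expr0 alg_polyC.
  by apply: nowhere_zero_poly => x; have [->|/nz] := eqVneq x 0.
have [pz|pnz] := eqVneq p 0; first by exists 0, 0%N; rewrite scale0r.
have /factor_theorem[q] : root p 0 by apply/rootP.
rewrite subr0 => e.
have qnz : q != 0 by apply: contra_neq pnz => q0; rewrite e q0 mul0r.
have [|x xnz|c [m qe]] := IH q.
- by move: sp; rewrite e size_mulX.
- by have := nz _ xnz; rewrite e hornerM hornerX mulf_eq0 (negPf xnz) orbF.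
by exists c, m.+1; rewrite e qe exprSr scalerAl.
Qed.

(** With g the gcd of d and p, the polynomial d / g is coprime to p / g, so it
    divides every b with [d %| p * b]; if it is not constant, it has a root, and
    all these b vanish there. *)
Lemma dvdp_at_roots p d : d != 0 ->
  (forall x, root d x -> exists2 b : {poly k}, b.[x] != 0 & d %| p * b) -> d %| p.
Proof.
move=> dnz H; set g := gcdp d p.
have gnz : g != 0 by rewrite gcdp_eq0 negb_and dnz.
have gd : g %| d by exact: dvdp_gcdl.
have gp : g %| p by exact: dvdp_gcdr.
have cop : coprimep (d %/ g) (p %/ g) by apply: coprimep_div_gcd; rewrite dnz.
have [s1|] := boolP (size (d %/ g) == 1%N).
  have /size_poly1P[c cnz ec] := s1.
  by rewrite -(divpK gd) ec mul_polyC dvdpZl.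
move=> /closed_rootP[x rx].
have [b bx db] : exists2 b : {poly k}, b.[x] != 0 & d %| p * b.
  by apply: H; rewrite -(divpK gd) rootM rx.
have : d %/ g %| b.
  rewrite -(Gauss_dvdpr _ cop) -(dvdp_mul2r _ _ gnz) divpK //.
  by rewrite mulrAC divpK.
by move=> /root_dvdp/(_ rx); rewrite /root (negPf bx).
Qed.

End ClosedFieldPoly.

(** * Characters of the general linear group *)
Section GLChar.
Variable k : closedFieldType.

Lemma det_rank1 m (x : 'cV[k]_m) (y : 'rV[k]_m) :
  \det (1%:M + x *m y) = 1 + (y *m x) 0 0.
Proof.
pose B := block_mx (1%:M : 'M_1) (- y) x (1%:M : 'M_m).
have e1 : B = block_mx 1%:M 0 x 1%:M *m block_mx 1%:M (- y) 0 (1%:M + x *m y).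
  rewrite mulmx_block !(mul1mx, mul0mx, mulmx1, mulmx0, addr0, add0r) mulmxN.
  by rewrite addrCA addNr addr0.
have e2 : B = block_mx (1%:M + y *m x) (- y) 0 1%:M *m block_mx 1%:M 0 x 1%:M.
  rewrite mulmx_block !(mul1mx, mul0mx, mulmx1, mulmx0, addr0, add0r) mulNmx.
  by rewrite addrK.
have : \det B = \det B by [].
rewrite {1}e1 e2 !det_mulmx !det_ublock !det_lblock !det1 !mul1r !mulr1.
by move=> ->; rewrite det_mx11 !mxE eqxx.
Qed.

(** If neither of two forms, each nonzero at one of the vectors, does for both
    vectors, then their sum does. *)
Lemma form_nz2 m (u v : 'cV[k]_m) : u != 0 -> v != 0 ->
  exists w : 'rV[k]_m, (w *m u) 0 0 != 0 /\ (w *m v) 0 0 != 0.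
Proof.
have ex (t : 'cV[k]_m) : t != 0 -> exists i, (delta_mx 0 i *m t : 'M_1) 0 0 != 0.
  move=> /eqP tnz; apply: contrapT => H; apply: tnz; apply/colP => i; rewrite mxE.
  by apply/eqP; apply: contra_notT H => ti; exists i; rewrite -rowE mxE.
move=> /ex[i ui] /ex[j vj].
have [vi|] := eqVneq ((delta_mx 0 i *m v : 'M_1) 0 0) 0; last by exists (delta_mx 0 i).
have [uj|] := eqVneq ((delta_mx 0 j *m u : 'M_1) 0 0) 0; last by exists (delta_mx 0 j).
exists (delta_mx 0 i + delta_mx 0 j); rewrite !mulmxDl.
by split; rewrite mxE ?uj ?addr0 // vi add0r.
Qed.

(** The general linear group is generated by the rank one perturbations of the
    identity.  If A = g - 1 is not zero, choose z and w with w A z and w A g z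
    both nonzero.  The perturbation r = 1 + A z w A / (w A z) is invertible and
    agrees with g at z, and g - r = A - A z w A / (w A z) has smaller rank than
    A (Wedderburn's rank reduction). *)
Lemma unitmx_rank1_ind m (P : 'M[k]_m -> Prop) : P 1%:M ->
  (forall x y g, 1%:M + x *m y \in unitmx -> g \in unitmx -> P g ->
     P ((1%:M + (x : 'cV_m) *m (y : 'rV_m)) *m g)) ->
  forall g, g \in unitmx -> P g.
Proof.
move=> P1 PM g; have [n] := ubnP (\rank (g - 1%:M)).
elim: n g => // n IH g; rewrite ltnS => rg gu.
have [A defA] : exists A, A = g - 1%:M by exists (g - 1%:M).
have gE : g = A + 1%:M by rewrite defA subrK.
rewrite -defA in rg.
have [A0|Anz] := eqVneq A 0; first by rewrite gE A0 add0r.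
have [j Aj] : exists j, A *m delta_mx j (0 : 'I_1) != 0.
  apply: contrapT => H; move/eqP: Anz; apply; apply/matrixP => i j; rewrite [RHS]mxE.
  have : A *m delta_mx j (0 : 'I_1) = 0.
    by apply/eqP; apply: contra_notT H => Aj; exists j.
  by rewrite -colE => /matrixP/(_ i 0); rewrite !mxE.
set z : 'cV_m := delta_mx j 0 in Aj.
have gA : g *m A = A *m g by rewrite gE mulmxDr mulmxDl mulmx1 mul1mx.
have Agz : A *m g *m z != 0.
  rewrite -gA -mulmxA; apply: contra_neq Aj => e.
  by rewrite -[A *m z](mulKmx gu) e mulmx0.
have [w [w1 w2]] := form_nz2 Aj Agz.
set c := (w *m (A *m z)) 0 0 in w1.
have wAz : w *m A *m z = c%:M by rewrite -mulmxA [LHS]mx11_scalar.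
pose y := c^-1 *: (w *m A); pose r := 1%:M + (A *m z) *m y.
have yz : y *m z = 1%:M by rewrite /y -scalemxAl wAz scale_scalar_mx mulVf.
have ru : r \in unitmx.
  rewrite unitmxE unitfE /r det_rank1.
  have -> : 1 + (y *m (A *m z)) 0 0 = c^-1 * (w *m (A *m g *m z)) 0 0.
    have -> : A *m g = A + A *m A by rewrite gE mulmxDr mulmx1 addrC.
    rewrite mulmxDl mulmxDr /y -scalemxAl.
    have addE (a b : 'M[k]_1) : (a + b) 0 0 = a 0 0 + b 0 0 by rewrite mxE.
    have scE e (a : 'M[k]_1) : (e *: a) 0 0 = e * a 0 0 by rewrite mxE.
    by rewrite addE scE mulrDr -/c mulVf // !mulmxA.
  by rewrite mulf_neq0 ?invr_neq0.
have gr : g - r = (1%:M - c^-1 *: (A *m z *m w)) *m A.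
  rewrite gE /r /y opprD addrA addrK mulmxBl mul1mx -scalemxAl -scalemxAr.
  by rewrite -!mulmxA.
have grz : (g - r) *m z = 0.
  by rewrite gE mulmxBl /r !mulmxDl !mul1mx -!mulmxA yz mulmx1 [z + _]addrC subrr.
pose h := invmx r *m g.
have hu : h \in unitmx by rewrite unitmx_mul unitmx_inv ru.
have -> : g = r *m h by rewrite mulKVmx.
apply: PM => //; apply: IH => //.
apply: leq_trans rg.
have -> : h - 1%:M = invmx r *m (g - r) by rewrite mulmxBr mulVmx.
apply: leq_ltn_trans (mxrankM_maxr _ _) _.
have sub : (g - r <= A)%MS by rewrite gr submxMl.
rewrite ltnNge; apply/negP => le.
have : (A <= g - r)%MS by rewrite -(geq_leqif (mxrank_leqif_sup sub)).
move=> /submxP[D AD]; move/eqP: Aj; apply.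
by rewrite AD -mulmxA grz mulmx0.
Qed.

(** The only consequence of the rationality of a character that is needed below;
    it involves polynomials in one variable only. *)
Definition line_rational m (chi : 'M[k]_m -> k) :=
  forall A B, exists (d : nat) (p : {poly k}), forall s,
    \det (A + s *: B) != 0 -> chi (A + s *: B) * \det (A + s *: B) ^+ d = p.[s].

(** A rational character of GL_m is a power of the determinant.  Along a line
    of matrices with constant nonzero determinant the character is a polynomial
    without zeros, hence constant.  Moving x and y along such lines identifies
    its value at 1 + x y with that at diag(s,1,..,1), where s = 1 + y x is the
    determinant, and there it is a monomial in s. *)
Lemma rational_character_det m (chi : 'M[k]_m -> k) :
  (forall g, g \in unitmx -> chi g != 0) ->
  (forall g h, g \in unitmx -> h \in unitmx -> chi (g *m h) = chi g * chi h) ->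
  line_rational chi ->
  exists z : int, forall g, g \in unitmx -> chi g = \det g ^ z.
Proof.
move=> chi0 chiM chiL.
have chi1 : chi 1%:M = 1.
  have u1 := @unitmx1 k m; have := chiM _ _ u1 u1; rewrite mulmx1 => /eqP.
  by rewrite -{1}[chi 1%:M]mulr1 (inj_eq (mulfI (chi0 _ u1))) => /eqP.
have linec A B c : c != 0 -> (forall s, \det (A + s *: B) = c) ->
    chi (A + B) = chi A.
  move=> cnz Ac; have [d [p pE]] := chiL A B.
  have pE' s : p.[s] = chi (A + s *: B) * c ^+ d by rewrite -pE Ac.
  have pc : p = (p.[0])%:P.
    apply: nowhere_zero_poly => x.
    by rewrite pE' mulf_neq0 ?expf_neq0 ?chi0 // unitmxE Ac unitfE.
  have := pE' 1; rewrite pc hornerC pE' scale0r addr0 scale1r.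
  by move/mulIf => -> //; rewrite expf_neq0.
pose R1 x y : 'M[k]_m := 1%:M + (x : 'cV_m) *m (y : 'rV_m).
pose f (x : 'cV[k]_m) (y : 'rV[k]_m) := (y *m x) 0 0.
have fDy x y y' : f x (y + y') = f x y + f x y' by rewrite /f mulmxDl mxE.
have fZy x c y : f x (c *: y) = c * f x y by rewrite /f -scalemxAl mxE.
have fDx x x' y : f (x + x') y = f x y + f x' y by rewrite /f mulmxDr mxE.
have fZx x c y : f (c *: x) y = c * f x y by rewrite /f -scalemxAr mxE.
have detR x y : \det (R1 x y) = 1 + f x y by exact: det_rank1.
have movey x y y' : 1 + f x y != 0 -> f x y = f x y' -> chi (R1 x y') = chi (R1 x y).
  move=> nz e; have -> : R1 x y' = R1 x y + x *m (y' - y).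
    by rewrite /R1 mulmxBr addrA addrAC addrK.
  apply: (linec _ _ _ nz) => s; rewrite /R1 -addrA scalemxAr -mulmxDr detR.
  by rewrite fDy fZy fDy -scaleN1r fZy mulN1r e subrr mulr0 addr0.
have movex x x' y : 1 + f x y != 0 -> f x y = f x' y -> chi (R1 x' y) = chi (R1 x y).
  move=> nz e; have -> : R1 x' y = R1 x y + (x' - x) *m y.
    by rewrite /R1 mulmxBl addrA addrAC addrK.
  apply: (linec _ _ _ nz) => s; rewrite /R1 -addrA scalemxAl -mulmxDl detR.
  by rewrite fDx fZx fDx -scaleN1r fZx mulN1r e subrr mulr0 addr0.
have R1u x y : (R1 x y \in unitmx) = (1 + f x y != 0).
  by rewrite unitmxE unitfE detR.
case: m chi chi0 chiM chiL chi1 linec @R1 @f fDy fZy fDx fZx detR movey movex R1u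
  => [|m] chi chi0 chiM chiL chi1 linec R1 f fDy fZy fDx fZx detR movey movex R1u.
  by exists 0 => g gu; rewrite expr0z -chi1; congr chi; apply/matrixP => -[].
pose e0 : 'cV[k]_m.+1 := delta_mx 0 0; pose f0 : 'rV[k]_m.+1 := delta_mx 0 0.
have fe0 c : f e0 (c *: f0) = c.
  by rewrite /f -scalemxAl -colE !mxE !eqxx mulr1.
have [z zE] : exists z : int, forall s, s != 0 -> chi (R1 e0 ((s - 1) *: f0)) = s ^ z.
  have [d [p pE]] := chiL (R1 e0 (- f0)) (e0 *m f0).
  have eL s : R1 e0 (- f0) + s *: (e0 *m f0) = R1 e0 ((s - 1) *: f0).
    rewrite /R1 -addrA scalemxAr -mulmxDr; congr (_ + _ *m _).
    by rewrite scalerBl scale1r addrC.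
  have detE s : \det (R1 e0 ((s - 1) *: f0)) = s.
    by rewrite detR fe0 addrC subrK.
  have {}pE s : s != 0 -> chi (R1 e0 ((s - 1) *: f0)) * s ^+ d = p.[s].
    by move=> snz; rewrite -pE eL detE.
  have pnz s : s != 0 -> p.[s] != 0.
    by move=> snz; rewrite -pE // mulf_neq0 ?expf_neq0 // chi0 // unitmxE detE unitfE.
  have [c [e pc]] := only_zero_root pnz.
  have c1 : c = 1.
    have := pE 1; rewrite pc hornerZ hornerXn !expr1n mulr1 oner_neq0 subrr scale0r.
    by rewrite /R1 mulmx0 addr0 chi1 mulr1 => /(_ isT).
  exists (e%:Z - d%:Z) => s snz; apply: (mulIf (expf_neq0 d snz)).
  by rewrite pE // pc c1 scale1r hornerXn (exprnP s d) -expfzDr // subrK.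
have chiR x y : R1 x y \in unitmx -> chi (R1 x y) = \det (R1 x y) ^ z.
  rewrite R1u detR => nz.
  have zs s : 1 + s != 0 -> chi (R1 e0 (s *: f0)) = (1 + s) ^ z.
    by move=> snz; rewrite -zE // addrC addKr.
  have [f00|fnz] := eqVneq (f x y) 0.
    have fx0 : f x 0 = 0 by rewrite /f mul0mx mxE.
    rewrite (movey x 0 y) ?fx0 ?addr0 ?oner_neq0 //.
    by rewrite f00 /R1 mulmx0 !addr0 chi1 exp1rz.
  have xnz : x != 0 by apply: contra_neq fnz => ->; rewrite /f mulmx0 mxE.
  have e0nz : e0 != 0.
    apply/negP => /eqP/matrixP/(_ 0 0)/eqP.
    by rewrite !mxE !eqxx oner_eq0.
  have [w [w1 w2]] := form_nz2 xnz e0nz.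
  pose y' := (f x y / f x w) *: w.
  have fy' : f x y = f x y' by rewrite fZy divfK.
  have fy0 : f e0 y' != 0.
    by rewrite fZy mulf_neq0 // mulf_neq0 // invr_neq0.
  pose c := f x y / f e0 y'; pose x' := c *: e0.
  have fx' : f x y' = f x' y'.
    by rewrite -fy' fZx divfK.
  have cnz : c != 0 by rewrite mulf_neq0 ?invr_neq0.
  pose y'' := c^-1 *: (f x y *: f0).
  have fy'' : f x' y' = f x' y''.
    by rewrite -fx' -fy' fZy fZx mulrA mulVf // mul1r fe0.
  have nz1 : 1 + f x y' != 0 by rewrite -fy'.
  have nz2 : 1 + f x' y' != 0 by rewrite -fx'.
  rewrite -(movey x y y' nz fy') -(movex x x' y' nz1 fx') -(movey x' y' y'' nz2 fy'').
  have -> : R1 x' y'' = R1 e0 (f x y *: f0).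
    by rewrite /R1 -scalemxAl -scalemxAr scalerA mulfV // scale1r.
  exact: zs.
exists z; apply: unitmx_rank1_ind => [|x y g ru gu IH].
  by rewrite chi1 det1 exp1rz.
by rewrite chiM // IH chiR // det_mulmx expfzMl.
Qed.

End GLChar.

(** * Algebras of functions *)
Section FunAlgebra.
Variables (k : closedFieldType) (T : Type).

Definition fun_algebra (A : (T -> k) -> Prop) : Prop :=
  [/\ forall c, A (fun=> c),
      forall f g, A f -> A g -> A (fun x => f x + g x) &
      forall f g, A f -> A g -> A (fun x => f x * g x)].

Variable A : (T -> k) -> Prop.
Hypothesis algA : fun_algebra A.

Lemma alg_const c : A (fun=> c). Proof. by case: algA. Qed.
Lemma alg_add f g : A f -> A g -> A (fun x => f x + g x). Proof. by case: algA => _ + _; exact. Qed.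
Lemma alg_mul f g : A f -> A g -> A (fun x => f x * g x). Proof. by case: algA => _ _ +; exact. Qed.

Lemma alg_opp f : A f -> A (fun x => - f x).
Proof.
move=> Af; have -> : (fun x => - f x) = (fun x => -1 * f x) by apply/funext => x; rewrite mulN1r.
exact: alg_mul (alg_const _) Af.
Qed.

Lemma alg_exp f m : A f -> A (fun x => f x ^+ m).
Proof.
move=> Af; elim: m => [|m IH]; first exact: alg_const.
have -> : (fun x => f x ^+ m.+1) = (fun x => f x * f x ^+ m) by apply/funext => x; rewrite exprS.
exact: alg_mul.
Qed.

Lemma alg_sum I (r : seq I) (P : pred I) (F : I -> T -> k) :
  (forall i, P i -> A (F i)) -> A (fun x => \sum_(i <- r | P i) F i x).
Proof.
move=> AF; elim: r => [|i r IH].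
  rewrite (_ : (fun x => _) = (fun=> 0)); first exact: alg_const.
  by apply/funext => x; rewrite big_nil.
have [Pi|nPi] := boolP (P i).
  rewrite (_ : (fun x => _) = (fun x => F i x + \sum_(i <- r | P i) F i x)).
    by apply: alg_add IH; exact: AF.
  by apply/funext => x; rewrite big_cons Pi.
rewrite (_ : (fun x => _) = (fun x => \sum_(i <- r | P i) F i x)) //.
by apply/funext => x; rewrite big_cons (negPf nPi).
Qed.

Lemma alg_prod I (r : seq I) (P : pred I) (F : I -> T -> k) :
  (forall i, P i -> A (F i)) -> A (fun x => \prod_(i <- r | P i) F i x).
Proof.
move=> AF; elim: r => [|i r IH].
  rewrite (_ : (fun x => _) = (fun=> 1)); first exact: alg_const.
  by apply/funext => x; rewrite big_nil.
have [Pi|nPi] := boolP (P i).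
  rewrite (_ : (fun x => _) = (fun x => F i x * \prod_(i <- r | P i) F i x)).
    by apply: alg_mul IH; exact: AF.
  by apply/funext => x; rewrite big_cons Pi.
rewrite (_ : (fun x => _) = (fun x => \prod_(i <- r | P i) F i x)) //.
by apply/funext => x; rewrite big_cons (negPf nPi).
Qed.

Lemma alg_meval n (p : {mpoly k[n]}) (c : 'I_n -> T -> k) :
  (forall i, A (c i)) -> A (fun x => p.@[fun i => c i x]).
Proof.
move=> Ac; have -> : (fun x => p.@[fun i => c i x]) =
    (fun x => \sum_(m <- msupp p) p@_m * \prod_i c i x ^+ m i).
  by apply/funext => x; rewrite mevalE.
apply: alg_sum => m _; apply: alg_mul; first exact: alg_const.
by apply: alg_prod => i _; apply: alg_exp.
Qed.

Definition alg_mx m n (M : T -> 'M[k]_(m, n)) := forall i j, A (fun x => M x i j).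

Lemma alg_mx_const m n (M : 'M[k]_(m, n)) : alg_mx (fun=> M).
Proof. by move=> i j; exact: alg_const. Qed.

Lemma alg_mxD m n (M N : T -> 'M[k]_(m, n)) :
  alg_mx M -> alg_mx N -> alg_mx (fun x => M x + N x).
Proof.
move=> AM AN i j; have -> : (fun x => (M x + N x) i j) = (fun x => M x i j + N x i j).
  by apply/funext => x; rewrite mxE.
exact: alg_add.
Qed.

Lemma alg_mxZ m n c (M : T -> 'M[k]_(m, n)) :
  A c -> alg_mx M -> alg_mx (fun x => c x *: M x).
Proof.
move=> Ac AM i j; have -> : (fun x => (c x *: M x) i j) = (fun x => c x * M x i j).
  by apply/funext => x; rewrite mxE.
exact: alg_mul.
Qed.

Lemma alg_mxM m n p (M : T -> 'M[k]_(m, n)) (N : T -> 'M[k]_(n, p)) :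
  alg_mx M -> alg_mx N -> alg_mx (fun x => M x *m N x).
Proof.
move=> AM AN i j; have -> : (fun x => (M x *m N x) i j) = (fun x => \sum_l M x i l * N x l j).
  by apply/funext => x; rewrite mxE.
by apply: alg_sum => l _; apply: alg_mul.
Qed.

Lemma alg_det m (M : T -> 'M[k]_m) : alg_mx M -> A (fun x => \det (M x)).
Proof.
move=> AM; rewrite /determinant; apply: alg_sum => s _.
by apply: alg_mul; [exact: alg_const | apply: alg_prod => i _; exact: AM].
Qed.

Lemma alg_adj m (M : T -> 'M[k]_m) : alg_mx M -> alg_mx (fun x => \adj (M x)).
Proof.
move=> AM i j; have -> : (fun x => (\adj (M x)) i j) = (fun x => cofactor (M x) j i).
  by apply/funext => x; rewrite mxE.
rewrite /cofactor; apply: alg_mul; first exact: alg_const.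
apply: alg_det => a b.
have -> : (fun x => row' j (col' i (M x)) a b) = (fun x => M x (lift j a) (lift i b)).
  by apply/funext => x; rewrite !mxE.
exact: AM.
Qed.

Lemma alg_mx_cast m n m' n' (e : (m = m') * (n = n')) (M : T -> 'M[k]_(m, n)) :
  alg_mx M -> alg_mx (fun x => castmx e (M x)).
Proof.
move=> AM i j; have -> : (fun x => castmx e (M x) i j) =
   (fun x => M x (cast_ord (esym e.1) i) (cast_ord (esym e.2) j)).
  by apply/funext => x; rewrite castmxE.
exact: AM.
Qed.

Lemma alg_row_mx m n1 n2 (M : T -> 'M[k]_(m, n1)) (N : T -> 'M[k]_(m, n2)) :
  alg_mx M -> alg_mx N -> alg_mx (fun x => row_mx (M x) (N x)).
Proof.
move=> AM AN i j; have -> : (fun x => row_mx (M x) (N x) i j) =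
   (fun x => match fintype.split j with inl l => M x i l | inr l => N x i l end).
  by apply/funext => x; rewrite mxE.
by case: (fintype.split j).
Qed.

(** Stands for the localization of [A] at [delta]: only the values at the points
    where [delta] is not zero matter. *)
Definition localization (delta h : T -> k) : Prop :=
  exists (d : nat) (P : T -> k), A P /\
    forall x, delta x != 0 -> h x * delta x ^+ d = P x.

Lemma localization_sub delta h : A h -> localization delta h.
Proof. by move=> Ah; exists 0%N, h; split=> // x _; rewrite expr0 mulr1. Qed.

Lemma localization_alg delta : A delta -> fun_algebra (localization delta).
Proof.
move=> Ad; split=> [c|f g [d [P [AP fP]]] [e [R [AR gR]]]|f g [d [P [AP fP]]] [e [R [AR gR]]]].
- by apply: localization_sub; exact: alg_const.
- exists (d + e)%N, (fun x => P x * delta x ^+ e + R x * delta x ^+ d); split.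
    by apply: alg_add; apply: alg_mul => //; apply: alg_exp.
  move=> x dx; rewrite -fP // -gR // mulrDl exprD mulrA; congr (_ + _).
  by rewrite -!mulrA; congr (_ * _); rewrite mulrC.
- exists (d + e)%N, (fun x => P x * R x); split; first exact: alg_mul.
  by move=> x dx; rewrite -fP // -gR // exprD mulrACA.
Qed.

Lemma localization_inv delta h : A h ->
  (forall x, delta x != 0 -> h x != 0) ->
  (exists g, A g /\ forall x, h x * g x = delta x) ->
  localization delta (fun x => (h x)^-1).
Proof.
move=> Ah hnz [g [Ag hg]]; exists 1%N, g; split=> // x dx.
by rewrite expr1 -hg mulKf // hnz.
Qed.

End FunAlgebra.

Section Regular.
Variables (k : closedFieldType) (X : gvariety k).

Lemma regular_alg : fun_algebra (@regular k X).
Proof.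
split=> [c|f g [p pE] [q qE]|f g [p pE] [q qE]].
- by exists c%:MP => x; rewrite mevalC.
- by exists (p + q) => x; rewrite pE qE mevalD.
- by exists (p * q) => x; rewrite pE qE mevalM.
Qed.

Lemma regular_coord (i : coord_index X) : regular (fun x => coord i x).
Proof. by exists 'X_(enum_rank i) => x; rewrite mevalXU enum_rankK. Qed.

(** Reduces regularity to coordinates.  Taking for [A] the polynomials in one
    variable, or a localization, it also describes regular functions along curves
    and on principal open sets. *)
Lemma regular_comp T (A : (T -> k) -> Prop) (phi : T -> pt X) f :
  fun_algebra A -> (forall i, A (fun y => coord i (phi y))) -> @regular k X f ->
  A (fun y => f (phi y)).
Proof.
move=> algA Ac [p pE].
have -> : (fun y => f (phi y)) = (fun y => p.@[fun i => coord (enum_val i) (phi y)]).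
  by apply/funext => y; rewrite pE.
exact: alg_meval.
Qed.

Lemma regular_eq (f : pt X -> k) x y : regular f ->
  (forall i, coord i x = coord i (y : pt X)) -> f x = f y.
Proof.
by move=> [p pE] e; rewrite !pE; apply: meval_eq => i; exact: e.
Qed.

Definition polyfun (h : k -> k) := exists p : {poly k}, forall s, h s = p.[s].

Lemma polyfun_alg : fun_algebra polyfun.
Proof.
split=> [c|f g [p pE] [q qE]|f g [p pE] [q qE]].
- by exists c%:P => s; rewrite hornerC.
- by exists (p + q) => s; rewrite hornerD pE qE.
- by exists (p * q) => s; rewrite hornerM pE qE.
Qed.

Lemma polyfun_id : polyfun id.
Proof. by exists 'X => s; rewrite hornerX. Qed.

(** Both varieties of interest are affine spaces.  Lines between any two points
    reduce statements on their coordinate rings, which are domains without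
    nonconstant units, to polynomials in one variable. *)
Definition has_lines := forall x y : pt X, exists phi : k -> pt X, forall t i,
  coord i (phi t) = coord i x + t * (coord i y - coord i x).

Hypothesis linesX : has_lines.

Lemma regular_line x y : exists phi : k -> pt X, forall f : pt X -> k, regular f ->
  exists p : {poly k}, [/\ forall t, f (phi t) = p.[t], p.[0] = f x & p.[1] = f y].
Proof.
have [phi phiE] := linesX x y; exists phi => f fr.
have [p pE] : polyfun (fun t => f (phi t)).
  apply: regular_comp fr => [|i]; first exact: polyfun_alg.
  exists ((coord i x)%:P + (coord i y - coord i x) *: 'X) => t.
  by rewrite phiE !hornerE mulrC.
exists p; split=> //; rewrite -pE; apply: regular_eq => // i; rewrite phiE.
  by rewrite mul0r addr0.
by rewrite mul1r addrC subrK.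
Qed.

Lemma regular_neq0_mul (f g : pt X -> k) x y : regular f -> regular g -> f x != 0 -> g y != 0 ->
  exists z, f z != 0 /\ g z != 0.
Proof.
move=> fr gr fx gy; have [phi phiP] := regular_line x y.
have [p [pE p0 _]] := phiP f fr; have [q [qE _ q1]] := phiP g gr.
have pnz : p != 0 by apply: contra_neq fx => p_0; rewrite -p0 p_0 horner0.
have qnz : q != 0 by apply: contra_neq gy => q_0; rewrite -q1 q_0 horner0.
have := mulf_neq0 pnz qnz => /closed_nonrootP[t].
rewrite /root hornerM mulf_eq0 negb_or => /andP[pt qt].
by exists (phi t); rewrite pE qE.
Qed.

Lemma regular_dense (f g : pt X -> k) y : regular f -> regular g -> g y != 0 ->
  (forall x, g x != 0 -> f x = 0) -> forall x, f x = 0.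
Proof.
move=> fr gr gy fg x; apply/eqP; apply: contraT => fx.
have [z [fz gz]] := regular_neq0_mul fr gr fx gy.
by rewrite fg ?eqxx in fz.
Qed.

Lemma regular_nowhere_zero (f : pt X -> k) : regular f -> (forall x, f x != 0) ->
  forall x y, f x = f y.
Proof.
move=> fr fnz x y; have [phi phiP] := regular_line x y.
have [p [pE <- <-]] := phiP f fr.
by rewrite (@nowhere_zero_poly _ p) ?hornerC // => t; rewrite -pE.
Qed.

End Regular.

(** * Extension of regular functions across a divisor *)
Section TopCoef.
Variable k : closedFieldType.

Definition top_coef m (c : k) (p : {poly k}) := (size p <= m.+1)%N /\ p`_m = c.

Lemma top_coefM m n c d p q : top_coef m c p -> top_coef n d q ->
  top_coef (m + n) (c * d) (p * q).
Proof.
move=> [sp <-] [sq <-]; split.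
  apply: leq_trans (size_polyMleq _ _) _.
  by rewrite -ltnS -addnS; case: (size p + size q)%N (leq_add sp sq) => //= l; rewrite addSn addnS.
rewrite coefM (bigD1 (inord m)) //= inordK ?ltnS ?leq_addr // addKn big1 ?addr0 // => i.
move=> /eqP ne; have [lt|ge] := ltnP m i.
  by rewrite nth_default ?mul0r //; apply: leq_trans sp lt.
have [eqi|ne'] := eqVneq (i : nat) m.
  by case: ne; apply: val_inj; rewrite /= inordK ?ltnS ?leq_addr.
rewrite [q`_ _]nth_default ?mulr0 //; apply: leq_trans sq _.
rewrite ltn_subRL ltn_add2r.
by rewrite ltn_neqAle ne'.
Qed.

Lemma top_coef1 : top_coef 0 1 (1 : {poly k}).
Proof. by split; rewrite ?size_poly1 // coef1. Qed.

Lemma top_coef_prod I (r : seq I) (P : pred I) (m : I -> nat) (c : I -> k) (p : I -> {poly k}) :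
  (forall i, P i -> top_coef (m i) (c i) (p i)) ->
  top_coef (\sum_(i <- r | P i) m i) (\prod_(i <- r | P i) c i) (\prod_(i <- r | P i) p i).
Proof.
move=> H; apply: (big_ind3 (fun m c p => top_coef m c p)) => //; first exact: top_coef1.
by move=> m1 c1 p1 m2 c2 p2; exact: top_coefM.
Qed.

Lemma top_coef_exp m c p K : top_coef m c p -> top_coef (m * K) (c ^+ K) (p ^+ K).
Proof.
move=> H; elim: K => [|K IH]; first by rewrite muln0 !expr0; exact: top_coef1.
by rewrite mulnS !exprS; exact: top_coefM.
Qed.

(** Every term of the Leibniz formula takes one entry from each column, so its
    part of degree [\sum_j m j] is the product of the parts of degrees [m j]. *)
Lemma top_coef_det l (m : 'I_l -> nat) (C : 'M[k]_l) (M : 'M[{poly k}]_l) :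
  (forall i j, top_coef (m j) (C i j) (M i j)) ->
  top_coef (\sum_j m j) (\det C) (\det M).
Proof.
move=> H.
have key (s : 'S_l) : top_coef (\sum_j m j) ((-1) ^+ s * \prod_i C i (s i))
    ((-1) ^+ s * \prod_i M i (s i)).
  have -> : (\sum_j m j = \sum_i m (s i))%N by rewrite (reindex_inj (@perm_inj _ s)).
  rewrite -[X in top_coef X]add0n; apply: top_coefM; last by apply: top_coef_prod.
  case: (odd_perm s); rewrite ?expr0 ?expr1; last exact: top_coef1.
  by split; rewrite ?size_polyN ?size_poly1 // coefN coef1.
rewrite /determinant; split.
  apply: leq_trans (size_sum _ _ _) _; apply/bigmax_leqP => s _.
  by have [] := key s.
by rewrite coef_sum; apply: eq_bigr => s _; have [] := key s.
Qed.

End TopCoef.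

Section Hartogs.
Variables (k : closedFieldType) (X : gvariety k).
Notation T := (pt X).

(** A polynomial over the ring of regular functions, given by its
    specializations *)
Definition poly_family (P : T -> {poly k}) :=
  (exists m, forall x, (size (P x) <= m)%N) /\ forall i, regular (fun x => (P x)`_i).

Lemma poly_familyD P Q : poly_family P -> poly_family Q -> poly_family (fun x => P x + Q x).
Proof.
move=> [[m sP] cP] [[l sQ] cQ]; split.
  exists (maxn m l) => x; apply: leq_trans (size_polyD _ _) _.
  by rewrite geq_max !leq_max sP sQ orbT.
move=> i; have -> : (fun x => (P x + Q x)`_i) = (fun x => (P x)`_i + (Q x)`_i).
  by apply/funext => x; rewrite coefD.
by apply: (alg_add (regular_alg X)); [exact: cP | exact: cQ].
Qed.

Lemma poly_familyM P Q : poly_family P -> poly_family Q -> poly_family (fun x => P x * Q x).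
Proof.
move=> [[m sP] cP] [[l sQ] cQ]; split.
  exists (m + l)%N => x; apply: leq_trans (size_polyMleq _ _) _.
  by apply: leq_trans (leq_pred _) _; rewrite leq_add.
move=> i; have -> : (fun x => (P x * Q x)`_i) =
    (fun x => \sum_(j < i.+1) (P x)`_j * (Q x)`_(i - j)).
  by apply/funext => x; rewrite coefM.
apply: (alg_sum (regular_alg X)) => j _.
by apply: (alg_mul (regular_alg X)); [exact: cP | exact: cQ].
Qed.

Lemma poly_familyC (c : T -> k) : regular c -> poly_family (fun x => (c x)%:P).
Proof.
move=> rc; split; first by exists 1%N => x; exact: size_polyC_leq1.
move=> i; have -> : (fun x => (c x)%:P`_i) = (if i == 0%N then c else fun=> 0).
  by apply/funext => x; rewrite coefC; case: ifP.
by case: ifP => // _; exact: alg_const (regular_alg X) _.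
Qed.

Lemma poly_family_const p : poly_family (fun=> p).
Proof.
by split=> [|i]; [exists (size p) | exact: alg_const (regular_alg X) _].
Qed.

Lemma regular_poly_family sh e
    (shE : forall (x : pt X) t i, coord i (sh x t) = coord i x + t * e i) (f : T -> k) :
  regular f -> exists2 P, poly_family P & forall x t, f (sh x t) = (P x).[t].
Proof.
move=> fr; pose A (h : T * k -> k) := exists2 P, poly_family P & forall x t, h (x, t) = (P x).[t].
have algA : fun_algebra A.
  split=> [c|h g [P fP hP] [Q fQ gQ]|h g [P fP hP] [Q fQ gQ]].
  - by exists (fun=> c%:P); [exact: poly_family_const | move=> x t; rewrite hornerC].
  - by exists (fun x => P x + Q x); [exact: poly_familyD | move=> x t; rewrite hP gQ hornerD].
  - by exists (fun x => P x * Q x); [exact: poly_familyM | move=> x t; rewrite hP gQ hornerM].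
have := @regular_comp _ X (T * k) A (fun xt => sh xt.1 xt.2) f algA.
case=> [i||P fP PE] //; last by exists P => // x t; rewrite -PE.
exists (fun x => (coord i x)%:P + (e i)%:P * 'X).
  apply: poly_familyD; first by apply: poly_familyC; exact: regular_coord.
  exact: poly_familyM (poly_family_const _) (poly_family_const _).
by move=> x t; rewrite /= shE hornerD hornerCM hornerC hornerX mulrC.
Qed.

(** Pseudo-division over the ring of regular functions by the coefficient in a
    fixed degree m, which may vanish at some points *)
Lemma poly_family_edivp m (D P : T -> {poly k}) :
  poly_family D -> (forall x, (size (D x) <= m.+1)%N) -> poly_family P ->
  exists s Q R, [/\ poly_family Q, poly_family R,
    forall x, (size (R x) <= m)%N &
    forall x, (D x)`_m ^+ s *: P x = Q x * D x + R x].
Proof.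
move=> fD sD [[M sP] cP]; elim: M P sP cP => [|M IH] P sP cP.
  exists 0%N, (fun=> 0), P; split=> [||x|x].
  - exact: poly_family_const.
  - by split=> //; exists 0%N.
  - exact: leq_trans (sP x) _.
  - by rewrite expr0 scale1r mul0r add0r.
have fP : poly_family P by split=> //; exists M.+1.
have [leM|ltM] := leqP M.+1 m.
  exists 0%N, (fun=> 0), P; split=> // [|x|x].
  - exact: poly_family_const.
  - exact: leq_trans (sP x) leM.
  - by rewrite expr0 scale1r mul0r add0r.
have [_ cD] := fD.
pose q x : {poly k} := ((P x)`_M)%:P * 'X^(M - m).
have fq : poly_family q by exact: poly_familyM (poly_familyC (cP M)) (poly_family_const _).
pose P' x := ((D x)`_m)%:P * P x - q x * D x.
have fP' : poly_family P'.
  have -> : P' = (fun x => ((D x)`_m)%:P * P x + (-1)%:P * (q x * D x)).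
    by apply/funext => x; rewrite /P' polyCN mulN1r.
  apply: poly_familyD; first exact: poly_familyM (poly_familyC (cD m)) fP.
  exact: poly_familyM (poly_family_const _) (poly_familyM fq fD).
have sP' x : (size (P' x) <= M)%N.
  have le : (m <= M)%N by rewrite -ltnS.
  have [||s1 t1] := @top_coefM k 0 M (D x)`_m (P x)`_M ((D x)`_m)%:P (P x).
  - by split; rewrite ?size_polyC_leq1 // coefC.
  - by split.
  have tq : top_coef (M - m) (P x)`_M (q x).
    rewrite -[(M - m)%N]add0n -[(P x)`_M]mulr1; apply: top_coefM.
      by split; rewrite ?size_polyC_leq1 // coefC.
    by split; rewrite ?size_polyXn // coefXn eqxx.
  have [|s2 t2] := @top_coefM _ _ m _ (D x)`_m _ (D x) tq; first by split.
  rewrite subnK // in s2 t2.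
  have sM : (size (P' x) <= M.+1)%N.
    apply: leq_trans (size_polyD _ _) _.
    by rewrite size_polyN geq_max s2 s1.
  apply/leq_sizeP => j; rewrite leq_eqVlt => /orP[/eqP<-|lt]; last first.
    by apply: nth_default; exact: leq_trans sM lt.
  by rewrite coefB t2 t1 mulrC subrr.
have [s [Q [R [fQ fR sR e]]]] := IH _ sP' fP'.2.
exists s.+1, (fun x => Q x + ((D x)`_m ^+ s)%:P * q x), R; split=> //.
  apply: poly_familyD => //; apply: poly_familyM fq.
  by apply: poly_familyC; apply: (alg_exp (regular_alg X)); exact: cD.
move=> x; rewrite exprSr -scalerA mulrDl addrAC -e /P' mul_polyC scalerBr.
by rewrite -mulrA mul_polyC subrK.
Qed.

Hypothesis linesX : has_lines X.

(** Divide P by D as polynomials along the lines of direction e; the factors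
    [L x ^+ s] come from this pseudo-division.  Where kappa does not vanish,
    the hypothesis on the zeros of D on the line makes D divide P there, so the
    remainder is zero, as its degree is less than that of D.  By density the
    remainder is zero everywhere; put t = 0. *)
Lemma hartogs_step sh e (shE : forall (x : pt X) t i, coord i (sh x t) = coord i x + t * e i)
    (P D L kappa : T -> k) m x0 :
  regular P -> regular D -> regular L -> regular kappa -> kappa x0 != 0 ->
  (forall x, exists2 p : {poly k}, forall t, p.[t] = D (sh x t) & top_coef m (L x) p) ->
  (forall x, kappa x != 0 -> L x != 0 /\ forall t0, D (sh x t0) = 0 ->
     exists2 b : {poly k}, b.[t0] != 0 & exists b' : {poly k},
       forall t, P (sh x t) * b.[t] = b'.[t] * D (sh x t)) ->
  exists s Q, regular Q /\ forall x, L x ^+ s * P x = Q x * D x.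
Proof.
move=> rP rD rL depth k0 Dtop Dvd.
have [FP fP PE] := regular_poly_family shE rP.
have [FD fD DE] := regular_poly_family shE rD.
have topD x : top_coef m (L x) (FD x).
  by have [p pE tp] := Dtop x; rewrite (@horner_ext _ (FD x) p) // => t; rewrite pE DE.
have sD x : (size (FD x) <= m.+1)%N by have [] := topD x.
have [s [Q [R [fQ fR sR e_div]]]] := poly_family_edivp fD sD fP.
have sh0 (f : T -> k) x : regular f -> f (sh x 0) = f x.
  by move=> fr; apply: regular_eq => // i; rewrite shE mul0r addr0.
have R0 : forall x, (R x).[0] = 0.
  have r0 : regular (fun x => (R x).[0]).
    have [_ fR0] := fR; move: (fR0 0%N); congr regular; apply/funext => x.
    by rewrite horner_coef0.
  apply: (regular_dense linesX r0 depth k0) => x kx.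
  have [Lx dv] := Dvd x kx.
  have [szD cD] := topD x.
  have Dnz : FD x != 0 by apply: contra_neq Lx => D0; rewrite -cD D0 coef0.
  have : FD x %| FP x.
    apply: dvdp_at_roots => // t0 /rootP; rewrite -DE => /dv[b bt [b' e']].
    exists b => //; apply/dvdpP; exists b'.
    by apply: horner_ext => t; rewrite !hornerM -PE e' DE.
  move=> dP; have : FD x %| R x.
    have -> : R x = (FD x)`_m ^+ s *: FP x - Q x * FD x by rewrite e_div addrC addKr.
    by rewrite dvdp_sub ?dvdp_mull ?dvdpp // dvdpZr ?expf_neq0 ?cD.
  have [->|Rnz] := eqVneq (R x) 0; first by rewrite horner0.
  move/(dvdp_leq Rnz); rewrite leqNgt => /negP[].
  apply: leq_ltn_trans (sR x) _; rewrite ltnNge; apply/negP => szm.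
  by move: Lx; rewrite -cD nth_default ?eqxx.
exists s, (fun x => (Q x).[0]); split.
  have [_ fQ0] := fQ; move: (fQ0 0%N); congr regular; apply/funext => x.
  by rewrite horner_coef0.
move=> x; rewrite -(sh0 P x) // -(sh0 D x) // PE DE.
have [_ <-] := topD x.
by rewrite -hornerZ e_div hornerD hornerM R0 addr0.
Qed.

End Hartogs.

(** * Morphisms out of projective representations *)
Section ProjectiveHoms.
Variables (k : closedFieldType) (n : nat) (Q : quiver n).
Hypothesis hQ : acyclic Q.
Local Notation P gamma := (@projrep k n Q gamma).

Lemma hom_eq d1 d2 (V : rep k Q d1) (W : rep k Q d2) (f g : hom V W) :
  (forall v, f v = g v) -> f = g.
Proof.
case: f g => [f fP] [g gP] /= e; have efg : f = g by apply: functional_extensionality_dep.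
by case: g / efg gP {e} => gP; congr Hom; exact: Prop_irrelevance.
Qed.

Lemma aut_eq d (V : rep k Q d) (f g : aut V) : (forall v, f v = g v) -> f = g.
Proof.
case: f g => [f fP] [g gP] /= e; have efg : f = g by exact: hom_eq.
by case: g / efg gP {e} => gP; congr Aut; exact: Prop_irrelevance.
Qed.

Lemma gl_eq (d : 'I_n -> nat) (f g : gl k d) : (forall v, f v = g v) -> f = g.
Proof.
case: f g => [f fP] [g gP] /= e; have efg : f = g by apply: functional_extensionality_dep.
by case: g / efg gP {e} => gP; congr GL; exact: Prop_irrelevance.
Qed.

Lemma hom_compE d1 d2 d3 (U : rep k Q d1) (V : rep k Q d2) (W : rep k Q d3)
  (g : hom V W) (f : hom U V) v : hom_comp g f v = g v *m f v.
Proof. by []. Qed.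

Lemma aut_mulE d (V : rep k Q d) (f g : aut V) v : aut_mul f g v = f v *m g v.
Proof. by []. Qed.

(** Increases along arrows, so that it serves as the measure for inductions
    along the quiver *)
Definition depth (v : 'I_n) : nat :=
  \max_(x : Pbasis Q (fun=> 1%N) v) size (Ppath x).

Lemma depth_lt (a : arrow Q) : (depth (tl a) < depth (hd a))%N.
Proof.
have [x ->] : exists x : Pbasis Q (fun=> 1%N) (tl a), depth (tl a) = size (Ppath x).
  have [|x e] := @eq_bigmax _ (fun x : Pbasis Q (fun=> 1%N) (tl a) => size (Ppath x)).
    apply/card_gt0P.
    by exists (Tagged (fun v' => 'I_1 * qpath Q v' (tl a))%type (ord0, qpath_nil Q (tl a))).
  by exists x.
have [y _ py] := Pbasis_rcons hQ x.
have := leq_bigmax (F := fun x : Pbasis Q (fun=> 1%N) (hd a) => size (Ppath x)) y.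
by rewrite py size_rcons.
Qed.

(** The inclusion of the generators of P(gamma) at v *)
Definition gens (gamma : 'I_n -> nat) v : 'M[k]_(Pdim Q gamma v, gamma v) :=
  \matrix_(c, i) (c == Pone Q i)%:R.

(** The projection onto the generators of P(gamma) at v, which kills all
    nontrivial paths *)
Definition top (gamma : 'I_n -> nat) v : 'M[k]_(gamma v, Pdim Q gamma v) :=
  (gens gamma v)^T.

Lemma mul_gens gamma v m (B : 'M_(m, Pdim Q gamma v)) r i :
  (B *m gens gamma v) r i = B r (Pone Q i).
Proof.
rewrite mxE (bigD1 (Pone Q i)) //= big1 ?addr0 ?mxE ?eqxx ?mulr1 // => c.
by rewrite mxE => /negPf->; rewrite mulr0.
Qed.

Lemma Pone_inj gamma v : injective (@Pone n Q gamma v).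
Proof.
move=> i j /enum_rank_inj /(congr1 (@Pgen n Q gamma v)); rewrite /Pgen /= => /eqP.
by rewrite eq_Tagged /= => /eqP.
Qed.

Lemma top_gens gamma v : top gamma v *m gens gamma v = 1%:M.
Proof.
by apply/matrixP => i j; rewrite mul_gens !mxE (inj_eq (@Pone_inj gamma v)) eq_sym.
Qed.

Lemma top_rad gamma a : top gamma (hd a) *m P gamma a = 0.
Proof.
apply/matrixP => i j; rewrite !mxE big1 // => c _; rewrite !mxE.
case: eqP => [->|]; last by rewrite mul0r.
have nr s : ([::] == rcons s a) = false by case: s.
by rewrite enum_rankK {1}/Ppath /= nr andbF mulr0.
Qed.

Lemma mul_projrep gamma a m (B : 'M[k]_(m, Pdim Q gamma (hd a))) r
    (x : Pbasis Q gamma (tl a)) (y : Pbasis Q gamma (hd a)) :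
  Pgen y = Pgen x -> Ppath y = rcons (Ppath x) a ->
  (B *m P gamma a) r (enum_rank x) = B r (enum_rank y).
Proof.
move=> gx px; rewrite mxE (bigD1 (enum_rank y)) //= big1 ?addr0.
  by rewrite mxE /= !enum_rankK gx px !eqxx mulr1.
move=> l ly; rewrite [X in _ * X]mxE /= enum_rankK; case: eqP => [gl|_]; last by rewrite mulr0.
case: eqP => [pl|_]; last by rewrite mulr0.
case/eqP: ly; rewrite -[l]enum_valK; congr enum_rank.
by apply: Pbasis_inj; rewrite ?gl ?pl ?gx ?px.
Qed.

Lemma Ppath_nil gamma v (y : Pbasis Q gamma v) : Ppath y = [::] ->
  exists i, enum_rank y = Pone Q i.
Proof.
case: y => [u [i [p hp]]] p0; rewrite /Ppath /= in p0.
have uv : u = v by move: hp; rewrite p0 => /eqP.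
case: v / uv hp p0 => hp p0; exists i; congr enum_rank.
by apply: Pbasis_inj.
Qed.

(** P(gamma)_v is spanned by the generators at v and the images of the arrows
    into v; in dual form: *)
Lemma zero_on_gens_rad gamma v m (B : 'M[k]_(m, Pdim Q gamma v)) :
  B *m gens gamma v = 0 ->
  (forall a (e : hd a = v),
     castmx (erefl, congr1 (Pdim Q gamma) (esym e)) B *m P gamma a = 0) ->
  B = 0.
Proof.
move=> Bg Br; apply/matrixP => r c; rewrite mxE -[c]enum_valK.
case/lastP py: (Ppath (enum_val c)) => [|p a].
  by have [i ->] := Ppath_nil py; rewrite -mul_gens Bg mxE.
have hp : is_path (tag (enum_val c)) v (rcons p a).
  by rewrite -py; exact: valP (tagged (enum_val c)).2.
move: hp; rewrite is_path_rcons => /andP[_ /eqP e].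
case: v / e B Bg Br c py => B Bg /(_ _ erefl); rewrite castmx_id => Br c py.
have [x gx px] := Pbasis_belast py.
by rewrite -(@mul_projrep _ a _ B r x) ?gx ?px // Br mxE.
Qed.

Lemma hom_agree gamma d (W : rep k Q d) (f g : hom (P gamma) W) v :
  (forall u, (depth u < depth v)%N || (u == v) -> f u *m gens gamma u = g u *m gens gamma u) ->
  f v = g v.
Proof.
have [m] := ubnP (depth v); elim: m v => // m IH v; rewrite ltnS => rv H.
apply/eqP; rewrite -subr_eq0; apply/eqP; apply: zero_on_gens_rad.
  by rewrite mulmxBl H ?subrr // eqxx orbT.
move=> a e; case: v / e rv H => rv H; rewrite castmx_id mulmxBl !hom_comm.
rewrite (IH (tl a)) ?subrr //; first exact: leq_trans (depth_lt a) rv.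
move=> u /orP[lt|/eqP->]; apply: H; rewrite ?depth_lt //.
by rewrite (ltn_trans lt (depth_lt a)).
Qed.

Lemma hom_gens_eq gamma d (W : rep k Q d) (f g : hom (P gamma) W) :
  (forall u, f u *m gens gamma u = g u *m gens gamma u) -> f = g.
Proof. by move=> H; apply: hom_eq => v; apply: hom_agree. Qed.

Section Lift.
Variables (gamma d : 'I_n -> nat) (W : rep k Q d).
Implicit Type x : forall v, 'M[k]_(d v, gamma v).

Definition lift_mx x u : 'M[k]_(d u, Pdim Q gamma u) :=
  \matrix_(r, c) let y := enum_val c : Pbasis Q gamma u in
    (path_mx W (tag y) u (Ppath y) *m x (tag y)) r (tagged y).1.

Fact lift_comm x a : lift_mx x (hd a) *m P gamma a = W a *m lift_mx x (tl a).
Proof.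
apply/matrixP => r c; rewrite -{1}[c]enum_valK.
have [y gy py] := Pbasis_rcons hQ (enum_val c).
rewrite (mul_projrep _ _ gy py) mxE enum_rankK /= py [RHS]mxE.
under [RHS]eq_bigr do rewrite mxE.
have hp : is_path (tag (enum_val c)) (tl a) (Ppath (enum_val c)) := valP (tagged (enum_val c)).2.
case: y (enum_val c) gy py hp => [v [i1 q1]] [w [i2 q2]] /= e py hp.
have ew : v = w by exact: (congr1 tag e).
case: w / ew in i2 q2 e py hp *.
move/eqP: e; rewrite eq_Tagged /= => /eqP ->.
by rewrite path_mx_rcons // -mulmxA mxE.
Qed.

Definition lift x : hom (P gamma) W := Hom (lift_comm x).

Lemma lift_gens x v : lift x v *m gens gamma v = x v.
Proof.
apply/matrixP => r i; rewrite mul_gens /= mxE enum_rankK /= conform_mx_id.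
by rewrite mul1mx.
Qed.

End Lift.

Definition hom_id d (V : rep k Q d) : hom V V.
Proof. by exists (fun v => 1%:M) => a; rewrite mul1mx mulmx1. Defined.

Definition hom_lin d1 d2 (V : rep k Q d1) (W : rep k Q d2) (f : hom V W) (c : k) (g : hom V W) :
  hom V W.
Proof.
exists (fun v => f v + c *: g v) => a.
by rewrite mulmxDl mulmxDr -scalemxAl -scalemxAr !hom_comm.
Defined.

(** The block of a morphism P(gamma) -> P(delta) on generators at v *)
Definition hom_top gamma delta (f : hom (P gamma) (P delta)) v : 'M[k]_(delta v, gamma v) :=
  top delta v *m f v *m gens gamma v.

(** Nontrivial paths are mapped to combinations of nontrivial paths. *)
Lemma top_hom gamma delta (f : hom (P gamma) (P delta)) v :
  top delta v *m f v = hom_top f v *m top gamma v.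
Proof.
apply/eqP; rewrite -subr_eq0; apply/eqP; apply: zero_on_gens_rad.
  by rewrite mulmxBl -[hom_top _ _ *m _ *m _]mulmxA top_gens mulmx1 subrr.
move=> a e; case: v / e; rewrite castmx_id mulmxBl.
by rewrite -!mulmxA hom_comm (top_rad gamma) !mulmx0 subr0 mulmxA (top_rad delta) mul0mx.
Qed.

Lemma hom_top_comp gamma delta eps (g : hom (P delta) (P eps)) (f : hom (P gamma) (P delta)) v :
  hom_top (hom_comp g f) v = hom_top g v *m hom_top f v.
Proof. by rewrite {1}/hom_top /= mulmxA top_hom -!mulmxA /hom_top !mulmxA. Qed.

Lemma iso_of_units d (V : rep k Q d) (f : hom V V) : (forall v, f v \in unitmx) -> is_iso f.
Proof.
move=> fu; have comm a : invmx (f (hd a)) *m V a = V a *m invmx (f (tl a)).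
  by rewrite -[LHS](mulmxK (fu (tl a))) -[_ *m V a *m _]mulmxA -hom_comm mulKmx.
by exists (@Hom _ _ _ _ _ V V (fun v => invmx (f v)) comm) => v /=; rewrite mulVmx ?mulmxV.
Qed.

Lemma aut_unit d (V : rep k Q d) (f : aut V) v : f v \in unitmx.
Proof. by have [g gP] := autP f; have [_ /mulmx1_unit[]] := gP v. Qed.

Lemma row_neq0 m l (B : 'M[k]_(m, l)) : (forall i, row i B = 0) -> B = 0.
Proof. by move=> H; apply/row_matrixP => i; rewrite H row0. Qed.

Lemma unitmx_ker m (B : 'M[k]_m) : (forall x : 'rV_m, x *m B = 0 -> x = 0) -> B \in unitmx.
Proof.
move=> H; rewrite -row_free_unit -kermx_eq0; apply/eqP/row_neq0 => i.
by apply: H; apply/sub_kermxP; exact: row_sub.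
Qed.

(** This is Nakayama's lemma.  A row vector killed by f_v restricts along each
    arrow into v to one that is killed by f at the tail, so by induction it
    factors through the projection onto the generators at v. *)
Lemma hom_top_iso gamma (f : hom (P gamma) (P gamma)) :
  (forall v, hom_top f v \in unitmx) -> is_iso f.
Proof.
move=> fu; apply: iso_of_units => v; apply: unitmx_ker.
have [m] := ubnP (depth v); elim: m v => // m IH v; rewrite ltnS => rv x xf.
have xr a (e : hd a = v) : castmx (erefl, congr1 (Pdim Q gamma) (esym e)) x *m P gamma a = 0.
  case: v / e in rv x xf *; rewrite castmx_id.
  apply: (IH (tl a)); first exact: leq_trans (depth_lt a) rv.
  by rewrite -mulmxA -hom_comm mulmxA xf mul0mx.
have xt : x = x *m gens gamma v *m top gamma v.
  apply/eqP; rewrite -subr_eq0; apply/eqP; apply: zero_on_gens_rad.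
    by rewrite mulmxBl -[_ *m top _ _ *m _]mulmxA top_gens mulmx1 subrr.
  move=> a e; move: (xr a e); case: v / e in rv x xf xr *; rewrite !castmx_id mulmxBl => ->.
  by rewrite -!mulmxA top_rad !mulmx0 subrr.
have e0 : x *m gens gamma v *m hom_top f v = 0 by rewrite !mulmxA -xt xf mul0mx.
have e1 : x *m gens gamma v = 0 by rewrite -[LHS](mulmxK (fu v)) e0 mul0mx.
by rewrite xt e1 mul0mx.
Qed.

Lemma hom_top_unit gamma (f : aut (P gamma)) v : hom_top f v \in unitmx.
Proof.
have [g gP] := autP f.
have fg : hom_top f v *m hom_top g v = 1%:M.
  by rewrite -hom_top_comp /hom_top /=; have [_ ->] := gP v; rewrite mulmx1 top_gens.
by have [] := mulmx1_unit fg.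
Qed.

Definition embed_hom gamma (g : forall v, 'M[k]_(gamma v)) : hom (P gamma) (P gamma) :=
  lift (P gamma) (fun v => gens gamma v *m g v).

Lemma embed_top gamma (g : forall v, 'M[k]_(gamma v)) v : hom_top (embed_hom g) v = g v.
Proof. by rewrite /hom_top -mulmxA lift_gens mulmxA top_gens mul1mx. Qed.

Fact embed_iso gamma (g : gl k gamma) : is_iso (embed_hom g).
Proof. by apply: hom_top_iso => v; rewrite embed_top; exact: glP. Qed.

Definition embed gamma (g : gl k gamma) : aut (P gamma) := Aut (embed_iso g).

Lemma embed_gens gamma (g : gl k gamma) v : embed g v *m gens gamma v = gens gamma v *m g v.
Proof. exact: lift_gens. Qed.

Lemma embedM gamma (g h : gl k gamma) : embed (gl_mul g h) = aut_mul (embed g) (embed h).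
Proof.
have e : aut_hom (embed (gl_mul g h)) = aut_hom (aut_mul (embed g) (embed h)).
  apply: hom_gens_eq => u; rewrite embed_gens aut_mulE -[RHS]mulmxA.
  by rewrite embed_gens mulmxA embed_gens -mulmxA.
by apply: aut_eq => v; rewrite e.
Qed.

Definition aut_one d (V : rep k Q d) : aut V.
Proof. by exists (hom_id V), (hom_id V) => v; rewrite !mul1mx. Defined.

End ProjectiveHoms.

(** * Presentations of representations of dimension alpha *)
Section Presentations.
Variables (k : closedFieldType) (n : nat) (Q : quiver n).
Hypothesis hQ : acyclic Q.
Variable alpha : 'I_n -> nat.
Local Notation gamma := (coexp Q alpha).
Local Notation P gamma := (@projrep k n Q gamma).
Local Notation pres := (hom (P gamma) (P alpha)).
Local Notation gens := (@gens k n Q).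
Local Notation top := (@top k n Q).
Local Notation depth := (@depth n Q).

Lemma slot_surj (s : arrow_slot Q alpha) : exists i : 'I_(gamma (hd (tag s))), slot hQ i = s.
Proof.
have sin : s \in slots_into (hd (tag s)) by rewrite inE.
exists (cast_ord (esym (coexpE hQ alpha (hd (tag s)))) (enum_rank_in sin s)).
by rewrite /slot cast_ordKV enum_rankK_in.
Qed.

Lemma slot_inj v : injective (@slot n Q hQ alpha v).
Proof. by move=> i j /enum_val_inj /cast_ord_inj. Qed.

(** The inclusion of k^(alpha u), for an arrow a : u -> v, into k^(gamma v).
    It is defined for all v, as the zero map unless a ends at v, to avoid
    transport along equations between vertices. *)
Definition sel (a : arrow Q) v : 'M[k]_(gamma v, alpha (tl a)) :=
  \matrix_(i, l) (slot hQ i == Tagged (fun a => 'I_(alpha (tl a))) l)%:R.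

Lemma sel_off a v : hd a != v -> sel a v = 0.
Proof.
move=> ne; apply/matrixP => i l; rewrite !mxE; case: eqP => // e.
by case/eqP: ne; rewrite -(slotP hQ i) e.
Qed.

Lemma sel_orth a b v : a != b -> (sel a v)^T *m sel b v = 0.
Proof.
move=> ne; apply/matrixP => i l; rewrite !mxE big1 // => j _; rewrite !mxE.
case: eqP => [->|_]; last by rewrite mul0r.
by case: eqP => [/(congr1 tag)/= ab|_]; [rewrite ab eqxx in ne | rewrite mulr0].
Qed.

Lemma mul_sel a m (B : 'M[k]_(m, gamma (hd a))) r l :
  exists2 i, slot hQ i = Tagged (fun a => 'I_(alpha (tl a))) l &
    (B *m sel a (hd a)) r l = B r i.
Proof.
have [i si] := slot_surj (Tagged (fun a => 'I_(alpha (tl a))) l); exists i => //.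
rewrite mxE (bigD1 i) //= big1 ?addr0 => [|j ji].
  by rewrite mxE si eqxx mulr1.
by rewrite mxE -si (inj_eq (@slot_inj _)) (negPf ji) mulr0.
Qed.

Lemma sel_diag a : (sel a (hd a))^T *m sel a (hd a) = 1%:M.
Proof.
apply/matrixP => i l; have [j sj ->] := mul_sel (sel a (hd a))^T i l.
by rewrite !mxE sj eq_Tagged /= eq_sym.
Qed.

Lemma sel_sum v : \sum_a sel a v *m (sel a v)^T = 1%:M.
Proof.
apply/matrixP => i j; rewrite summxE.
pose F (a : arrow Q) (l : 'I_(alpha (tl a))) : k :=
  (slot hQ i == Tagged (fun a => 'I_(alpha (tl a))) l)%:R *
  (slot hQ j == Tagged (fun a => 'I_(alpha (tl a))) l)%:R.
transitivity (\sum_(s : arrow_slot Q alpha) F (tag s) (tagged s)).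
  rewrite -(sig_big_dep xpredT (fun _ => xpredT) F) /=; apply: eq_bigr => a _.
  by rewrite mxE; apply: eq_bigr => l _; rewrite !mxE.
rewrite (bigD1 (slot hQ i)) //= big1 ?addr0 => [|s si].
  by rewrite /F taggedK eqxx mul1r (inj_eq (@slot_inj v)) mxE eq_sym.
by rewrite /F taggedK eq_sym (negPf si) mul0r.
Qed.

Lemma sel_cancel v m (B : 'M[k]_(m, gamma v)) : (forall a, hd a = v -> B *m sel a v = 0) -> B = 0.
Proof.
move=> H; rewrite -[B]mulmx1 -(sel_sum v) mulmx_sumr big1 // => a _.
have [e|ne] := eqVneq (hd a) v; first by rewrite mulmxA H ?mul0mx.
by rewrite sel_off // mul0mx mulmx0.
Qed.

Lemma hom_sel_eq d (W : rep k Q d) (f g : hom (P gamma) W) :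
  (forall a, f (hd a) *m gens gamma (hd a) *m sel a (hd a) =
             g (hd a) *m gens gamma (hd a) *m sel a (hd a)) -> f = g.
Proof.
move=> H; apply: hom_gens_eq => // v; apply/eqP; rewrite -subr_eq0; apply/eqP.
by apply: sel_cancel => a e; case: v / e; rewrite mulmxBl H subrr.
Qed.

(** The only property of the entries of the canonical presentation that is used
    in the sequel *)
Lemma canon_gens (M : rep k Q alpha) a :
  canon hQ M (hd a) *m gens gamma (hd a) *m sel a (hd a) =
  gens alpha (hd a) *m M a - P alpha a *m gens alpha (tl a).
Proof.
apply/matrixP => r l; have [i si ->] := mul_sel (canon hQ M (hd a) *m gens gamma (hd a)) r l.
rewrite mul_gens /= mxE enum_rankK /= si /= [RHS]mxE [X in _ = X + _]mxE [X in _ = _ + X]mxE.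
rewrite mul_gens [X in _ = _ - X]mxE enum_rankK /=; congr (_ - _).
apply: eq_bigr => m _; rewrite [X in _ = X * _]mxE mulr_natl; congr (_ *+ nat_of_bool _).
rewrite -[r in RHS]enum_valK (inj_eq enum_rank_inj).
apply/andP/eqP => [[/eqP g /eqP p]|->]; last by rewrite /Pgen /Ppath /= !eqxx.
by apply: Pbasis_inj; rewrite ?g ?p.
Qed.

(** P(alpha)_v is spanned by the image of [phi] and the generators at v; in
    dual form: *)
Definition spans (phi : pres) v := forall x : 'rV[k]_(Pdim Q alpha v),
  x *m phi v = 0 -> x *m gens alpha v = 0 -> x = 0.

(** A morphism that takes the same values as a canonical presentation on the
    generators at v allows to rewrite a path that ends at v in terms of
    generators at v and of paths that end at the tails of the arrows into v. *)
Lemma spans_step (phi : pres) M v :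
  phi v *m gens gamma v = canon hQ M v *m gens gamma v ->
  (forall a : arrow Q, hd a = v -> spans phi (tl a)) -> spans phi v.
Proof.
move=> e H x xp xg; apply: zero_on_gens_rad => // a ea.
case: v / ea e H x xp xg => e H x xp xg; rewrite castmx_id.
apply: (H a) => //; first by rewrite -mulmxA -hom_comm mulmxA xp mul0mx.
have := congr1 (mulmx x) (canon_gens M a).
rewrite -e !mulmxA xp !mul0mx mulmxBr !mulmxA xg mul0mx sub0r.
by move=> /esym/eqP; rewrite oppr_eq0 => /eqP.
Qed.

Lemma canon_spans M v : spans (canon hQ M) v.
Proof.
have [m] := ubnP (depth v); elim: m v => // m IH v; rewrite ltnS => rv.
apply: spans_step => // a e; apply: IH; case: v / e in rv.
exact: leq_trans (depth_lt hQ a) rv.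
Qed.

(** A path in P(gamma) that starts at a slot of an arrow a becomes a path of
    positive length in P(alpha) when a is put in front of it; the generators of
    P(alpha) at v are the trivial paths. *)
Fact Pdim_coexp_leq v : (Pdim Q gamma v + alpha v <= Pdim Q alpha v)%N.
Proof.
have bnd (i : Pbasis Q gamma v) :
    is_path (tl (tag (slot hQ (tagged i).1))) v (tag (slot hQ (tagged i).1) :: Ppath i).
  by rewrite /= eqxx /= slotP; exact: (valP (tagged i).2).
pose f (x : (Pbasis Q gamma v + 'I_(alpha v))%type) : Pbasis Q alpha v :=
  match x with
  | inl i => Tagged (fun v' => 'I_(alpha v') * qpath Q v' v)%type
      (tagged (slot hQ (tagged i).1),
       exist (fun p : n.-bseq (arrow Q) => is_path _ v p)
         (Bseq (ltnW (path_size hQ (bnd i)))) (bnd i))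
  | inr i => Tagged (fun v' => 'I_(alpha v') * qpath Q v' v)%type (i, qpath_nil Q v)
  end.
have fp x : Ppath (f x) = if x is inl i then tag (slot hQ (tagged i).1) :: Ppath i else [::].
  by case: x.
have finj : injective f.
  move=> [x|i] [y|j] e; have ep := congr1 (@Ppath _ _ _ _) e; rewrite !fp in ep => //.
  - case: ep => et ep; congr inl.
    have es : slot hQ (tagged x).1 = slot hQ (tagged y).1.
      rewrite -[LHS]taggedK -[RHS]taggedK.
      have := congr1 (@Pgen _ _ _ _) e; rewrite /Pgen /=.
      move: (slot hQ (tagged x).1) (slot hQ (tagged y).1) et => [a i] [b j] /= ab.
      by case: b / ab j => j /eqP; rewrite eq_Tagged /= => /eqP ->.
    apply: Pbasis_inj => //.
    case: x y es {e et ep} => [w [i p]] [w' [j q]] /=; rewrite /Pgen /= => es.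
    have ew : w = w' by rewrite -(slotP hQ i) -(slotP hQ j) es.
    by case: w' / ew j q es => j q /slot_inj ->.
  - congr inr; have := congr1 (@Pgen _ _ _ _) e; rewrite /Pgen /= => /eqP.
    by rewrite eq_Tagged /= => /eqP.
have := leq_card f finj.
by rewrite card_sum card_ord.
Qed.

(** The remaining inequality holds because the columns of a canonical presentation
    and the generators at v span P(alpha)_v. *)
Lemma Pdim_coexp v : Pdim Q alpha v = (Pdim Q gamma v + alpha v)%N.
Proof.
apply/eqP; rewrite eqn_leq Pdim_coexp_leq andbT.
pose B := row_mx (canon hQ (fun a => 0) v) (gens alpha v).
have : row_free B.
  rewrite -kermx_eq0; apply/eqP/row_neq0 => i; set x := row i _.
  have : x *m B = 0 by apply/sub_kermxP; exact: row_sub.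
  rewrite mul_mx_row -[0]row_mx0 => /eq_row_mx[x1 x2].
  exact: canon_spans x1 x2.
by rewrite /row_free => /eqP <-; exact: rank_leq_col.
Qed.

(** The square matrix with the columns of [phi] and the generators at v *)
Definition frame (phi : pres) v : 'M[k]_(Pdim Q gamma v + alpha v) :=
  castmx (Pdim_coexp v, erefl) (row_mx (phi v) (gens alpha v)).

Lemma frameE phi v :
  frame phi v = castmx (Pdim_coexp v, erefl) (row_mx (phi v) (gens alpha v)).
Proof. by []. Qed.

Definition frame_det (phi : pres) v : k := \det (frame phi v).

Lemma frame_detE phi v : frame_det phi v = \det (frame phi v). Proof. by []. Qed.

Definition coframe (phi : pres) v : 'M[k]_(Pdim Q gamma v + alpha v, Pdim Q alpha v) :=
  castmx (erefl, esym (Pdim_coexp v)) (invmx (frame phi v)).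

(** The projections of P(alpha)_v onto the image of [phi], identified with
    P(gamma)_v, and onto the span of the generators at v *)
Definition ret (phi : pres) v : 'M[k]_(Pdim Q gamma v, Pdim Q alpha v) := usubmx (coframe phi v).
Definition prj (phi : pres) v : 'M[k]_(alpha v, Pdim Q alpha v) := dsubmx (coframe phi v).

Lemma prjE phi v : prj phi v =
  dsubmx (castmx (erefl, esym (Pdim_coexp v)) (invmx (frame phi v))).
Proof. by []. Qed.

Lemma mulmx_cast m m' p q (e : m = m') (A : 'M[k]_(p, m)) (B : 'M[k]_(m, q)) :
  castmx (erefl, e) A *m castmx (e, erefl) B = A *m B.
Proof. by case: m' / e; rewrite !castmx_id. Qed.

Lemma frame_det_spans phi v : frame_det phi v != 0 <-> spans phi v.
Proof.
split=> [D x x1 x2|sp].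
  have : castmx (erefl, Pdim_coexp v) x *m frame phi v = 0.
    by rewrite mulmx_cast mul_mx_row x1 x2 row_mx0.
  have fu : frame phi v \in unitmx by rewrite unitmxE unitfE.
  move=> /(congr1 (mulmx^~ (invmx (frame phi v)))); rewrite mulmxK // mul0mx => e.
  rewrite -[x](castmxK (erefl 1%N) (Pdim_coexp v)) e.
  by apply/matrixP => i j; rewrite castmxE !mxE.
have : frame phi v \in unitmx; last by rewrite unitmxE unitfE.
apply: unitmx_ker => y; rewrite -[y](castmxKV (erefl 1%N) (Pdim_coexp v)).
set x := castmx _ y; rewrite mulmx_cast mul_mx_row -[X in _ = X -> _]row_mx0 => /eq_row_mx[x1 x2].
by rewrite (sp x x1 x2); apply/matrixP => i j; rewrite castmxE !mxE.
Qed.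

Lemma coframeK phi v : frame_det phi v != 0 ->
  coframe phi v *m row_mx (phi v) (gens alpha v) = 1%:M /\
  row_mx (phi v) (gens alpha v) *m coframe phi v = 1%:M.
Proof.
move=> D; have fu : frame phi v \in unitmx by rewrite unitmxE unitfE.
have := mulVmx fu; have := mulmxV fu; rewrite /coframe; set I := invmx _; rewrite /frame.
move: (Pdim_coexp v) (row_mx _ _) I; move: (_ + _)%N => m e; case: m / e => B I.
by rewrite !castmx_id.
Qed.

Section Inverse.
Variables (phi : pres) (v : 'I_n).
Hypothesis D : frame_det phi v != 0.

Let KB : [/\ ret phi v *m phi v = 1%:M, ret phi v *m gens alpha v = 0,
   prj phi v *m phi v = 0 & prj phi v *m gens alpha v = 1%:M].
Proof.
have [+ _] := coframeK D; rewrite -[coframe phi v]vsubmxK mul_col_row.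
by rewrite scalar_mx_block => /eq_block_mx.
Qed.

Lemma ret_phi : ret phi v *m phi v = 1%:M. Proof. by case: KB. Qed.
Lemma ret_gens : ret phi v *m gens alpha v = 0. Proof. by case: KB. Qed.
Lemma prj_phi : prj phi v *m phi v = 0. Proof. by case: KB. Qed.
Lemma prj_gens : prj phi v *m gens alpha v = 1%:M. Proof. by case: KB. Qed.

Lemma ret_prj : phi v *m ret phi v + gens alpha v *m prj phi v = 1%:M.
Proof. by rewrite -mul_row_col vsubmxK; case: (coframeK D). Qed.

Lemma frame_agree m (B C : 'M_(m, Pdim Q alpha v)) :
  B *m phi v = C *m phi v -> B *m gens alpha v = C *m gens alpha v -> B = C.
Proof.
move=> e1 e2; rewrite -[B]mulmx1 -[C]mulmx1 -ret_prj !mulmxDr !mulmxA.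
by rewrite e1 e2.
Qed.

End Inverse.

(** The presentations whose cokernel has the images of the generators as a
    basis *)
Definition good (phi : pres) := forall v, frame_det phi v != 0.

Lemma canon_good M : good (canon hQ M).
Proof. by move=> v; apply/frame_det_spans; exact: canon_spans. Qed.

(** The cokernel of [phi], with the images of the generators as basis *)
Definition coker (phi : pres) : rep k Q alpha :=
  fun a => prj phi (hd a) *m P alpha a *m gens alpha (tl a).

Lemma cokerE phi a : coker phi a = prj phi (hd a) *m P alpha a *m gens alpha (tl a).
Proof. by []. Qed.

Section Coker.
Variable phi : pres.
Hypothesis U : good phi.

Lemma prj_comm a : prj phi (hd a) *m P alpha a = coker phi a *m prj phi (tl a).
Proof.
apply: (frame_agree (U (tl a))); last by rewrite -!mulmxA prj_gens // mulmx1 mulmxA.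
by rewrite -mulmxA -hom_comm mulmxA prj_phi // mul0mx -mulmxA prj_phi // mulmx0.
Qed.

Definition prj_hom : hom (P alpha) (coker phi) :=
  @Hom _ _ _ _ _ (P alpha) (coker phi) (prj phi) prj_comm.

Lemma prj_canon v : prj phi v *m canon hQ (coker phi) v = 0.
Proof.
have -> : prj phi v *m canon hQ (coker phi) v =
    lift hQ (coker phi) (fun v => 0 : 'M_(alpha v, gamma v)) v; last first.
  apply: zero_on_gens_rad; first exact: lift_gens.
  move=> a e; case: v / e; rewrite castmx_id hom_comm.
  have -> : lift hQ (coker phi) (fun v => 0 : 'M_(alpha v, gamma v)) (tl a) = 0;
    last by rewrite mulmx0.
  by apply/matrixP => i j; rewrite [LHS]mxE /= mulmx0 !mxE.
rewrite -(hom_compE prj_hom); congr (hom_mx _ v); apply: hom_sel_eq => a.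
rewrite lift_gens mul0mx hom_compE.
transitivity (prj phi (hd a) *m (canon hQ (coker phi) (hd a) *m gens gamma (hd a) *m sel a (hd a))).
  by rewrite !mulmxA.
by rewrite canon_gens mulmxBr !mulmxA prj_gens // mul1mx subrr.
Qed.

(** At each vertex, phi and the canonical presentation of its cokernel are
    injective, and both have the kernel of [prj phi] as image. *)
Lemma canon_factor : exists b : aut (P gamma), phi = hom_comp (canon hQ (coker phi)) b.
Proof.
set c := canon hQ (coker phi); have Uc : good c by exact: canon_good.
have cr v : c v *m ret c v + gens alpha v *m prj phi v = 1%:M.
  have -> : prj phi v = prj c v; last exact: ret_prj.
  apply: (frame_agree (Uc v)); first by rewrite prj_canon prj_phi.
  by rewrite !prj_gens.
pose b := lift hQ (P gamma) (fun v => ret c v *m phi v *m gens gamma v).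
have cb : phi = hom_comp c b.
  apply: hom_gens_eq => // v; rewrite hom_compE -mulmxA lift_gens !mulmxA.
  have -> : c v *m ret c v = 1%:M - gens alpha v *m prj phi v by rewrite -(cr v) addrK.
  by rewrite mulmxBl mul1mx -[_ *m prj _ _ *m _]mulmxA prj_phi // mulmx0 subr0.
have bu : is_iso b.
  apply: iso_of_units => v; have := ret_phi (U v).
  by rewrite {2}cb hom_compE mulmxA => /mulmx1_unit[].
by exists (Aut bu).
Qed.

End Coker.

Lemma coker_canon M : coker (canon hQ M) = M.
Proof.
apply: functional_extensionality_dep => a; have U := canon_good M.
have := congr1 (mulmx (prj (canon hQ M) (hd a))) (canon_gens M a).
rewrite !mulmxA prj_phi // !mul0mx mulmxBr !mulmxA prj_gens // mul1mx.
by move=> /esym/eqP; rewrite subr_eq0 => /eqP.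
Qed.

(** GL(alpha_u) acts on k^(gamma v) through the summands of the arrows from u
    to v. *)
Definition slot_mx (B : forall v, 'M[k]_(alpha v)) v : 'M[k]_(gamma v) :=
  \sum_a sel a v *m B (tl a) *m (sel a v)^T.

Lemma slot_mxM B C v : slot_mx B v *m slot_mx C v = slot_mx (fun v => B v *m C v) v.
Proof.
rewrite /slot_mx mulmx_suml; apply: eq_bigr => a _.
rewrite mulmx_sumr (bigD1 a) //= big1 ?addr0 => [|b ba].
  have [e|ne] := eqVneq (hd a) v; last by rewrite sel_off // !mul0mx.
  case: v / e; rewrite !mulmxA -[_ *m (sel a _)^T *m sel a _]mulmxA sel_diag mulmx1.
  by [].
by rewrite !mulmxA -[_ *m (sel a v)^T *m sel b v]mulmxA sel_orth 1?eq_sym // mulmx0 !mul0mx.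
Qed.

Lemma slot_mx1 B v : (forall u, B u = 1%:M) -> slot_mx B v = 1%:M.
Proof. by move=> H; rewrite -(sel_sum v); apply: eq_bigr => a _; rewrite H mulmx1. Qed.

Lemma slot_mx_sel B a : slot_mx B (hd a) *m sel a (hd a) = sel a (hd a) *m B (tl a).
Proof.
rewrite mulmx_suml (bigD1 a) //= big1 ?addr0 => [|b ba].
  by rewrite -mulmxA sel_diag mulmx1.
by rewrite -mulmxA sel_orth // mulmx0.
Qed.

Fact slot_mx_inv_unit (g : gl k alpha) v : slot_mx (fun v => invmx (g v)) v \in unitmx.
Proof.
have e : slot_mx (fun v => invmx (g v)) v *m slot_mx g v = 1%:M.
  by rewrite slot_mxM slot_mx1 // => u; rewrite mulVmx ?glP.
by have [] := mulmx1_unit e.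
Qed.

Definition slot_gl (g : gl k alpha) : gl k gamma := GL (slot_mx_inv_unit g).

(** The homomorphism from GL(alpha) for which [canon] is equivariant *)
Definition rho (g : gl k alpha) : aut (P alpha) * aut (P gamma) :=
  (embed hQ g, embed hQ (slot_gl g)).

Lemma rhoM g h : rho (gl_mul g h) = (aut_mul (rho g).1 (rho h).1, aut_mul (rho h).2 (rho g).2).
Proof.
rewrite /rho -!embedM; congr (_, embed hQ _); apply: gl_eq => v /=.
rewrite slot_mxM; apply: eq_bigr => a _; congr (_ *m _ *m _).
have e : (g (tl a) *m h (tl a)) *m (invmx (h (tl a)) *m invmx (g (tl a))) = 1%:M.
  by rewrite mulmxA mulmxK ?glP // mulmxV ?glP.
by rewrite -[LHS]mulmx1 -e mulKmx // unitmx_mul !glP.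
Qed.

Lemma canon_equivariant (g : gl k alpha) (M : rep k Q alpha) :
  canon hQ (rep_act g M) = pres_act (rho g) (canon hQ M).
Proof.
apply: hom_sel_eq => a; rewrite canon_gens /pres_act !hom_compE.
transitivity (embed hQ g (hd a) *m (canon hQ M (hd a) *m gens gamma (hd a) *m
    sel a (hd a)) *m invmx (g (tl a))); last first.
  rewrite -!mulmxA; congr (_ *m (_ *m _)); rewrite [in RHS]mulmxA embed_gens -mulmxA.
  by rewrite slot_mx_sel !mulmxA.
rewrite canon_gens mulmxBr mulmxBl !mulmxA embed_gens -[gens _ _ *m g _ *m M a]mulmxA.
rewrite -!mulmxA; congr (_ - _); rewrite [in RHS]mulmxA hom_comm -mulmxA.
congr (_ *m _); rewrite mulmxA embed_gens -mulmxA mulmxV ?glP // mulmx1.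
by [].
Qed.

End Presentations.

(** * Restriction of semi-invariants to canonical presentations *)
Section Restriction.
Variables (k : closedFieldType) (n : nat) (Q : quiver n).
Hypothesis hQ : acyclic Q.
Variable alpha : 'I_n -> nat.
Local Notation gamma := (coexp Q alpha).
Local Notation P gamma := (@projrep k n Q gamma).
Local Notation pres := (hom (P gamma) (P alpha)).
Local Notation VP := (pres_variety k Q alpha gamma).
Local Notation VR := (rep_variety k Q alpha).
Local Notation frame_det := (@frame_det k n Q hQ alpha).
Local Notation good := (@good k n Q hQ alpha).
Implicit Types (phi : pres) (M : rep k Q alpha).

Lemma pres_lines : has_lines VP.
Proof.
move=> x y; exists (fun t => hom_lin x t (hom_lin y (-1) x)) => t [v [r c]] /=.
by rewrite !mxE mulN1r.
Qed.

Lemma rep_lines : has_lines VR.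
Proof.
move=> x y; exists (fun t a => x a + t *: (y a - x a)) => t [v [r c]] /=.
by rewrite !mxE.
Qed.

Lemma regular_pres v : alg_mx (@regular k VP) (fun phi => phi v).
Proof.
move=> r c; exact: (@regular_coord k VP
  (Tagged (fun v => 'I_(Pdim Q alpha v) * 'I_(Pdim Q gamma v))%type (r, c))).
Qed.

Lemma regular_rep a : alg_mx (@regular k VR) (fun M => M a).
Proof.
move=> r c; exact: (@regular_coord k VR
  (Tagged (fun a => 'I_(alpha (hd a)) * 'I_(alpha (tl a)))%type (r, c))).
Qed.

Lemma regular_frame_det v : @regular k VP (fun phi => frame_det phi v).
Proof.
have rA := regular_alg VP; apply: (alg_det rA); apply: alg_mx_cast.
by apply: alg_row_mx; [exact: regular_pres | exact: alg_mx_const].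
Qed.

Lemma regular_canon v : alg_mx (@regular k VR) (fun M => canon hQ M v).
Proof.
have rA := regular_alg VR => r c.
have -> : (fun M => canon hQ M v r c) = (fun M => canon_mx hQ M v r c) by [].
under eq_fun => M do rewrite mxE /=.
apply: (alg_add rA); last exact: alg_const.
apply: (alg_sum rA) => m _; case: (_ && _); rewrite ?mulr1n ?mulr0n.
  exact: regular_rep.
exact: alg_const.
Qed.

Lemma regular_restrict (f : pres -> k) : @regular k VP f -> @regular k VR (fun M => f (canon hQ M)).
Proof.
apply: (regular_comp (A := @regular k VR) (X := VP)) => [|[v [r c]]]; first exact: regular_alg.
exact: regular_canon.
Qed.

(** A regular function without zeros on an affine space is constant. *)
Lemma frame_det_canon M N v : frame_det (canon hQ M) v = frame_det (canon hQ N) v.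
Proof.
apply: (@regular_nowhere_zero k VR rep_lines (fun M => frame_det (canon hQ M) v)).
  exact: regular_restrict (regular_frame_det v).
by move=> L; exact: canon_good.
Qed.

Definition frames_det (phi : pres) : k := \prod_v frame_det phi v.

Lemma frames_detE phi : frames_det phi = \prod_v frame_det phi v. Proof. by []. Qed.

Lemma regular_frames_det : @regular k VP frames_det.
Proof. by apply: (alg_prod (regular_alg VP)) => v _; exact: regular_frame_det. Qed.

Lemma frames_det_good phi : frames_det phi != 0 <-> good phi.
Proof.
by split=> [/prodf_neq0 H v|H]; [exact: H | apply/prodf_neq0 => v _; exact: H].
Qed.

Lemma frames_det_canon M : frames_det (canon hQ M) != 0.
Proof. by apply/frames_det_good; exact: canon_good. Qed.

Lemma regular_good_eq0 (f : pres -> k) : @regular k VP f ->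
  (forall phi, good phi -> f phi = 0) -> forall phi, f phi = 0.
Proof.
move=> fr H.
apply: (regular_dense pres_lines fr regular_frames_det (frames_det_canon (fun a => 0))).
by move=> phi /frames_det_good; exact: H.
Qed.

Lemma restrict_semi_invariant (chi : grp VP -> k) (f : pres -> k) :
  character chi -> semi_invariant chi f ->
  @character k VR (fun g => chi (rho hQ g)) /\
  @semi_invariant k VR (fun g => chi (rho hQ g)) (fun M => f (canon hQ M)).
Proof.
move=> [nz M] [fr fE]; split; first by split=> [g|g h]; rewrite ?nz // rhoM M.
split=> [|g N]; first exact: regular_restrict.
by rewrite -fE; congr f; exact: canon_equivariant.
Qed.

Fact restrict_SI (f : SI VP) : (fun M => f (canon hQ M)) \in SI_pred (X := VR).
Proof.
have /asboolP[m [F [FP fE]]] := SI_valP f; apply/asboolP.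
exists m, (fun i M => F i (canon hQ M)); split.
  move=> i; have [chi c s] := FP i; have [c' s'] := restrict_semi_invariant c s.
  by exists (fun g => chi (rho hQ g)).
by apply/funext => M; rewrite fE !fct_sumE.
Qed.

Definition restrict (f : SI VP) : SI VR := MkSI (restrict_SI f).

Lemma SI_eq (X : gvariety k) (f g : SI X) : SI_val f = SI_val g -> f = g.
Proof. exact: val_inj. Qed.

Fact restrict_zmod : zmod_morphism restrict.
Proof. by move=> f g; apply: SI_eq; apply/funext => M. Qed.

Fact restrict_monoid : monoid_morphism restrict.
Proof. by split=> [|f g]; apply: SI_eq; apply/funext => M. Qed.

HB.instance Definition _ := GRing.isZmodMorphism.Build (SI VP) (SI VR) restrict restrict_zmod.
HB.instance Definition _ := GRing.isMonoidMorphism.Build (SI VP) (SI VR) restrict restrict_monoid.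

(** ** The semi-invariants C_V *)
Lemma Hcoord_surj g d (V : rep k Q d) (y : 'cV[k]_#|{: Hbasis g d}|) :
  exists h : hom (P g) V, Hcoord h = y.
Proof.
pose x v : 'M[k]_(d v, g v) := \matrix_(r, i)
  y (enum_rank (Tagged (fun v => 'I_(g v) * 'I_(d v))%type (i, r) : Hbasis g d)) 0.
have xE v r i : x v r i =
    y (enum_rank (Tagged (fun v => 'I_(g v) * 'I_(d v))%type (i, r) : Hbasis g d)) 0.
  by rewrite mxE.
exists (lift hQ V x); apply/colP => j; rewrite mxE /= -mul_gens (lift_gens hQ) xE.
by rewrite -[j in RHS]enum_valK; case: (enum_val j) => v [i r].
Qed.

Lemma Hmx_comp g0 g1 g2 d (V : rep k Q d) (psi : hom (P g1) (P g0)) (phi : hom (P g2) (P g1)) :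
  Hmx V (hom_comp psi phi) = Hmx V phi *m Hmx V psi.
Proof.
suff H (y : 'cV_ _) : Hmx V (hom_comp psi phi) *m y = Hmx V phi *m Hmx V psi *m y.
  by apply/matrixP => i j; have := H (delta_mx j 0); rewrite -!colE => /colP/(_ i); rewrite !mxE.
have [h <-] := Hcoord_surj V y; rewrite -HmxE -mulmxA -HmxE -HmxE; congr Hcoord.
by apply: hom_eq => v; rewrite !hom_compE mulmxA.
Qed.

Lemma Hmx_id g d (V : rep k Q d) : Hmx V (hom_id (P g)) = 1%:M.
Proof.
suff H (y : 'cV_ _) : Hmx V (hom_id (P g)) *m y = y.
  apply/matrixP => i j; have := H (delta_mx j 0).
  by rewrite -!colE => /colP/(_ i); rewrite !mxE eqxx andbT.
have [h <-] := Hcoord_surj V y; rewrite -HmxE; congr Hcoord.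
by apply: hom_eq => v; rewrite hom_compE mulmx1.
Qed.

Lemma regular_Hmx d (V : rep k Q d) : alg_mx (@regular k VP) (fun psi => Hmx V psi).
Proof.
move=> i j; have rA := regular_alg VP; rewrite /Hmx.
under eq_fun => psi do rewrite mxE /=.
by apply: (alg_mxM rA); [exact: alg_mx_const | exact: regular_pres].
Qed.

Lemma det_cast3 m m' (e : m = m') (A : 'M[k]_m) (B : 'M_(m, m')) (C : 'M_m') :
  \det (castmx (e, erefl) (A *m B *m C)) = \det A * \det C * \det (castmx (e, erefl) B).
Proof. by case: m' / e B C => B C; rewrite !castmx_id !det_mulmx mulrAC. Qed.

Lemma det_Hmx_mul g d (V : rep k Q d) (f h : aut (P g)) :
  \det (Hmx V (aut_mul f h)) = \det (Hmx V f) * \det (Hmx V h).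
Proof. by rewrite [Hmx _ _](Hmx_comp V f h) det_mulmx mulrC. Qed.

Lemma det_Hmx_neq0 g d (V : rep k Q d) (f : aut (P g)) : \det (Hmx V f) != 0.
Proof.
have [h hP] := autP f; have : Hmx V (hom_comp f h) = 1%:M.
  rewrite -(Hmx_id g V); congr Hmx; apply: hom_eq => v; rewrite hom_compE.
  by have [] := hP v.
rewrite Hmx_comp => /(congr1 determinant); rewrite det_mulmx det1 => e.
by apply/eqP => f0; move/eqP: e; rewrite f0 mulr0 eq_sym oner_eq0.
Qed.

Lemma regular_detC d (V : rep k Q d) (hV : euler_form Q alpha d = 0) :
  @regular k VP (detC hQ V hV).
Proof. apply: (alg_det (regular_alg VP)); apply: alg_mx_cast; exact: regular_Hmx. Qed.

Lemma detC_SI d (V : rep k Q d) (hV : euler_form Q alpha d = 0) :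
  detC hQ V hV \in SI_pred (X := VP).
Proof.
apply/asboolP; exists 1%N, (fun=> detC hQ V hV); split; last by rewrite big_ord1.
move=> _; exists (fun g : grp VP => \det (Hmx V g.2) * \det (Hmx V g.1)).
  split=> [g|g h]; first by rewrite mulf_neq0 ?det_Hmx_neq0.
  by rewrite /= !det_Hmx_mul [X in X * _ = _]mulrC mulrACA.
split=> [|g psi]; first exact: regular_detC.
rewrite /detC /= /pres_act !Hmx_comp det_cast3.
by [].
Qed.

End Restriction.

(** * Weights *)
Section ProductsOfGL.
Variables (k : closedFieldType) (n : nat).

(** [conform_mx] transports [X] along the equation u = v. *)
Definition at_mx d1 d2 (D : forall u : 'I_n, 'M[k]_(d1 u, d2 u)) v (X : 'M[k]_(d1 v, d2 v)) u :
    'M[k]_(d1 u, d2 u) :=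
  if u == v then conform_mx (D u) X else D u.

Lemma at_mx_same d1 d2 (D : forall u : 'I_n, 'M[k]_(d1 u, d2 u)) v X : at_mx D X v = X.
Proof. by rewrite /at_mx eqxx conform_mx_id. Qed.

Lemma at_mx_other d1 d2 (D : forall u : 'I_n, 'M[k]_(d1 u, d2 u)) v (X : 'M_(d1 v, d2 v)) u :
  u != v -> at_mx D X u = D u.
Proof. by rewrite /at_mx => /negPf->. Qed.

Lemma alg_at_mx T (A : (T -> k) -> Prop) d1 d2 (D : forall u : 'I_n, 'M[k]_(d1 u, d2 u)) v
    (X : T -> 'M[k]_(d1 v, d2 v)) u :
  fun_algebra A -> alg_mx A X -> alg_mx A (fun t => at_mx D (X t) u).
Proof.
move=> algA AX; have [e|ne] := eqVneq u v.
  case: v / e in X AX *; under eq_fun do rewrite at_mx_same; exact: AX.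
under eq_fun do rewrite at_mx_other //; exact: alg_mx_const.
Qed.

Variable d : 'I_n -> nat.

Fact gl_at_unit v (X : 'M[k]_(d v)) u :
  at_mx (d1 := d) (fun=> 1%:M) (if X \in unitmx then X else 1%:M) u \in unitmx.
Proof.
have [->|ne] := eqVneq u v; last by rewrite at_mx_other // unitmx1.
by rewrite at_mx_same; case: ifP => // _; exact: unitmx1.
Qed.

Definition gl_at v X : gl k d := GL (@gl_at_unit v X).

Lemma gl_at_same v X : X \in unitmx -> gl_at X v = X.
Proof. by move=> Xu /=; rewrite at_mx_same Xu. Qed.

Lemma gl_at_other v (X : 'M_(d v)) u : u != v -> gl_at X u = 1%:M.
Proof. by move=> ne /=; rewrite at_mx_other. Qed.

(** An element of the product is the product of its components, and
    [rational_character_det] applies to each factor. *)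
Lemma gl_character (chi : gl k d -> k) :
  (forall g, chi g != 0) -> (forall g h, chi (gl_mul g h) = chi g * chi h) ->
  (forall v, line_rational (fun X => chi (@gl_at v X))) ->
  exists z : 'I_n -> int, forall g, chi g = \prod_v \det (g v) ^ z v.
Proof.
move=> chi0 chiM chiL.
have : forall v, exists zv : int, forall X : 'M_(d v), X \in unitmx -> chi (gl_at X) = \det X ^ zv.
  move=> v; apply: rational_character_det => [X _|X Y Xu Yu|]; first exact: chi0.
    rewrite -chiM; congr chi; apply: gl_eq => u /=.
    have [->|ne] := eqVneq u v; last by rewrite !at_mx_other // mulmx1.
    by rewrite !at_mx_same unitmx_mul Xu Yu.
  exact: chiL.
move=> /choice[z zE]; exists z => g.
pose g_on (s : seq 'I_n) u : 'M[k]_(d u) := if u \in s then g u else 1%:M.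
have g_on_unit s u : g_on s u \in unitmx by rewrite /g_on; case: ifP; rewrite ?glP ?unitmx1.
suff H s : uniq s -> chi (GL (g_on_unit s)) = \prod_(v <- s) \det (g v) ^ z v.
  rewrite -(H _ (index_enum_uniq _)); congr chi; apply: gl_eq => u /=.
  by rewrite /g_on mem_index_enum.
elim: s => [|v s IH] /=.
  move=> _; rewrite big_nil; apply: (mulfI (chi0 (GL (g_on_unit [::])))).
  by rewrite -chiM mulr1; congr chi; apply: gl_eq => u /=; rewrite /g_on mulmx1.
move=> /andP[vs us]; rewrite big_cons -(IH us) -(zE v) ?glP // -chiM; congr chi.
apply: gl_eq => u /=; rewrite {1}/g_on inE.
have [->|ne] := eqVneq u v; first by rewrite at_mx_same glP /g_on (negPf vs) mulmx1.
by rewrite at_mx_other // mul1mx.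
Qed.

Lemma det_at_prod v (X : 'M[k]_(d v)) (Y : forall u, 'M[k]_(d u)) (z : 'I_n -> int) :
  Y v = X -> (forall u, u != v -> Y u = 1%:M) -> \prod_u \det (Y u) ^ z u = \det X ^ z v.
Proof.
move=> Yv Yu; rewrite (bigD1 v) //= Yv big1 ?mulr1 // => u uv.
by rewrite Yu // det1 exp1rz.
Qed.

Lemma expz_inj (z w : int) : (forall s : k, s != 0 -> s ^ z = s ^ w) -> z = w.
Proof.
move=> H; have {}H (s : k) : s != 0 -> s ^ (z - w) = 1.
  by move=> snz; rewrite expfzDr // H // -expfzDr // subrr expr0z.
apply/eqP; rewrite -subr_eq0; apply: contraT => nz.
have {nz} : exists m, (forall s : k, s != 0 -> s ^+ m.+1 = 1).
  move: nz H; case: (z - w) => [[|m]|m] // _ H; exists m => s /H //.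
  by move/eqP; rewrite NegzE -exprnN invr_eq1 => /eqP.
case=> m Hm; have nzp : ('X^(m.+1) - 1%:P) * 'X != 0 :> {poly k}.
  by rewrite mulf_neq0 ?polyX_eq0 // -size_poly_eq0 size_XnsubC.
have /closed_nonrootP[s] := nzp.
rewrite /root !hornerE mulf_eq0 negb_or => /andP[+ snz].
by rewrite Hm // subrr eqxx.
Qed.

End ProductsOfGL.

(** Dedekind's independence of characters, in the form in which repeated
    characters are allowed: the coefficients of each character add up to zero.
    To isolate a character eta_i, translate the relation by g and subtract eta g
    times it, for every other character eta: the terms of eta disappear and
    those of eta_i are multiplied by eta_i g - eta g. *)
Lemma character_relation (k : closedFieldType) (G : Type) (mul : G -> G -> G) (e : G)
    (I : eqType) (s : seq I) (eta : I -> G -> k) (c w : I -> k) :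
  (forall i g h, eta i (mul g h) = eta i g * eta i h) -> (forall i, eta i e != 0) ->
  (forall g, \sum_(i <- s) eta i g * c i = 0) ->
  (forall i j, i \in s -> j \in s -> eta i = eta j -> w i = w j) ->
  \sum_(i <- s) w i * c i = 0.
Proof.
move=> etaM etae.
have isolate (t : seq I) (i0 : I) : (forall g, \sum_(i <- t) eta i g * c i = 0) ->
    \sum_(i <- t | `[< eta i = eta i0 >]) c i = 0.
  move=> rel.
  have key (r : seq I) : (forall l, l \in r -> eta l <> eta i0) ->
      exists (phi : I -> k) (K : k), [/\ K != 0, forall i, eta i = eta i0 -> phi i = K,
        forall i, i \in r -> phi i = 0 & forall g, \sum_(i <- t) eta i g * (c i * phi i) = 0].
    elim: r => [|l r IH] H.
      exists (fun=> 1), 1; split=> //; first exact: oner_neq0.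
      by move=> g; rewrite -[RHS](rel g); apply: eq_bigr => i _; rewrite mulr1.
    have [|phi [K [Knz phiK phi0 relphi]]] := IH.
      by move=> j jr; apply: H; rewrite inE jr orbT.
    have [g0 g0P] : exists g0, eta l g0 != eta i0 g0.
      apply: contrapT => Hn; apply: (H l); first by rewrite inE eqxx.
      by apply/funext => g; apply/eqP; apply: contra_notT Hn => Hg; exists g.
    exists (fun i => phi i * (eta i g0 - eta l g0)), (K * (eta i0 g0 - eta l g0)); split.
    - by rewrite mulf_neq0 // subr_eq0 eq_sym.
    - by move=> i ei; rewrite phiK // ei.
    - by move=> i; rewrite inE => /orP[/eqP->|/phi0->]; rewrite ?subrr ?mulr0 ?mul0r.
    - move=> g.
      transitivity (\sum_(i <- t) eta i (mul g g0) * (c i * phi i) -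
          eta l g0 * \sum_(i <- t) eta i g * (c i * phi i)); last first.
        by rewrite !relphi mulr0 subrr.
      by rewrite mulr_sumr -sumrB; apply: eq_bigr => i _; rewrite etaM; ring.
  have [|phi [K [Knz phiK phi0 relphi]]] := key [seq i <- t | ~~ `[< eta i = eta i0 >]].
    by move=> l; rewrite mem_filter => /andP[/asboolPn].
  apply: (mulfI (mulf_neq0 (etae i0) Knz)); rewrite mulr0 mulr_sumr.
  transitivity (\sum_(i <- t) eta i e * (c i * phi i)); last exact: relphi.
  rewrite [RHS](bigID (fun i => `[< eta i = eta i0 >])) /= [X in _ = _ + X]big1_seq ?addr0.
    by apply: eq_bigr => i /asboolP ei; rewrite ei phiK // mulrAC -mulrA.
  by move=> i /andP[ni it]; rewrite phi0 ?mulr0 // mem_filter ni.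
have [m] := ubnP (size s); elim: m s => // m IH [|i0 s]; first by rewrite big_nil.
rewrite ltnS => sz rel weq; pose p i := `[< eta i = eta i0 >].
have p0 : p i0 by apply/asboolP.
rewrite (bigID p) /= -[X in _ + X]big_filter IH ?addr0.
- rewrite big_seq_cond (eq_bigr (fun i => w i0 * c i)) => [|i /andP[iin /asboolP ei]].
    by rewrite -big_seq_cond -mulr_sumr isolate ?mulr0.
  by congr (_ * _); apply: weq => //; rewrite inE eqxx.
- apply: leq_trans sz; rewrite /= p0 /= ltnS size_filter; exact: count_size.
- move=> g; rewrite big_filter; have := rel g; rewrite (bigID p) /=.
  rewrite (eq_bigr (fun i => eta i0 g * c i)) => [|i /asboolP-> //].
  by rewrite -mulr_sumr isolate // mulr0 add0r.
- move=> i j; rewrite !mem_filter => /andP[_ iin] /andP[_ jin]; exact: weq.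
Qed.

Section Injectivity.
Variables (k : closedFieldType) (n : nat) (Q : quiver n).
Hypothesis hQ : acyclic Q.
Variable alpha : 'I_n -> nat.
Local Notation gamma := (coexp Q alpha).
Local Notation P gamma := (@projrep k n Q gamma).
Local Notation pres := (hom (P gamma) (P alpha)).
Local Notation VP := (pres_variety k Q alpha gamma).
Local Notation VR := (rep_variety k Q alpha).
Local Notation gens := (@gens k n Q).
Local Notation top := (@top k n Q).
Local Notation depth := (@depth n Q).

Lemma alg_lift T (A : (T -> k) -> Prop) g d (W : rep k Q d)
    (x : T -> forall v, 'M[k]_(d v, g v)) u :
  fun_algebra A -> (forall v, alg_mx A (fun t => x t v)) -> alg_mx A (fun t => lift hQ W (x t) u).
Proof.
move=> algA Ax r c.
have -> : (fun t => lift hQ W (x t) u r c) = (fun t => lift_mx W (x t) u r c) by [].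
under eq_fun => t do rewrite mxE /=.
by apply: alg_mxM => //; exact: alg_mx_const.
Qed.

Lemma alg_comp T (A : (T -> k) -> Prop) d1 d2 d3 (U : rep k Q d1) (V : rep k Q d2) (W : rep k Q d3)
    (f : T -> hom V W) (g : T -> hom U V) u :
  fun_algebra A -> (forall v, alg_mx A (fun t => f t v)) -> (forall v, alg_mx A (fun t => g t v)) ->
  alg_mx A (fun t => hom_comp (f t) (g t) u).
Proof. by move=> algA Af Ag; exact: alg_mxM. Qed.

Lemma polyfun_line m l (A B : 'M[k]_(m, l)) : alg_mx (@polyfun k) (fun s => A + s *: B).
Proof.
have pA := polyfun_alg k; apply: (alg_mxD pA); first exact: alg_mx_const.
by apply: (alg_mxZ pA); [exact: polyfun_id | exact: alg_mx_const].
Qed.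

Lemma regular_curve (f : pres -> k) (phi : k -> pres) :
  (forall v, alg_mx (@polyfun k) (fun s => phi s v)) -> @regular k VP f ->
  polyfun (fun s => f (phi s)).
Proof.
move=> Aphi; apply: (regular_comp (X := VP)) => [|[v [r c]]]; first exact: polyfun_alg.
exact: Aphi.
Qed.

Lemma top_gl_at g v (X : 'M[k]_(g v)) : X \in unitmx ->
  aut_hom (embed hQ (gl_at X)) = embed_hom hQ (at_mx (d1 := g) (fun=> 1%:M) X).
Proof. by move=> Xu; rewrite /= Xu. Qed.

Definition topgl g (b : aut (P g)) : gl k g := GL (hom_top_unit b).

(** A line of automorphisms from the block diagonal part of b to b: the blocks on
    generators are constant along it. *)
Definition contract g (b : aut (P g)) (s : k) : hom (P g) (P g) :=
  lift hQ (P g) (fun v =>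
    gens g v *m hom_top b v + s *: (b v *m gens g v - gens g v *m hom_top b v)).

Lemma contract_gens g (b : aut (P g)) s v : contract b s v *m gens g v =
  gens g v *m hom_top b v + s *: (b v *m gens g v - gens g v *m hom_top b v).
Proof. exact: lift_gens. Qed.

Lemma contract_top g (b : aut (P g)) s v : hom_top (contract b s) v = hom_top b v.
Proof.
rewrite {1}/hom_top -mulmxA contract_gens mulmxDr !mulmxA top_gens mul1mx.
rewrite -scalemxAr mulmxBr !mulmxA top_gens mul1mx -/(hom_top b v) subrr scaler0 addr0.
by [].
Qed.

Fact contract_iso g (b : aut (P g)) s : is_iso (contract b s).
Proof. by apply: (hom_top_iso hQ) => v; rewrite contract_top; exact: hom_top_unit. Qed.

Definition contract_aut g (b : aut (P g)) s : aut (P g) := Aut (contract_iso b s).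

Lemma contract1 g (b : aut (P g)) : contract_aut b 1 = b.
Proof.
have e : aut_hom (contract_aut b 1) = b.
  apply: (hom_gens_eq hQ) => u; rewrite contract_gens scale1r addrC subrK.
  by [].
by apply: aut_eq => v; rewrite e.
Qed.

Lemma contract0 g (b : aut (P g)) : contract_aut b 0 = embed hQ (topgl b).
Proof.
have e : aut_hom (contract_aut b 0) = embed hQ (topgl b).
  apply: (hom_gens_eq hQ) => u; rewrite contract_gens scale0r addr0 embed_gens.
  by [].
by apply: aut_eq => v; rewrite e.
Qed.

Lemma polyfun_contract g (b : aut (P g)) v : alg_mx (@polyfun k) (fun s => contract b s v).
Proof. apply: alg_lift => [|u]; [exact: polyfun_alg | exact: polyfun_line]. Qed.

Section Weights.
Variables (chi : grp VP -> k) (f : pres -> k).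
Hypotheses (chiC : character chi) (fS : semi_invariant chi f).

Let one g : aut (P g) := aut_one (P g).
Let chil (g : aut (P alpha)) : k := chi (g, one gamma).
Let chir (b : aut (P gamma)) : k := chi (one alpha, b).

Lemma aut_mul1 g (b : aut (P g)) : aut_mul b (one g) = b.
Proof. by apply: aut_eq => v; rewrite aut_mulE mulmx1. Qed.

Lemma chi_split g b : chi (g, b) = chil g * chir b.
Proof. by have [_ M] := chiC; rewrite -M /= aut_mul1 aut_mul1. Qed.

Lemma semi_left (g : aut (P alpha)) (phi : pres) : f (hom_comp g phi) = chil g * f phi.
Proof.
have [_ <-] := fS; congr f; apply: hom_eq => v; rewrite /= mulmx1.
by [].
Qed.

Lemma semi_right (b : aut (P gamma)) (phi : pres) : f (hom_comp phi b) = chir b * f phi.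
Proof.
have [_ <-] := fS; congr f; apply: hom_eq => v; rewrite /= mul1mx.
by [].
Qed.

Variable phi0 : pres.
Hypothesis f0 : f phi0 != 0.

(** On block diagonal automorphisms [gl_character] applies.  The character is
    constant on the line [contract g], since along it the values of f at the
    translates of phi0 form a polynomial without zeros. *)
Lemma left_weight : exists z : 'I_n -> int, forall g, chil g = \prod_v \det (hom_top g v) ^ z v.
Proof.
have [nz M] := chiC; have [fr _] := fS.
have [||v A B|z zE] := @gl_character k n alpha (fun g => chil (embed hQ g)).
- by move=> g; exact: nz.
- by move=> g h; rewrite /chil embedM -M /= aut_mul1.
- have [p pE] : polyfun (fun s =>
    f (hom_comp (embed_hom hQ (at_mx (d1 := alpha) (fun=> 1%:M) (A + s *: B))) phi0)).
    apply: regular_curve fr => u; apply: alg_comp => [||w]; first exact: polyfun_alg.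
      move=> w; apply: alg_lift => [|x]; first exact: polyfun_alg.
      apply: alg_mxM; [exact: polyfun_alg | apply: alg_mx_const; exact: polyfun_alg |].
      by apply: alg_at_mx; [exact: polyfun_alg | exact: polyfun_line].
    by apply: alg_mx_const; exact: polyfun_alg.
  exists 0%N, ((f phi0)^-1 *: p) => s ds.
  rewrite expr0 mulr1 hornerZ -pE -top_gl_at ?unitmxE ?unitfE // semi_left.
  by rewrite mulrC mulfK.
exists z => g; rewrite -(zE (topgl g)) /=.
have [p pE] : polyfun (fun s => f (hom_comp (contract g s) phi0)).
  apply: regular_curve fr => u; apply: alg_comp => [||w]; first exact: polyfun_alg.
    by move=> w; exact: polyfun_contract.
  by apply: alg_mx_const; exact: polyfun_alg.
have pE' s : p.[s] = chil (contract_aut g s) * f phi0 by rewrite -pE -semi_left.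
have pc := @nowhere_zero_poly _ p.
apply: (mulIf f0); rewrite -contract0 -{1}(contract1 g) -!pE' pc ?hornerC // => s.
by rewrite pE' mulf_neq0 // nz.
Qed.

Lemma right_weight : exists z : 'I_n -> int, forall b, chir b = \prod_v \det (hom_top b v) ^ z v.
Proof.
have [nz M] := chiC; have [fr _] := fS.
have [||v A B|z zE] := @gl_character k n gamma (fun g => chir (embed hQ g)).
- by move=> g; exact: nz.
- by move=> g h; rewrite /chir embedM mulrC -M /= aut_mul1.
- have [p pE] : polyfun (fun s =>
    f (hom_comp phi0 (embed_hom hQ (at_mx (d1 := gamma) (fun=> 1%:M) (A + s *: B))))).
    apply: regular_curve fr => u; apply: alg_comp => [||w]; first exact: polyfun_alg.
      by move=> w; apply: alg_mx_const; exact: polyfun_alg.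
    apply: alg_lift => [|x]; first exact: polyfun_alg.
    apply: alg_mxM; [exact: polyfun_alg | apply: alg_mx_const; exact: polyfun_alg |].
    by apply: alg_at_mx; [exact: polyfun_alg | exact: polyfun_line].
  exists 0%N, ((f phi0)^-1 *: p) => s ds.
  rewrite expr0 mulr1 hornerZ -pE -top_gl_at ?unitmxE ?unitfE // semi_right.
  by rewrite mulrC mulfK.
exists z => g; rewrite -(zE (topgl g)) /=.
have [p pE] : polyfun (fun s => f (hom_comp phi0 (contract g s))).
  apply: regular_curve fr => u; apply: alg_comp => [||w]; first exact: polyfun_alg.
    by move=> w; apply: alg_mx_const; exact: polyfun_alg.
  exact: polyfun_contract.
have pE' s : p.[s] = chir (contract_aut g s) * f phi0 by rewrite -pE -semi_right.
have pc := @nowhere_zero_poly _ p.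
apply: (mulIf f0); rewrite -contract0 -{1}(contract1 g) -!pE' pc ?hornerC // => s.
by rewrite pE' mulf_neq0 // nz.
Qed.

End Weights.


Lemma hom_top_lin g1 g2 (f h : hom (P g1) (P g2)) c v :
  hom_top (hom_lin f c h) v = hom_top f v + c *: hom_top h v.
Proof. by rewrite /hom_top /= mulmxDr mulmxDl -scalemxAr -scalemxAl. Qed.

Lemma hom_top_id g v : hom_top (hom_id (P g)) v = 1%:M.
Proof. by rewrite /hom_top /= mulmx1 top_gens. Qed.

Lemma det_delta m p (e : 'M[k]_(m, p)) i l c :
  \det (1%:M + (c *: delta_mx l i) *m e) = 1 + c * e i l /\
  \det (1%:M + e *m (c *: delta_mx l i)) = 1 + c * e i l.
Proof.
have -> : c *: delta_mx l i = (c *: delta_mx l 0) *m delta_mx (0 : 'I_1) i.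
  by rewrite -scalemxAl mul_delta_mx.
split.
  by rewrite -mulmxA det_rank1 -scalemxAr mxE -rowE -colE !mxE.
by rewrite mulmxA det_rank1 -scalemxAr -scalemxAr -colE mxE -rowE !mxE.
Qed.

(** The automorphisms 1 + psi h of P(alpha) and 1 + h psi of P(gamma), for a
    morphism h : P(alpha) -> P(gamma), are intertwined by psi.  They force the
    weights of a semi-invariant at the two sides to agree wherever both
    P(alpha) and P(gamma) have generators. *)
Lemma homotopy_weights (chi : grp VP -> k) (f : pres -> k) (z0 z1 : 'I_n -> int)
    (psi : pres) v i l :
  character chi -> semi_invariant chi f ->
  (forall g, chi (g, aut_one (P gamma)) = \prod_v \det (hom_top g v) ^ z0 v) ->
  (forall b, chi (aut_one (P alpha), b) = \prod_v \det (hom_top b v) ^ z1 v) ->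
  f psi != 0 -> hom_top psi v i l != 0 -> z0 v = z1 v.
Proof.
move=> chiC fS E0 E1 fpsi enz; apply: (@expz_inj k) => s snz.
pose c := (s - 1) / hom_top psi v i l.
pose H : 'M[k]_(gamma v, alpha v) := c *: delta_mx l i.
pose h : hom (P alpha) (P gamma) := lift hQ (P gamma) (fun u => gens gamma u *m
  at_mx (d1 := gamma) (d2 := alpha) (fun u => 0) H u).
have htop u : hom_top h u = at_mx (d1 := gamma) (d2 := alpha) (fun u => 0) H u.
  by rewrite /hom_top -mulmxA lift_gens mulmxA top_gens mul1mx.
have cE : 1 + c * hom_top psi v i l = s by rewrite divfK // addrC subrK.
have [det1 det2] := det_delta (hom_top psi v) i l c; rewrite cE -/H in det1 det2.
pose b := hom_lin (hom_id (P gamma)) 1 (hom_comp h psi).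
pose g := hom_lin (hom_id (P alpha)) 1 (hom_comp psi h).
have btop u : hom_top b u = 1%:M + hom_top h u *m hom_top psi u.
  by rewrite hom_top_lin hom_top_id scale1r hom_top_comp.
have gtop u : hom_top g u = 1%:M + hom_top psi u *m hom_top h u.
  by rewrite hom_top_lin hom_top_id scale1r hom_top_comp.
have bv : hom_top b v = 1%:M + H *m hom_top psi v by rewrite btop htop at_mx_same.
have gv : hom_top g v = 1%:M + hom_top psi v *m H by rewrite gtop htop at_mx_same.
have bu u : u != v -> hom_top b u = 1%:M.
  by move=> ne; rewrite btop htop at_mx_other // mul0mx addr0.
have gu u : u != v -> hom_top g u = 1%:M.
  by move=> ne; rewrite gtop htop at_mx_other // mulmx0 addr0.
have biso : is_iso b.
  apply: (hom_top_iso hQ) => u; have [->|ne] := eqVneq u v; last by rewrite bu ?unitmx1.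
  by rewrite bv unitmxE det1 unitfE.
have giso : is_iso g.
  apply: (hom_top_iso hQ) => u; have [->|ne] := eqVneq u v; last by rewrite gu ?unitmx1.
  by rewrite gv unitmxE det2 unitfE.
have comm : hom_comp (Aut giso) psi = hom_comp psi (Aut biso).
  apply: hom_eq => u; rewrite !hom_compE /= !scale1r mulmxDl mulmxDr mul1mx mulmx1.
  by rewrite mulmxA.
have := semi_left fS (Aut giso) psi; rewrite comm (semi_right fS) => /(mulIf fpsi).
rewrite E0 E1 (det_at_prod _ bv bu) (det_at_prod _ gv gu) det1 det2.
by [].
Qed.

Hypothesis supp : forall v, (0 < gamma v)%N -> (0 < alpha v)%N.

Lemma det_size0 m (A : 'M[k]_m) : m = 0%N -> \det A = 1.
Proof. by move=> e; move: A; rewrite e => A; rewrite det_mx00. Qed.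

Lemma slot_gl_far (g : gl k alpha) u v : (forall w, w != u -> g w = 1%:M) ->
  (depth v <= depth u)%N -> slot_gl hQ g v = 1%:M.
Proof.
move=> gw le; rewrite /= -(sel_sum k hQ alpha v); apply: eq_bigr => a _.
have [e|ne] := eqVneq (hd a) v; last by rewrite sel_off // !mul0mx.
rewrite gw ?invmx1 ?mulmx1 //; apply: contraTneq (depth_lt hQ a) => tu.
by rewrite tu e -leqNgt.
Qed.

Lemma exists_det m (s : k) : (0 < m)%N -> exists A : 'M[k]_m, \det A = s.
Proof.
case: m => // m _; exists (1%:M + delta_mx 0 (0 : 'I_1) *m ((s - 1) *: delta_mx (0 : 'I_1) 0)).
by rewrite det_rank1 -scalemxAl mul_delta_mx !mxE !eqxx mulr1 addrC subrK.
Qed.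

Lemma weights_agree_sides (th : grp VP -> k) (h : pres -> k) z0 z1 :
  character th -> semi_invariant th h -> (exists psi, h psi != 0) ->
  (forall g, th (g, aut_one (P gamma)) = \prod_v \det (hom_top g v) ^ z0 v) ->
  (forall b, th (aut_one (P alpha), b) = \prod_v \det (hom_top b v) ^ z1 v) ->
  forall v, (0 < gamma v)%N -> z0 v = z1 v.
Proof.
move=> thC hS [psi hpsi] E0 E1 v gv; have av := supp gv.
pose i : 'I_(alpha v) := Ordinal av; pose l : 'I_(gamma v) := Ordinal gv.
pose psi1 : pres := lift hQ (P alpha) (fun u => gens alpha u *m const_mx 1).
have reg : @regular k VP (fun psi => hom_top psi v i l).
  have rA := regular_alg VP; suff : alg_mx (@regular k VP) (fun psi => hom_top psi v) by exact.
  apply: (alg_mxM rA); last exact: alg_mx_const.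
  by apply: (alg_mxM rA); [exact: alg_mx_const | exact: regular_pres].
have nz : hom_top psi1 v i l != 0.
  by rewrite /hom_top -mulmxA lift_gens mulmxA top_gens mul1mx mxE oner_neq0.
have [hr _] := hS.
have [phi [p1 p2]] := regular_neq0_mul (@pres_lines k n Q alpha) hr reg hpsi nz.
exact: homotopy_weights thC hS E0 E1 p1 p2.
Qed.

Section Compare.
Variables (chi chi' : grp VP -> k) (f f' : pres -> k).
Hypotheses (chiC : character chi) (fS : semi_invariant chi f) (fnz : exists psi, f psi != 0).
Hypotheses (chiC' : character chi') (fS' : semi_invariant chi' f') (fnz' : exists psi, f' psi != 0).
Hypothesis eq_rho : forall g, chi (rho hQ g) = chi' (rho hQ g).

(** An element of GL(alpha_u) acts on the generators of P(alpha) at u, with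
    weight z0_u, and on those of P(gamma) at the heads of the arrows out of u,
    with weights that agree with those of P(alpha) at these heads.  So the
    weights are determined by the restricted character, from the ends of the
    longest paths backwards. *)
Lemma restriction_determines_right (b : aut (P gamma)) :
  chi (aut_one (P alpha), b) = chi' (aut_one (P alpha), b).
Proof.
have [psi fpsi] := fnz; have [psi' fpsi'] := fnz'.
have [z0 E0] := left_weight chiC fS fpsi; have [z1 E1] := right_weight chiC fS fpsi.
have [y0 F0] := left_weight chiC' fS' fpsi'; have [y1 F1] := right_weight chiC' fS' fpsi'.
have zz := weights_agree_sides chiC fS fnz E0 E1.
have yy := weights_agree_sides chiC' fS' fnz' F0 F1.
have zy u : (0 < alpha u)%N -> z0 u = y0 u.
  have [m] := ubnP (\max_v depth v - depth u); elim: m u => // m IH u; rewrite ltnS => mu au.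
  apply: (@expz_inj k) => s snz; have [A As] := exists_det s au.
  have Au : A \in unitmx by rewrite unitmxE As unitfE.
  pose g := gl_at A.
  have gu : hom_top (embed hQ g) u = A by rewrite embed_top gl_at_same.
  have gw w : w != u -> hom_top (embed hQ g) w = 1%:M by move=> ne; rewrite embed_top gl_at_other.
  have := eq_rho g.
  have -> := chi_split chiC (embed hQ g) (embed hQ (slot_gl hQ g)).
  have -> := chi_split chiC' (embed hQ g) (embed hQ (slot_gl hQ g)).
  rewrite E0 E1 F0 F1.
  have -> := @det_at_prod k n alpha u A (hom_top (embed hQ g)) z0 gu gw.
  have -> := @det_at_prod k n alpha u A (hom_top (embed hQ g)) y0 gu gw.
  rewrite As.
  have -> : \prod_v \det (hom_top (embed hQ (slot_gl hQ g)) v) ^ z1 v =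
            \prod_v \det (hom_top (embed hQ (slot_gl hQ g)) v) ^ y1 v.
    apply: eq_bigr => v _; have [gv|] := posnP (gamma v); first by rewrite det_size0 // !exp1rz.
    move=> gv; have [le|lt] := leqP (depth v) (depth u).
      rewrite embed_top (slot_gl_far _ le) ?det1 ?exp1rz // => w ne.
      exact: gl_at_other.
    rewrite -zz // -yy //; congr (_ ^ _); apply: IH; last exact: supp.
    have lm : (depth u < \max_v depth v)%N := leq_trans lt (@leq_bigmax _ depth v).
    by apply: (leq_trans _ mu); rewrite ltn_sub2l.
  apply: mulIf; apply/prodf_neq0 => v _; rewrite expfz_neq0 //.
  by rewrite -unitfE -unitmxE embed_top glP.
rewrite E1 F1; apply: eq_bigr => v _; have [gv|gv] := posnP (gamma v).
  by rewrite det_size0 // !exp1rz.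
by rewrite -zz // -yy // zy ?supp.
Qed.

End Compare.

(** On good presentations [canon_factor] expresses a sum of semi-invariants by
    their restrictions and characters; then apply [character_relation] to the
    restricted characters. *)
Lemma restrict_injective : injective (@restrict k n Q hQ alpha).
Proof.
move=> f0 f1 ef; apply/eqP; rewrite -subr_eq0; apply/eqP; set f := f0 - f1.
have fz M : SI_val f (canon hQ M) = 0.
  have := congr1 (fun h : SI VR => SI_val h M) ef => /eqP; rewrite -subr_eq0 => /eqP.
  by [].
apply: SI_eq; apply/funext => phi; rewrite [RHS](_ : _ = 0) //.
have /asboolP[m [F [FP fE]]] := SI_valP f.
have [chi chiP] : {chi : 'I_m -> grp VP -> k &
    forall i, character (chi i) /\ semi_invariant (chi i) (F i)}.
  apply: (choice (P := fun i c => character c /\ semi_invariant c (F i))) => i.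
  by have [c] := FP i; exists c.
have fsum psi : SI_val f psi = \sum_i F i psi by rewrite fE fct_sumE.
apply: (@regular_good_eq0 k n Q hQ alpha (SI_val f)) => [|{}phi U].
  have -> : SI_val f = (fun psi => \sum_i F i psi) by apply/funext => psi.
  by apply: (alg_sum (regular_alg VP)) => i _; have [_ []] := chiP i.
have [b phiE] := canon_factor U; set M := coker hQ phi in phiE.
pose s := [seq i <- index_enum 'I_m | `[< exists psi, F i psi != 0 >]].
have sumF psi : \sum_i F i psi = \sum_(i <- s) F i psi.
  rewrite big_filter [LHS](bigID (fun i => `[< exists psi, F i psi != 0 >])) /=.
  rewrite [X in _ + X]big1 ?addr0 // => i /asboolPn H.
  by apply/eqP; apply: contra_notT H => ?; exists psi.
rewrite fsum sumF.
rewrite (eq_bigr (fun i => chi i (aut_one (P alpha), b) * F i (canon hQ M))) => [|i _]; last first.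
  by have [_ S] := chiP i; rewrite -(semi_right S) -phiE.
pose idgl : gl k alpha := GL (fun v => unitmx1 k (alpha v)).
apply: (@character_relation k (gl k alpha) (@gl_mul k n alpha) idgl _ s
  (fun i g => chi i (rho hQ g)) (fun i => F i (canon hQ M))
  (fun i => chi i (aut_one (P alpha), b))).
- move=> i g h; have [[nz mulC] S] := chiP i; by rewrite rhoM mulC.
- by move=> i; have [[nz _] _] := chiP i.
- move=> g; rewrite -[RHS](fz (rep_act g M)) fsum sumF; apply: eq_bigr => i _.
  have [_ [_ S]] := chiP i; rewrite -S; congr (F i _).
  by rewrite canon_equivariant.
- move=> i j; rewrite !mem_filter => /andP[/asboolP nzi _] /andP[/asboolP nzj _] e.
  have [ci si] := chiP i; have [cj sj] := chiP j.
  apply: (restriction_determines_right ci si nzi cj sj nzj) => g.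
  exact: (congr1 (fun h => h g) e).
Qed.

End Injectivity.

(** * Extension of a semi-invariant of R(alpha) to good presentations *)
Section Localization.
Variables (k : closedFieldType) (T : Type) (A : (T -> k) -> Prop).

Lemma localization_eq delta h h' : (forall x, delta x != 0 -> h x = h' x) ->
  localization A delta h -> localization A delta h'.
Proof. by move=> e [d [p [Ap H]]]; exists d, p; split=> // x dx; rewrite -e // H. Qed.

Lemma alg_expz (algA : fun_algebra A) h (z : int) :
  A h -> A (fun x => (h x)^-1) -> A (fun x => h x ^ z).
Proof.
move=> Ah Ahi; case: z => m; first exact: alg_exp algA _ _ Ah.
have -> : (fun x => h x ^ Negz m) = (fun x => (h x)^-1 ^+ m.+1).
  by apply/funext => x; rewrite NegzE -exprnN exprVn.
exact: alg_exp algA _ _ Ahi.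
Qed.

End Localization.

Section Extension.
Variables (k : closedFieldType) (n : nat) (Q : quiver n).
Hypothesis hQ : acyclic Q.
Variable alpha : 'I_n -> nat.
Local Notation gamma := (coexp Q alpha).
Local Notation P gamma := (@projrep k n Q gamma).
Local Notation pres := (hom (P gamma) (P alpha)).
Local Notation VP := (pres_variety k Q alpha gamma).
Local Notation VR := (rep_variety k Q alpha).
Local Notation gens := (@gens k n Q).
Local Notation frame_det := (@frame_det k n Q hQ alpha).
Local Notation good := (@good k n Q hQ alpha).
Local Notation frames_det := (@frames_det k n Q hQ alpha).
Local Notation coker := (@coker k n Q hQ alpha).
Local Notation prj := (@prj k n Q hQ alpha).
Local Notation p0 := (canon hQ (fun a => 0 : 'M[k]_(alpha (hd a), alpha (tl a)))).

Variables (eta : grp VR -> k) (F : rep k Q alpha -> k) (N0 : rep k Q alpha).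
Hypotheses (etaC : character eta) (FS : semi_invariant eta F) (F0 : F N0 != 0).

Lemma invmx_at v (X : 'M[k]_(alpha v)) u : X \in unitmx ->
  invmx (gl_at X u) = at_mx (d1 := alpha) (d2 := alpha) (fun=> 1%:M) (invmx X) u.
Proof.
move=> Xu; have [->|ne] := eqVneq u v; first by rewrite gl_at_same // at_mx_same.
by rewrite gl_at_other // at_mx_other // invmx1.
Qed.

Lemma rep_weight : exists z : 'I_n -> int, forall g, eta g = \prod_v \det (g v) ^ z v.
Proof.
have [nz M] := etaC; have [Fr FE] := FS.
apply: gl_character => // v A B.
pose delta s : k := \det (A + s *: B).
have pA := polyfun_alg k.
have dA : polyfun delta by apply: (alg_det pA); exact: polyfun_line.
have lA : fun_algebra (localization (@polyfun k) delta) := localization_alg pA dA.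
have di : localization (@polyfun k) delta (fun s => (delta s)^-1).
  apply: (localization_inv dA) => //; exists (fun=> 1); split; first exact: alg_const.
  by move=> s; rewrite mulr1.
have atA (X : k -> 'M[k]_(alpha v)) u : alg_mx (localization (@polyfun k) delta) X ->
    alg_mx (localization (@polyfun k) delta)
      (fun s => at_mx (d1 := alpha) (d2 := alpha) (fun=> 1%:M) (X s) u).
  by move=> AX; exact: alg_at_mx.
have lX : alg_mx (localization (@polyfun k) delta) (fun s => A + s *: B).
  by move=> r c; apply: localization_sub; exact: polyfun_line.
have lXi : alg_mx (localization (@polyfun k) delta) (fun s => (delta s)^-1 *: \adj (A + s *: B)).
  by apply: (alg_mxZ lA) => //; exact: alg_adj.
have : localization (@polyfun k) delta (fun s => F (rep_act (gl_at (A + s *: B)) N0)).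
  apply: (regular_comp (X := VR) lA) Fr => -[a [r c]] /=.
  have L : alg_mx (localization (@polyfun k) delta) (fun s =>
      at_mx (d1 := alpha) (d2 := alpha) (fun=> 1%:M) (A + s *: B) (hd a) *m N0 a *m
      at_mx (d1 := alpha) (d2 := alpha) (fun=> 1%:M) ((delta s)^-1 *: \adj (A + s *: B)) (tl a)).
    apply: (alg_mxM lA); last exact: atA.
    by apply: (alg_mxM lA); [exact: atA | exact: alg_mx_const].
  apply: localization_eq (L r c) => s ds; rewrite /rep_act.
  have Xu : A + s *: B \in unitmx by rewrite unitmxE unitfE.
  by rewrite invmx_at // /invmx Xu /= Xu.
case=> d [q [[p pE] H]]; exists d, ((F N0)^-1 *: p) => s ds.
by rewrite hornerZ -pE -H // FE [eta _ * F N0]mulrC -!mulrA mulKf.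
Qed.

Section Values.
Variable sigma : 'I_n -> int.
Hypothesis etaE : forall g, eta g = \prod_v \det (g v) ^ sigma v.

(** The extension of F to good presentations: its value at the cokernel,
    corrected by powers of the determinants of the frames *)
Definition good_ext (phi : pres) : k :=
  (\prod_v (frame_det phi v / frame_det p0 v) ^ sigma v) * F (coker phi).

Lemma ext_canon M : good_ext (canon hQ M) = F M.
Proof.
rewrite /good_ext coker_canon big1 ?mul1r // => v _.
by rewrite (frame_det_canon hQ M (fun a => 0)) divff ?exp1rz //; exact: canon_good.
Qed.

Lemma frames_det_frame_det phi v : frames_det phi != 0 -> frame_det phi v != 0.
Proof. by move=> /frames_det_good; exact. Qed.

Lemma inv_frame_det_loc v :
  localization (@regular k VP) frames_det (fun phi => (frame_det phi v)^-1).
Proof.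
have rA := regular_alg VP.
apply: (@localization_inv k pres (@regular k VP) frames_det (fun phi => frame_det phi v)).
  exact: regular_frame_det.
  by move=> phi; exact: frames_det_frame_det.
exists (fun phi => \prod_(w | w != v) frame_det phi w); split.
  by apply: (alg_prod rA) => w _; exact: regular_frame_det.
by move=> phi; rewrite frames_detE [RHS](bigD1 v).
Qed.

Lemma coker_loc a : alg_mx (localization (@regular k VP) frames_det) (fun phi => coker phi a).
Proof.
have rA := regular_alg VP; have lA := localization_alg rA (@regular_frames_det k n Q hQ alpha).
pose prj' (phi : pres) v := dsubmx (castmx (erefl, esym (Pdim_coexp k hQ alpha v))
  ((frame_det phi v)^-1 *: \adj (frame hQ phi v))).
have L : alg_mx (localization (@regular k VP) frames_det)
    (fun phi => prj' phi (hd a) *m P alpha a *m gens alpha (tl a)).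
  apply: (alg_mxM lA); last exact: alg_mx_const.
  apply: (alg_mxM lA); last exact: alg_mx_const.
  move=> r c; rewrite /prj'; under eq_fun do rewrite mxE.
  apply: alg_mx_cast; apply: (alg_mxZ lA); first exact: inv_frame_det_loc.
  move=> i j; apply: localization_sub; apply: (alg_adj rA).
  apply: alg_mx_cast; apply: alg_row_mx; [exact: regular_pres | exact: alg_mx_const].
move=> r c; apply: localization_eq (L r c) => phi D.
rewrite cokerE prjE /prj' /invmx unitmxE unitfE -frame_detE.
by rewrite (frames_det_frame_det (hd a) D).
Qed.

Lemma ext_loc : localization (@regular k VP) frames_det good_ext.
Proof.
have rA := regular_alg VP; have lA := localization_alg rA (@regular_frames_det k n Q hQ alpha).
apply: (alg_mul lA); last first.
  have [Fr _] := FS.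
  by apply: (regular_comp (X := VR) lA) Fr => -[a [r c]]; exact: coker_loc.
apply: (alg_prod lA) => v _; apply: (alg_expz lA).
  apply: (alg_mul lA); last exact: alg_const.
  by apply: localization_sub; exact: regular_frame_det.
under eq_fun do rewrite invfM.
by apply: (alg_mul lA); [exact: inv_frame_det_loc | exact: alg_const].
Qed.

Lemma det_cast_mull m m' (e : m = m') (A : 'M[k]_m) (B : 'M_(m, m')) :
  \det (castmx (e, erefl) (A *m B)) = \det A * \det (castmx (e, erefl) B).
Proof. by case: m' / e B => B; rewrite !castmx_id det_mulmx. Qed.

Lemma det_cast_mulr m m' (e : m = m') (A : 'M[k]_(m, m')) (B : 'M_m') :
  \det (castmx (e, erefl) (A *m B)) = \det (castmx (e, erefl) A) * \det B.
Proof. by case: m' / e A B => A B; rewrite !castmx_id det_mulmx. Qed.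

Lemma frame_det_right (phi : pres) (b : aut (P gamma)) v :
  frame_det (hom_comp phi b) v = frame_det phi v * \det (b v).
Proof.
rewrite !frame_detE /frame.
have -> : row_mx (hom_comp phi b v) (gens alpha v) =
    row_mx (phi v) (gens alpha v) *m block_mx (b v) 0 0 1%:M.
  by rewrite mul_row_block !mulmx0 addr0 add0r mulmx1 hom_compE.
by rewrite det_cast_mulr det_ublock det1 mulr1.
Qed.

Lemma good_right (phi : pres) (b : aut (P gamma)) : good phi -> good (hom_comp phi b).
Proof. by move=> U v; rewrite frame_det_right mulf_neq0 // -unitfE -unitmxE aut_unit. Qed.

Lemma coker_right (phi : pres) (b : aut (P gamma)) : good phi ->
  coker (hom_comp phi b) = coker phi.
Proof.
move=> U; have Ub := good_right b U; apply: functional_extensionality_dep => a.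
congr (_ *m _ *m _); apply: (frame_agree (Ub (hd a))); last by rewrite !prj_gens.
by rewrite prj_phi // hom_compE mulmxA prj_phi // mul0mx.
Qed.

Lemma ext_right (phi : pres) (b : aut (P gamma)) : good phi ->
  good_ext (hom_comp phi b) = (\prod_v \det (b v) ^ sigma v) * good_ext phi.
Proof.
move=> U; rewrite /good_ext coker_right // mulrA -big_split /=; congr (_ * _).
by apply: eq_bigr => v _; rewrite frame_det_right mulrAC mulrC expfzMl.
Qed.

Section Left.
Variables (phi : pres) (g : aut (P alpha)).
Hypotheses (U : good phi) (Ug : good (hom_comp g phi)).

(** The isomorphism induced by [g] on cokernels *)
Let h v : 'M[k]_(alpha v) := prj (hom_comp g phi) v *m g v *m gens alpha v.

Let h_prj v : prj (hom_comp g phi) v *m g v = h v *m prj phi v.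
Proof.
apply: (frame_agree (U v)); last by rewrite -[RHS]mulmxA prj_gens // mulmx1.
by rewrite -mulmxA -hom_compE (prj_phi (Ug v)) -mulmxA (prj_phi (U v)) mulmx0.
Qed.

Let h_unit v : h v \in unitmx.
Proof.
have [g' g'P] := autP g; have [g1 g2] := g'P v.
have e : prj phi v *m g' v = (prj phi v *m g' v *m gens alpha v) *m prj (hom_comp g phi) v.
  apply: (frame_agree (Ug v)); last by rewrite -[RHS]mulmxA prj_gens // mulmx1.
  rewrite -[RHS]mulmxA prj_phi // mulmx0 hom_compE -!mulmxA [g' v *m _]mulmxA g1 mul1mx.
  by rewrite prj_phi.
have : (prj phi v *m g' v *m gens alpha v) *m h v = 1%:M.
  by rewrite /h !mulmxA -e -!mulmxA [g' v *m _]mulmxA g1 mul1mx prj_gens.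
by case/mulmx1_unit.
Qed.

Let coker_left : coker (hom_comp g phi) = rep_act (GL h_unit) (coker phi).
Proof.
apply: functional_extensionality_dep => a; rewrite /rep_act /=.
rewrite -[LHS](mulmxK (h_unit (tl a))); congr (_ *m invmx _).
transitivity (prj (hom_comp g phi) (hd a) *m (P alpha a *m g (tl a)) *m gens alpha (tl a)).
  by rewrite /h !mulmxA -prj_comm.
by rewrite -hom_comm mulmxA h_prj cokerE !mulmxA.
Qed.

Let frame_det_left v : frame_det (hom_comp g phi) v * \det (h v) = \det (g v) * frame_det phi v.
Proof.
rewrite !frame_detE /frame -det_cast_mull mul_mx_row.
have e : g v *m gens alpha v =
    hom_comp g phi v *m (ret hQ (hom_comp g phi) v *m g v *m gens alpha v) +
    gens alpha v *m h v.
  by rewrite /h !mulmxA -mulmxDl -mulmxDl ret_prj // mul1mx.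
have -> : row_mx (g v *m phi v) (g v *m gens alpha v) = row_mx (hom_comp g phi v) (gens alpha v) *m
    block_mx 1%:M (ret hQ (hom_comp g phi) v *m g v *m gens alpha v) 0 (h v).
  by rewrite mul_row_block mulmx1 mulmx0 addr0 -e.
by rewrite det_cast_mulr det_ublock det1 mul1r.
Qed.

Lemma ext_left : good_ext (hom_comp g phi) = (\prod_v \det (g v) ^ sigma v) * good_ext phi.
Proof.
have [_ FE] := FS; rewrite /good_ext coker_left FE etaE !mulrA -!big_split /=; congr (_ * _).
apply: eq_bigr => v _; rewrite -!expfzMl; congr (_ ^ _).
by rewrite mulrAC frame_det_left mulrA.
Qed.

End Left.

End Values.

End Extension.

(** * Observable pairs *)
Section Krylov.
Variable k : closedFieldType.

(** Its rows r, r A, r A^2, .. form a basis exactly when the pair (A, r) is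
    observable. *)
Definition krylov m (r : 'rV[k]_m) (A : 'M[k]_m) : 'M[k]_m :=
  \matrix_i iter i (mulmx^~ A) r.

(** A vector in the kernel of A + t and of r is killed by all rows r A^i, hence
    zero; so it suffices to choose c outside the image of A + t. *)
Lemma krylov_shift m (r : 'rV[k]_m) (A : 'M[k]_m) t : krylov r A \in unitmx ->
  exists c : 'cV[k]_m, A + t%:M + c *m r \in unitmx.
Proof.
move=> Ku; have obs (x : 'cV[k]_m) : (A + t%:M) *m x = 0 -> r *m x = 0 -> x = 0.
  move=> Ax rx; have Ax' : A *m x = - t *: x.
    by move/eqP: Ax; rewrite mulmxDl mul_scalar_mx addr_eq0 scaleNr => /eqP.
  rewrite -[x](mulKmx Ku); suff -> : krylov r A *m x = 0 by rewrite mulmx0.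
  apply/row_matrixP => i; rewrite row_mul rowK row0.
  elim: (i : nat) => //= j IH.
  by rewrite -mulmxA Ax' -scalemxAr IH scaler0.
have [Au|] := boolP (A + t%:M \in unitmx); first by exists 0; rewrite mul0mx addr0.
rewrite -unitmx_tr -row_free_unit -row_leq_rank -ltnNge => rk_lt_m.
have [i nsub] : exists i : 'I_m, ~~ (row i (1%:M : 'M[k]_m) <= (A + t%:M)^T)%MS.
  apply: contrapT => H; move: rk_lt_m; rewrite ltnNge => /negP[].
  rewrite -{1}(mxrank1 k m); apply: mxrankS; apply/row_subP => i.
  by apply: contra_notT H => ns; exists i.
exists (row i 1%:M)^T; rewrite -unitmx_tr; apply: unitmx_ker => y ye.
have {}ye : (A + t%:M) *m y^T + (row i 1%:M)^T *m (r *m y^T) = 0.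
  by rewrite mulmxA -mulmxDl -[LHS]trmxK trmx_mul trmxK ye trmx0.
have ry : r *m y^T = 0.
  apply: contraNeq nsub => rnz; set b := (r *m y^T) 0 0.
  have rE : r *m y^T = b%:M by rewrite [LHS]mx11_scalar.
  have bnz : b != 0 by apply: contra_neq rnz => b0; rewrite rE b0 raddf0.
  apply/submxP; exists (- b^-1 *: y); rewrite -scalemxAl.
  move/eqP: ye; rewrite rE mul_mx_scalar addrC addr_eq0 => /eqP/(congr1 trmx).
  rewrite linearZ linearN /= trmxK trmx_mul trmxK => e.
  by rewrite scaleNr -scalerN -e scalerA mulVf // scale1r.
rewrite ry mulmx0 addr0 in ye.
by rewrite -[y]trmxK (obs _ ye ry) trmx0.
Qed.

Lemma krylov_jordan m (c : k) : c != 0 ->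
  krylov (\row_l (l == 0%N :> nat)%:R)
    (c *: \matrix_(i < m, l < m) (l == i.+1 :> nat)%:R) \in unitmx.
Proof.
move=> cnz; set r := \row__ _; set J := \matrix_(_, _) _.
have it i : iter i (mulmx^~ (c *: J)) r = c ^+ i *: \row_l (l == i :> nat)%:R.
  elim: i => [|i IH]; first by rewrite /= expr0 scale1r.
  rewrite iterS IH -scalemxAr -scalemxAl scalerA -exprS; congr (_ *: _).
  apply/rowP => l; rewrite !mxE; have [li|li] := ltnP i m.
    rewrite (bigD1 (Ordinal li)) //= big1 ?addr0 => [|j ji]; last first.
      rewrite mxE; case: eqP => [e|]; last by rewrite mul0r.
      by case/eqP: ji; apply: val_inj.
    by rewrite !mxE eqxx mul1r.
  rewrite big1 => [|j _].
    by case: eqP => // e; move: (ltn_ord l); rewrite e ltnNge (leqW li).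
  rewrite mxE; case: eqP => [e|]; last by rewrite mul0r.
  by move: (ltn_ord j); rewrite e ltnNge li.
have -> : krylov r (c *: J) = diag_mx (\row_i c ^+ i).
  apply/matrixP => i j; rewrite mxE it !mxE eq_sym.
  by rewrite -val_eqE /= mulr_natr.
by rewrite unitmxE det_diag unitfE; apply/prodf_neq0 => i _; rewrite mxE expf_neq0.
Qed.

Lemma alg_krylov T (A : (T -> k) -> Prop) (algA : fun_algebra A) m
    (r : T -> 'rV[k]_m) (M : T -> 'M[k]_m) :
  alg_mx A r -> alg_mx A M -> alg_mx A (fun x => krylov (r x) (M x)).
Proof.
move=> Ar AM i j; rewrite /krylov; under eq_fun do rewrite mxE.
elim: (i : nat) j => [|l IH] j /=; first exact: Ar.
apply: (alg_mxM algA) => // a b; rewrite ord1; exact: IH.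
Qed.

End Krylov.

(** * Extension of a semi-invariant to all presentations *)
Section Hartogs.
Variables (k : closedFieldType) (n : nat) (Q : quiver n).
Hypothesis hQ : acyclic Q.
Variable alpha : 'I_n -> nat.
Local Notation gamma := (coexp Q alpha).
Local Notation P gamma := (@projrep k n Q gamma).
Local Notation pres := (hom (P gamma) (P alpha)).
Local Notation VP := (pres_variety k Q alpha gamma).
Local Notation VR := (rep_variety k Q alpha).
Local Notation gens := (@gens k n Q).
Local Notation top := (@top k n Q).
Local Notation depth := (@depth n Q).
Local Notation frame_det := (@frame_det k n Q hQ alpha).
Local Notation good := (@good k n Q hQ alpha).
Local Notation spans := (@spans k n Q alpha).
Local Notation frame := (@frame k n Q hQ alpha).
Local Notation frames_det := (@frames_det k n Q hQ alpha).
Local Notation p0 := (canon hQ (fun a => 0 : 'M[k]_(alpha (hd a), alpha (tl a)))).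

(** Replaces phi by the canonical presentation of the zero representation on the
    generators at vertices of T *)
Definition reset (T : {set 'I_n}) (phi : pres) : pres :=
  lift hQ (P alpha) (fun v => if v \in T then p0 v *m gens gamma v else phi v *m gens gamma v).

Lemma reset_in (T : {set 'I_n}) phi v : v \in T ->
  reset T phi v *m gens gamma v = p0 v *m gens gamma v.
Proof. by move=> vT; rewrite lift_gens vT. Qed.

Lemma reset_out (T : {set 'I_n}) phi v : v \notin T ->
  reset T phi v *m gens gamma v = phi v *m gens gamma v.
Proof. by move=> vT; rewrite lift_gens (negPf vT). Qed.

Lemma reset_below (T : {set 'I_n}) (phi : pres) v : v \notin T ->
  (forall w, w \in T -> depth v <= depth w)%N ->
  reset T phi v = phi v.
Proof.
move=> vT H; apply: (hom_agree hQ) => u /orP[lt|/eqP->]; apply: reset_out => //.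
by apply/negP => /H; rewrite leqNgt lt.
Qed.

Lemma reset_canon T : reset T p0 = p0.
Proof.
apply: (hom_gens_eq hQ) => u; have [uT|uT] := boolP (u \in T); first exact: reset_in.
exact: reset_out.
Qed.

Lemma reset_setT phi : reset setT phi = p0.
Proof. by apply: (hom_gens_eq hQ) => u; apply: reset_in; rewrite inE. Qed.

Lemma reset_set0 phi : reset set0 phi = phi.
Proof. by apply: (hom_gens_eq hQ) => u; apply: reset_out; rewrite inE. Qed.

Lemma frame_det_eq (phi psi : pres) v : phi v = psi v -> frame_det phi v = frame_det psi v.
Proof. by move=> e; rewrite !frame_detE !frameE e. Qed.

(** By [spans_step], going down the quiver *)
Lemma reset_good (T : {set 'I_n}) (chi : pres) : (forall v, v \notin T -> frame_det chi v != 0) ->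
  (forall v, v \in T -> chi v *m gens gamma v = p0 v *m gens gamma v) -> good chi.
Proof.
move=> H e v; have [m] := ubnP (depth v); elim: m v => // m IH v; rewrite ltnS => rv.
have [vT|vT] := boolP (v \in T); last exact: H.
apply/frame_det_spans; apply: (spans_step (e v vT)) => a ea; apply/frame_det_spans; apply: IH.
by case: v / ea in rv vT *; exact: leq_trans (depth_lt hQ a) rv.
Qed.

(** The sets of vertices that have already been removed from the denominator are
    of this form; they are closed under successors. *)
Definition up (T : {set 'I_n}) := forall v w, v \in T -> w \notin T -> (depth w <= depth v)%N.

Lemma good_reset T phi : up T -> good phi -> good (reset T phi).
Proof.
move=> uT U; apply: (@reset_good T) => [v vT|v]; last exact: reset_in.
by rewrite (@frame_det_eq _ phi) //; apply: reset_below => // w wT; exact: uT.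
Qed.

(** The denominator that is left once the vertices of T have been removed *)
Definition reset_det (T : {set 'I_n}) (phi : pres) : k := frames_det (reset T phi).

Lemma regular_reset T v : alg_mx (@regular k VP) (fun phi => reset T phi v).
Proof.
have rA := regular_alg VP; apply: alg_lift => // w; case: (w \in T).
  exact: alg_mx_const.
by apply: (alg_mxM rA); [exact: regular_pres | exact: alg_mx_const].
Qed.

Lemma regular_reset_det T : @regular k VP (reset_det T).
Proof.
have rA := regular_alg VP; have rD := @regular_frames_det k n Q hQ alpha.
apply: (@regular_comp k VP pres (@regular k VP) (reset T) frames_det rA _ rD).
by case=> [v [r c]]; exact: regular_reset.
Qed.

Section Direction.
Variable j : 'I_n.

(** The direction in which the values on the generators at j move towards those
    of the canonical presentation of the zero representation *)
Definition dir : pres := lift hQ (P alpha) (fun v => if v == j then p0 v *m gens gamma v else 0).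

Definition shift (phi : pres) (t : k) : pres := hom_lin phi t dir.

Lemma dir_gens v : dir v *m gens gamma v = if v == j then p0 v *m gens gamma v else 0.
Proof. exact: lift_gens. Qed.

Lemma shift_gens phi t v : shift phi t v *m gens gamma v =
  phi v *m gens gamma v + t *: (if v == j then p0 v *m gens gamma v else 0).
Proof. by rewrite mulmxDl -scalemxAl dir_gens. Qed.

Lemma shift_below phi t v : v != j -> (depth v <= depth j)%N -> shift phi t v = phi v.
Proof.
move=> ne le; apply: (hom_agree hQ) => u H; rewrite shift_gens.
have /negPf-> : u != j; last by rewrite scaler0 addr0.
by case/orP: H => [lt|/eqP-> //]; apply: contraTneq lt => ->; rewrite -leqNgt.
Qed.

Lemma reset_shift (T : {set 'I_n}) phi t : j \notin T ->
  reset T (shift phi t) = shift (reset T phi) t.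
Proof.
move=> jT; apply: (hom_gens_eq hQ) => u; rewrite shift_gens.
have [uT|uT] := boolP (u \in T).
  rewrite !reset_in //; have /negPf-> : u != j by apply: contraNneq jT => <-.
  by rewrite scaler0 addr0.
by rewrite !reset_out // shift_gens.
Qed.

Lemma hom_column g d (W : rep k Q d) (h : hom (P g) W) u r c :
  h u r c = (path_mx W (tag (enum_val c)) u (Ppath (enum_val c : Pbasis Q g u)) *m
    (h (tag (enum_val c)) *m gens g (tag (enum_val c)))) r (tagged (enum_val c)).1.
Proof. by rewrite -{1}[c]enum_valK hom_path /= mulmxA mul_gens. Qed.

Lemma shift_entry phi t v r c : shift phi t v r c = phi v r c + t * dir v r c.
Proof.
have -> : shift phi t v = phi v + t *: dir v by [].
by rewrite mxE [X in _ + X]mxE.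
Qed.

Lemma cast_row_mxE m m' p q (e : m = m') (A : 'M[k]_(m, p)) (B : 'M_(m, q)) i c :
  castmx (e, erefl) (row_mx A B) i c = match fintype.split c with
    | inl y => A (cast_ord (esym e) i) y
    | inr l => B (cast_ord (esym e) i) l end.
Proof. by case: m' / e i => i; rewrite castmx_id mxE cast_ord_id. Qed.

(** The columns of a frame that belong to generators at j have degree one along
    this direction, with top coefficients the columns of the canonical
    presentation of 0, and the others are constant; use [top_coef_det]. *)
Lemma top_coef_reset_det (T : {set 'I_n}) (jT : j \notin T) K : exists m, forall phi,
  exists2 p : {poly k}, forall t, p.[t] = reset_det T (shift phi t) ^+ K &
    top_coef m (reset_det (j |: T) phi ^+ K) p.
Proof.
pose deg v (c : 'I_(Pdim Q gamma v + alpha v)) : nat :=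
  match fintype.split c with
  | inl y => (tag (enum_val y : Pbasis Q gamma v) == j)
  | inr _ => 0%N end.
exists ((\sum_v \sum_c deg v c) * K)%N => phi.
pose chi := reset T phi; pose chi' := reset (j |: T) phi.
pose C0 v := frame chi v.
pose C1 v : 'M[k]_(Pdim Q gamma v + alpha v) :=
  castmx (Pdim_coexp k hQ alpha v, erefl) (row_mx (dir v) 0).
pose M v : 'M[{poly k}]_(Pdim Q gamma v + alpha v) :=
  \matrix_(i, c) ((C0 v i c)%:P + (C1 v i c)%:P * 'X).
exists ((\prod_v \det (M v)) ^+ K).
  move=> t; rewrite horner_exp; congr (_ ^+ _).
  rewrite /reset_det reset_shift // frames_detE horner_prod; apply: eq_bigr => v _.
  rewrite frame_detE -horner_evalE -det_map_mx; congr (\det _); apply/matrixP => i c.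
  rewrite 2!mxE /= horner_evalE hornerD hornerCM !hornerC hornerX.
  rewrite /C0 /C1 !frameE !cast_row_mxE; case: fintype.split => l.
    by rewrite shift_entry mulrC.
  by rewrite [X in X * t]mxE mul0r addr0.
apply: top_coef_exp; rewrite /reset_det frames_detE; apply: top_coef_prod => v _.
rewrite frame_detE; apply: top_coef_det => i c; rewrite mxE.
have key : frame chi' v i c = if deg v c == 0%N then C0 v i c else C1 v i c.
  rewrite /C0 /C1 !frameE !cast_row_mxE /deg; case: fintype.split => l; last by [].
  rewrite !hom_column; set y := enum_val l.
  rewrite dir_gens; have [e|ne] := eqVneq (tag y) j.
    have yT : tag y \in j |: T by rewrite e setU11.
    by rewrite /= (reset_in _ yT).
  rewrite /=; have [yT|yT] := boolP (tag y \in T); first by rewrite !reset_in // in_setU1 yT orbT.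
  by rewrite !reset_out // in_setU1 negb_or ne.
rewrite -/chi' key; have [d0|d1] := eqVneq (deg v c) 0%N.
  have -> : C1 v i c = 0.
    rewrite /C1 cast_row_mxE; move: d0; rewrite /deg; case: fintype.split => l.
      rewrite hom_column dir_gens; case: eqP => // _ _.
      by rewrite mulmx0 mxE.
    by rewrite mxE.
  by rewrite d0 mul0r addr0; split; rewrite ?size_polyC_leq1 // coefC.
have -> : deg v c = 1%N.
  by move: d1; rewrite /deg; case: fintype.split => // l; case: (_ == j).
split; last by rewrite coefD coefC coefMX coefC add0r.
apply: leq_trans (size_polyD _ _) _; rewrite geq_max.
rewrite (leq_trans (size_polyC_leq1 _)) //=.
by apply: leq_trans (size_polyMleq _ _) _; rewrite size_polyX addn2 /= ltnS size_polyC_leq1.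
Qed.

End Direction.

Lemma p0_top v : top alpha v *m (p0 v *m gens gamma v) = 0.
Proof.
apply: (sel_cancel (hQ := hQ)) => a e; case: v / e.
by rewrite -mulmxA canon_gens mulmx0 sub0r mulmxN mulmxA top_rad mul0mx oppr0.
Qed.


Lemma hom_unipotent (f : hom (P alpha) (P alpha)) v N : f v *m gens alpha v = gens alpha v + N ->
  (forall a : arrow Q, hd a = v -> f (tl a) = 1%:M) -> f v = 1%:M + N *m top alpha v.
Proof.
move=> fg H; apply/eqP; rewrite -subr_eq0; apply/eqP; apply: zero_on_gens_rad.
  by rewrite mulmxBl fg mulmxDl mul1mx -mulmxA top_gens mulmx1 subrr.
move=> a e; case: v / e in N fg H *; rewrite castmx_id mulmxBl hom_comm H // mulmx1.
by rewrite mulmxDl mul1mx -mulmxA top_rad mulmx0 addr0 subrr.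
Qed.

Lemma castmx_zero_rad (xi psi : pres) v (x : 'rV_(Pdim Q alpha v)) a (e : hd a = v) :
  xi (tl a) = psi (tl a) -> x *m psi v = 0 ->
  castmx (erefl, congr1 (Pdim Q gamma) (esym e)) (x *m xi v) *m P gamma a = 0.
Proof.
case: v / e x => x ex xp; rewrite castmx_id -mulmxA hom_comm ex -hom_comm mulmxA xp.
by rewrite mul0mx.
Qed.

Lemma castmxB m m' p p' (e : (m = m') * (p = p')) (A B : 'M[k]_(m, p)) :
  castmx e (A - B) = castmx e A - castmx e B.
Proof. by apply/matrixP => r c; rewrite !(castmxE, mxE). Qed.

Lemma cast_top_rad v (y : 'rV_(gamma v)) a (e : hd a = v) :
  castmx (erefl, congr1 (Pdim Q gamma) (esym e)) (y *m top gamma v) *m P gamma a = 0.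
Proof. by case: v / e y => y; rewrite castmx_id -mulmxA top_rad mulmx0. Qed.

Section Step.
Variables (T : {set 'I_n}) (j : 'I_n).
Hypotheses (uT : up T) (jT : j \notin T) (jmax : forall w, w \notin T -> (depth w <= depth j)%N).
Hypothesis supp : (0 < gamma j)%N -> (0 < alpha j)%N.
Let T' := j |: T.

Let uT' : up T'.
Proof.
move=> v w; rewrite /T' !in_setU1 negb_or => /orP[/eqP->|vT] /andP[_ wT]; first exact: jmax.
exact: uT.
Qed.

Let out' w : w \notin T' -> w != j /\ w \notin T.
Proof. by rewrite in_setU1 negb_or => /andP[]. Qed.

(** The projection of P(alpha)_j onto the generators of P(gamma) at j, along the
    columns of [phi] that belong to nontrivial paths and the generators of
    P(alpha), up to the factor [frame_det (reset T' phi) j] *)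
Let tau (phi : pres) : 'M[k]_(gamma j, Pdim Q alpha j) :=
  top gamma j *m
  usubmx (castmx (erefl, esym (Pdim_coexp k hQ alpha j)) (\adj (frame (reset T' phi) j))).

Let tauE phi : frame_det (reset T' phi) j != 0 ->
  tau phi = frame_det (reset T' phi) j *: (top gamma j *m ret hQ (reset T' phi) j).
Proof.
move=> D; rewrite scalemxAr /tau; congr (_ *m _); apply/matrixP => r c.
rewrite mxE [RHS]mxE [X in _ = _ * X]mxE !castmxE /= /invmx unitmxE unitfE -frame_detE D.
rewrite [X in _ = _ * X]mxE mulrA.
by rewrite mulfV // mul1r.
Qed.

Let tau_gens phi : frame_det (reset T' phi) j != 0 -> tau phi *m gens alpha j = 0.
Proof. by move=> D; rewrite tauE // -scalemxAl -mulmxA ret_gens // mulmx0 scaler0. Qed.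

Let tau_p0 phi : frame_det (reset T' phi) j != 0 ->
  tau phi *m (p0 j *m gens gamma j) = (frame_det (reset T' phi) j)%:M.
Proof.
move=> D; rewrite tauE // -(@reset_in T' phi) ?setU11 // -scalemxAl -!mulmxA (mulmxA (ret _ _ _)).
by rewrite ret_phi // mul1mx top_gens scale_scalar_mx mulr1.
Qed.

Let Amx (phi : pres) : 'M[k]_(gamma j) := tau phi *m (phi j *m gens gamma j).
Let rrow (phi : pres) : 'rV[k]_(gamma j) := const_mx 1 *m (top alpha j *m (phi j *m gens gamma j)).

(** It does not vanish at a presentation when the other vertices cause no pole
    and the pair ([Amx], [rrow]) is observable.  Moving along [dir] adds a
    multiple of the identity to [Amx], and the automorphisms [autom] below add
    matrices c r with r = [rrow]. *)
Let kappa (phi : pres) : k :=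
  (\prod_(v | v \notin T') frame_det phi v) * frame_det (reset T' phi) j *
  \det (krylov (rrow phi) (Amx phi)).

Let regular_frame_det_reset : @regular k VP (fun phi => frame_det (reset T' phi) j).
Proof.
apply: (@regular_comp k VP pres (@regular k VP) (reset T') (fun phi => frame_det phi j)
  (regular_alg VP) _ (@regular_frame_det k n Q hQ alpha j)).
by case=> [v [r c]]; exact: regular_reset.
Qed.

Let regular_krylov : @regular k VP (fun phi => \det (krylov (rrow phi) (Amx phi))).
Proof.
have rA := regular_alg VP; apply: (alg_det rA); apply: (alg_krylov rA).
  apply: (alg_mxM rA); first exact: alg_mx_const.
  apply: (alg_mxM rA); first exact: alg_mx_const.
  by apply: (alg_mxM rA); [exact: regular_pres | exact: alg_mx_const].
apply: (alg_mxM rA); last by apply: (alg_mxM rA); [exact: regular_pres | exact: alg_mx_const].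
apply: (alg_mxM rA); first exact: alg_mx_const.
move=> r c; under eq_fun do rewrite mxE.
apply: alg_mx_cast; apply: (alg_adj rA); apply: alg_mx_cast.
by apply: alg_row_mx; [exact: regular_reset | exact: alg_mx_const].
Qed.

Let regular_kappa : @regular k VP kappa.
Proof.
have rA := regular_alg VP; apply: (alg_mul rA) regular_krylov.
apply: (alg_mul rA) regular_frame_det_reset.
by apply: (alg_prod rA) => v _; exact: regular_frame_det.
Qed.

Let p0_good : good p0 := canon_good hQ (fun a => 0).

Let kappa_neq0 : exists phi, kappa phi != 0.
Proof.
have rA := regular_alg VP.
have r1 : @regular k VP (fun phi =>
    (\prod_(v | v \notin T') frame_det phi v) * frame_det (reset T' phi) j).
  apply: (alg_mul rA) regular_frame_det_reset.
  by apply: (alg_prod rA) => v _; exact: regular_frame_det.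
have nz1 : (\prod_(v | v \notin T') frame_det p0 v) * frame_det (reset T' p0) j != 0.
  by rewrite reset_canon mulf_neq0 //; apply/prodf_neq0.
(* At this presentation the pair is, up to a scalar, a nilpotent Jordan block
   and the first unit row. *)
pose J : 'M[k]_(gamma j) := \matrix_(i, l) (l == i.+1 :> nat)%:R.
pose e0 : 'M[k]_(alpha j, gamma j) := \matrix_(i, l) ((i == 0%N :> nat) && (l == 0%N :> nat))%:R.
pose psi : pres := lift hQ (P alpha) (fun v =>
  if v == j then at_mx (d1 := Pdim Q alpha) (d2 := gamma) (fun v => 0)
    (p0 j *m gens gamma j *m J + gens alpha j *m e0) v else p0 v *m gens gamma v).
have psij : psi j *m gens gamma j = p0 j *m gens gamma j *m J + gens alpha j *m e0.
  by rewrite lift_gens eqxx at_mx_same.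
have psiT : reset T' psi = p0.
  apply: (hom_gens_eq hQ) => u; have [uT''|uT''] := boolP (u \in T'); first exact: reset_in.
  by rewrite reset_out // lift_gens; have [/negPf-> _] := out' uT''.
have D : frame_det (reset T' psi) j != 0 by rewrite psiT.
have Apsi : Amx psi = frame_det p0 j *: J.
  rewrite /Amx psij mulmxDr !mulmxA tau_gens // mul0mx addr0 -[_ *m gens gamma j]mulmxA tau_p0 //.
  by rewrite psiT mul_scalar_mx.
have rpsi : rrow psi = \row_l (l == 0%N :> nat)%:R.
  rewrite /rrow psij mulmxDr !mulmxA -(mulmxA _ _ (gens gamma j)) p0_top mul0mx add0r.
  rewrite top_gens mul1mx; apply/rowP => l; rewrite !mxE.
  (* By the support condition, [rrow] is a sum of at least one row if it has an
     entry. *)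
  have gj : (0 < gamma j)%N by exact: leq_ltn_trans (leq0n l) (ltn_ord l).
  rewrite (bigD1 (Ordinal (supp gj))) //= big1 ?addr0 ?mxE ?mul1r // => i i0.
  rewrite !mxE mul1r; case: eqP => // e; case/eqP: i0; exact: val_inj.
have nz2 : \det (krylov (rrow psi) (Amx psi)) != 0.
  by rewrite -unitfE -unitmxE Apsi rpsi; apply: krylov_jordan; exact: p0_good.
have [phi [k1 k2]] := regular_neq0_mul (@pres_lines k n Q alpha) r1 regular_krylov nz1 nz2.
by exists phi; rewrite mulf_neq0.
Qed.

Section Point.
Variable phi : pres.
Hypothesis kphi : kappa phi != 0.

Let Dphi v : v \notin T' -> frame_det phi v != 0.
Proof.
move=> vT; move: kphi; rewrite /kappa !mulf_eq0 !negb_or => /andP[/andP[/prodf_neq0 H _] _].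
exact: H.
Qed.

Let Dj : frame_det (reset T' phi) j != 0.
Proof. by move: kphi; rewrite /kappa !mulf_eq0 !negb_or => /andP[/andP[]]. Qed.

Let Ku : krylov (rrow phi) (Amx phi) \in unitmx.
Proof. by move: kphi; rewrite unitmxE unitfE /kappa !mulf_eq0 !negb_or => /andP[]. Qed.

Lemma reset_det_neq0 : reset_det T' phi != 0.
Proof.
apply/frames_det_good; apply: (@reset_good T') => [v vT|v]; last exact: reset_in.
rewrite (@frame_det_eq _ phi) ?Dphi //; apply: reset_below => // w wT; exact: uT'.
Qed.

(** The automorphism of P(alpha) that adds a combination of the columns of the
    canonical presentation to the generators at j *)
Let autom (C : 'M[k]_(gamma j, alpha j)) : hom (P alpha) (P alpha) := lift hQ (P alpha) (fun v =>
  gens alpha v +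
  at_mx (d1 := Pdim Q alpha) (d2 := alpha) (fun v => 0) (p0 j *m gens gamma j *m C) v).

Let autom_gens C v : autom C v *m gens alpha v = gens alpha v +
  at_mx (d1 := Pdim Q alpha) (d2 := alpha) (fun v => 0) (p0 j *m gens gamma j *m C) v.
Proof. exact: lift_gens. Qed.

Let autom_iso C : is_iso (autom C).
Proof.
apply: (hom_top_iso hQ) => v; rewrite /hom_top -mulmxA autom_gens mulmxDr top_gens.
have [->|ne] := eqVneq v j; last by rewrite at_mx_other // mulmx0 addr0 unitmx1.
by rewrite at_mx_same !mulmxA -(mulmxA _ _ (gens gamma j)) p0_top mul0mx addr0 unitmx1.
Qed.

Let autom_below C v : v != j -> (depth v <= depth j)%N -> autom C v = 1%:M.
Proof.
move=> ne le; rewrite -[RHS]/(hom_id (P alpha) v); apply: (hom_agree hQ) => u H.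
have ne' : u != j.
  by case/orP: H => [lt|/eqP-> //]; apply: contraTneq lt => ->; rewrite -leqNgt.
by rewrite autom_gens at_mx_other // addr0 mul1mx.
Qed.

Let autom_at C : autom C j = 1%:M + p0 j *m gens gamma j *m C *m top alpha j.
Proof.
apply: hom_unipotent => [|a e]; first by rewrite autom_gens at_mx_same.
have lt : (depth (tl a) < depth j)%N by rewrite -e depth_lt.
by apply: autom_below (ltnW lt); apply: contraTneq lt => ->; rewrite ltnn.
Qed.

(** The frame at j of the transform of the point of parameter t is invertible
    as soon as A + d t + c r is, where d is the factor in [tau]; so
    [krylov_shift] gives the automorphism. *)
Lemma leave (t : k) : exists g : aut (P alpha), reset_det T (hom_comp g (shift j phi t)) != 0.
Proof.
pose d := frame_det (reset T' phi) j; have Dd : d != 0 by exact: Dj.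
have [c cu] := krylov_shift (d * t) Ku.
pose C : 'M[k]_(gamma j, alpha j) := d^-1 *: (c *m const_mx 1).
exists (Aut (autom_iso C)); set psi := hom_comp _ _.
have below v : v != j -> (depth v <= depth j)%N -> psi v = phi v.
  by move=> ne le; rewrite /psi hom_compE autom_below // mul1mx shift_below.
apply/frames_det_good; apply: (@reset_good T) => [v vT|v]; last exact: reset_in.
rewrite (@frame_det_eq _ psi) //; last by apply: reset_below => // w wT; exact: uT.
have [->|ne] := eqVneq v j; last first.
  by rewrite (@frame_det_eq _ phi) ?Dphi ?in_setU1 ?negb_or ?ne //; apply: below => //; exact: jmax.
apply/frame_det_spans => x xpsi xg; set xi := reset T' phi.
(* The columns of nontrivial paths do not depend on the change of generators at j. *)
have xrad a (e : hd a = j) :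
    castmx (erefl, congr1 (Pdim Q gamma) (esym e)) (x *m xi j) *m P gamma a = 0.
  have lt : (depth (tl a) < depth j)%N by rewrite -e depth_lt.
  have ne : tl a != j by apply: contraTneq lt => ->; rewrite ltnn.
  have e1 : xi (tl a) = psi (tl a).
    rewrite below // ?(ltnW lt) //; apply: reset_below => [|w].
      by apply/negP; rewrite in_setU1 (negPf ne) /= => /uT/(_ jT); rewrite leqNgt lt.
    rewrite in_setU1 => /orP[/eqP->|/uT/(_ jT) le]; first exact: ltnW.
    exact: leq_trans (ltnW lt) le.
  exact: castmx_zero_rad e1 xpsi.
pose y := x *m (p0 j *m gens gamma j).
have xxi : x *m xi j = y *m top gamma j.
  apply/eqP; rewrite -subr_eq0; apply/eqP; apply: zero_on_gens_rad.
    rewrite mulmxBl -[y *m _ *m _]mulmxA top_gens mulmx1 -mulmxA reset_in ?setU11 //.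
    by rewrite subrr.
  move=> a e; rewrite castmxB mulmxBl xrad sub0r.
  by rewrite cast_top_rad oppr0.
have xE : x = d^-1 *: (y *m tau phi).
  apply: (frame_agree Dj); last by rewrite xg -scalemxAl -mulmxA tau_gens // mulmx0 scaler0.
  rewrite tauE // -scalemxAr scalerA mulVf // scale1r -[RHS]mulmxA -[X in y *m X]mulmxA.
  by rewrite ret_phi // mulmx1 xxi.
suff y0 : y = 0 by rewrite xE y0 mul0mx scaler0.
have gj : Aut (autom_iso C) j = 1%:M + p0 j *m gens gamma j *m C *m top alpha j := autom_at C.
have : y *m (Amx phi + (d * t)%:M + c *m rrow phi) = 0.
  have := congr1 (mulmx^~ (gens gamma j)) xpsi.
  rewrite mul0mx -mulmxA /psi hom_compE -mulmxA shift_gens eqxx gj {1}xE.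
  rewrite -scalemxAl => /eqP; rewrite scaler_eq0 invr_eq0 (negPf Dd) /= => /eqP e.
  rewrite -[RHS]e -[RHS]mulmxA; congr (y *m _).
  have -> : (1%:M + p0 j *m gens gamma j *m C *m top alpha j) *m
      (phi j *m gens gamma j + t *: (p0 j *m gens gamma j)) =
      phi j *m gens gamma j + t *: (p0 j *m gens gamma j) +
      p0 j *m gens gamma j *m C *m (top alpha j *m (phi j *m gens gamma j)).
    rewrite mulmxDl mul1mx; congr (_ + _); rewrite -[LHS]mulmxA; congr (_ *m _).
    by rewrite mulmxDr -scalemxAr p0_top scaler0 addr0.
  rewrite 2!mulmxDr -scalemxAr tau_p0 // -/d scale_scalar_mx [t * d]mulrC; congr (_ + _).
  rewrite mulmxA (mulmxA (tau phi) (p0 j *m gens gamma j) C) tau_p0 // -/d mul_scalar_mx.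
  rewrite /C scalerA mulfV // scale1r.
  by rewrite /rrow mulmxA.
by move/(congr1 (mulmx^~ (invmx (Amx phi + (d * t)%:M + c *m rrow phi)))); rewrite mulmxK // mul0mx.
Qed.

End Point.

Variables (f : pres -> k) (X : aut (P alpha) -> k).
Hypotheses (Xnz : forall g, X g != 0)
  (fX : forall (g : aut (P alpha)) phi, good phi -> good (hom_comp g phi) ->
          f (hom_comp g phi) = X g * f phi).

Lemma polyfun_shift (g : aut (P alpha)) phi (h : pres -> k) : @regular k VP h ->
  polyfun (fun t => h (hom_comp g (shift j phi t))).
Proof.
apply: regular_curve => v; apply: alg_comp => [||w]; first exact: polyfun_alg.
  by move=> w; apply: alg_mx_const; exact: polyfun_alg.
exact: polyfun_line.
Qed.

(** Along the line in direction [dir j], f is a quotient of polynomials.  By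
    [leave] and semi-invariance, it has no pole at the zeros of the denominator;
    so [hartogs_step] leaves only the top coefficient of the denominator. *)
Lemma hartogs_vertex K R : @regular k VP R ->
  (forall phi, good phi -> f phi * reset_det T phi ^+ K = R phi) ->
  exists K' R', @regular k VP R' /\ forall phi, good phi -> f phi * reset_det T' phi ^+ K' = R' phi.
Proof.
move=> rR RE; have rA := regular_alg VP; have lines := @pres_lines k n Q alpha.
have reg_act (g : aut (P alpha)) h : @regular k VP h ->
    @regular k VP (fun phi => h (hom_comp g phi)).
  move=> rh; apply: (@regular_comp k VP pres (@regular k VP) (fun phi => hom_comp g phi) h rA _ rh).
  move=> [v [r c]]; apply: (alg_mxM rA); [exact: alg_mx_const | exact: regular_pres].
have rD := regular_reset_det T; have rDK := alg_exp rA K rD.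
have rDp := @regular_frames_det k n Q hQ alpha.
have global (g : aut (P alpha)) psi :
    R (hom_comp g psi) * reset_det T psi ^+ K -
    X g * (R psi * reset_det T (hom_comp g psi) ^+ K) = 0.
  have [g' g'P] := autP g.
  have nz : frames_det (hom_comp g (hom_comp g' p0)) != 0.
    have -> : hom_comp g (hom_comp g' p0) = p0; last exact: frames_det_canon.
    by apply: hom_eq => v; rewrite !hom_compE mulmxA; have [_ ->] := g'P v; rewrite mul1mx.
  have [phi [nz1 nz2]] := regular_neq0_mul lines rDp (reg_act g _ rDp)
    (frames_det_canon hQ (fun a => 0)) nz.
  apply: (regular_dense (f := fun psi => R (hom_comp g psi) * reset_det T psi ^+ K -
      X g * (R psi * reset_det T (hom_comp g psi) ^+ K))
    (g := fun psi => frames_det psi * frames_det (hom_comp g psi)) lines _ _ (mulf_neq0 nz1 nz2)).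
  - apply: (alg_add rA); first by apply: (alg_mul rA) rDK; exact: reg_act.
    apply: (alg_opp rA); apply: (alg_mul rA); first exact: alg_const.
    by apply: (alg_mul rA) => //; exact: (reg_act g (fun psi => reset_det T psi ^+ K)).
  - by apply: (alg_mul rA) => //; exact: reg_act.
  - move=> chi; rewrite mulf_eq0 negb_or => /andP[/frames_det_good U /frames_det_good Ug].
    by rewrite -!RE // fX //; ring.
have [m topm] := top_coef_reset_det jT K.
have [x0 k0] := kappa_neq0.
pose e (i : coord_index VP) := dir j (tag i) (tagged i).1 (tagged i).2.
have rL := alg_exp rA K (regular_reset_det T').
have [||s [Q' [rQ' QE]]] := @hartogs_step k VP lines (shift j) e _ R
    (fun phi => reset_det T phi ^+ K) (fun phi => reset_det T' phi ^+ K) kappa m x0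
    rR rDK rL regular_kappa k0 topm.
- by move=> phi t [v [r c]]; exact: shift_entry.
- move=> phi kphi; split; first exact: expf_neq0 (reset_det_neq0 kphi).
  move=> t0 _; have [g gnz] := leave kphi t0.
  have [b bE] := polyfun_shift g phi rDK; have [b' b'E] := polyfun_shift g phi rR.
  exists b; first by rewrite -bE expf_neq0.
  exists ((X g)^-1 *: b') => t; rewrite hornerZ -bE -b'E -mulrA.
  have /eqP := global g (shift j phi t); rewrite subr_eq0 => /eqP ->.
  by rewrite mulKf.
exists (K * s)%N, Q'; split=> // phi U; have Dnz : reset_det T phi ^+ K != 0.
  by rewrite expf_neq0 //; apply/frames_det_good; exact: good_reset.
apply: (mulIf Dnz); rewrite -QE -RE // exprM.
by ring.
Qed.

End Step.

Hypothesis supp : forall v, (0 < gamma v)%N -> (0 < alpha v)%N.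

(** Apply [hartogs_vertex] to the vertices in order of decreasing depth, until the
    denominator is constant. *)
Lemma hartogs_extension (f : pres -> k) (X : aut (P alpha) -> k) : (forall g, X g != 0) ->
  (forall (g : aut (P alpha)) phi, good phi -> good (hom_comp g phi) ->
     f (hom_comp g phi) = X g * f phi) ->
  localization (@regular k VP) frames_det f ->
  exists h, @regular k VP h /\ forall phi, good phi -> f phi = h phi.
Proof.
move=> Xnz fX [d [R0 [rR0 R0E]]].
pose claim T := exists K R, @regular k VP R /\
  forall phi, good phi -> f phi * reset_det T phi ^+ K = R phi.
have c0 : claim set0.
  exists d, R0; split=> // phi U; rewrite /reset_det reset_set0; apply: R0E.
  exact/frames_det_good.
have step T : up T -> claim T -> claim setT.
  have [m] := ubnP #|~: T|; elim: m T => [|m IH] T; first by move=> lt0; rewrite ltn0 in lt0.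
  rewrite ltnS => sz uT cT.
  have [T0|[w0 w0T]] := set_0Vmem (~: T).
    by have <- : T = setT by rewrite -[T]setCK T0 setC0.
  have {}w0T : w0 \notin T by rewrite -in_setC.
  have [j /= jT jmax] := @arg_maxnP _ w0 [pred w | w \notin T] (fun w => depth w) w0T.
    apply: (IH (j |: T)).
  - apply: leq_trans sz; apply: proper_card; apply/properP; split.
      by rewrite setCS subsetUr.
    by exists j; rewrite !inE ?eqxx.
  - move=> v w; rewrite !in_setU1 negb_or => /orP[/eqP->|vT] /andP[_ wT]; first exact: jmax.
    exact: uT.
  - have [K [R [rR RE]]] := cT.
    exact: (hartogs_vertex uT jT jmax (@supp j) Xnz fX rR RE).
have [|K [R [rR RE]]] := step set0 _ c0; first by move=> v w; rewrite inE.
have cnz : frames_det p0 ^+ K != 0 by rewrite expf_neq0 // frames_det_canon.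
exists (fun phi => (frames_det p0 ^+ K)^-1 * R phi); split.
  by have rA := regular_alg VP; apply: (alg_mul rA) => //; exact: alg_const.
by move=> phi U; rewrite -RE // /reset_det reset_setT mulrCA (mulVf cnz) mulr1.
Qed.

End Hartogs.

Section Surjectivity.
Variables (k : closedFieldType) (n : nat) (Q : quiver n).
Hypothesis hQ : acyclic Q.
Variable alpha : 'I_n -> nat.
Local Notation gamma := (coexp Q alpha).
Local Notation P gamma := (@projrep k n Q gamma).
Local Notation pres := (hom (P gamma) (P alpha)).
Local Notation VP := (pres_variety k Q alpha gamma).
Local Notation VR := (rep_variety k Q alpha).
Local Notation good := (@good k n Q hQ alpha).
Local Notation frames_det := (@frames_det k n Q hQ alpha).
Hypothesis supp : forall v, (0 < gamma v)%N -> (0 < alpha v)%N.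

(** The extension of [good_ext] is semi-invariant on the dense set of good
    presentations, hence everywhere. *)
Lemma semi_invariant_lift (eta : grp VR -> k) (F : rep k Q alpha -> k) :
  character eta -> semi_invariant eta F ->
  exists chi (f : pres -> k), [/\ character chi, semi_invariant (X := VP) chi f &
    forall M, f (canon hQ M) = F M].
Proof.
move=> etaC FS.
have [[N0 F0]|F0] := pselect (exists N0, F N0 != 0); last first.
  exists (fun=> 1), (fun=> 0); split.
  - by split=> [g|g h]; rewrite ?oner_neq0 ?mulr1.
  - split=> [|g phi]; last by rewrite mulr0.
    exact: (alg_const (regular_alg VP)).
  - by move=> M; apply/esym/eqP; apply: contra_notT F0 => FM; exists M.
have [sigma sigmaE] := rep_weight etaC FS F0.
pose ex := good_ext hQ F sigma.
pose X (g : aut (P alpha)) : k := \prod_v \det (g v) ^ sigma v.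
pose Y (b : aut (P gamma)) : k := \prod_v \det (b v) ^ sigma v.
have det_nz d (V : rep k Q d) (g : aut V) v : \det (g v) != 0 by rewrite -unitfE -unitmxE aut_unit.
have Xnz g : X g != 0 by apply/prodf_neq0 => v _; rewrite expfz_neq0.
have Ynz b : Y b != 0 by apply/prodf_neq0 => v _; rewrite expfz_neq0.
have exX (g : aut (P alpha)) phi : good phi -> good (hom_comp g phi) ->
    ex (hom_comp g phi) = X g * ex phi.
  by move=> U Ug; exact: (ext_left FS sigmaE U Ug).
have [f [rf fE]] := hartogs_extension supp Xnz exX (ext_loc hQ FS sigma).
exists (fun g : grp VP => X g.1 * Y g.2), f; split.
- split=> [g|g h]; first by rewrite mulf_neq0.
  rewrite /= mulrACA; congr (_ * _); rewrite -big_split /=; apply: eq_bigr => v _.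
    by rewrite -expfzMl -det_mulmx.
  by rewrite -expfzMl mulrC -det_mulmx.
- split=> // g phi; apply/eqP; rewrite -subr_eq0; apply/eqP.
  have rA := regular_alg VP; have rDp := @regular_frames_det k n Q hQ alpha.
  have lines := @pres_lines k n Q alpha.
  have reg_act h : @regular k VP h -> @regular k VP (fun phi => h (gact (g : grp VP) phi)).
    move=> rh; apply: (@regular_comp k VP pres (@regular k VP)
      (fun phi => gact (g : grp VP) phi) h rA _ rh).
    move=> [v [r c]]; apply: (alg_mxM rA); first exact: alg_mx_const.
    by apply: (alg_mxM rA); [exact: regular_pres | exact: alg_mx_const].
  have [g1 g1P] := autP g.1; have [g2 g2P] := autP g.2.
  pose p0 := canon hQ (fun a => 0 : 'M[k]_(alpha (hd a), alpha (tl a))).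
  have nz : frames_det (gact (g : grp VP) (hom_comp g1 (hom_comp p0 g2))) != 0.
    have -> : gact (g : grp VP) (hom_comp g1 (hom_comp p0 g2)) = p0; last exact: frames_det_canon.
    apply: hom_eq => v; rewrite /= -!mulmxA; have [-> _] := g2P v; rewrite mulmx1.
    by rewrite mulmxA; have [_ ->] := g1P v; rewrite mul1mx.
  have [psi [nz1 nz2]] := regular_neq0_mul lines rDp (reg_act _ rDp)
    (frames_det_canon hQ (fun a => 0)) nz.
  apply: (regular_dense (f := fun phi => f (gact (g : grp VP) phi) - X g.1 * Y g.2 * f phi)
    (g := fun phi => frames_det phi * frames_det (gact (g : grp VP) phi))
    lines _ _ (mulf_neq0 nz1 nz2)).
  + apply: (alg_add rA); first exact: reg_act.
    by apply: (alg_opp rA); apply: (alg_mul rA) => //; exact: alg_const.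
  + by apply: (alg_mul rA) => //; exact: reg_act.
  + move=> chi; rewrite mulf_eq0 negb_or => /andP[/frames_det_good U /frames_det_good Ug].
    rewrite -!fE //; have Ub := good_right g.2 U.
    have e1 : ex (gact (g : grp VP) chi) = X g.1 * ex (hom_comp chi g.2) := exX g.1 _ Ub Ug.
    have e2 : ex (hom_comp chi g.2) = Y g.2 * ex chi by apply: ext_right.
    by rewrite e1 e2 mulrA subrr.
- by move=> M; rewrite -fE; [exact: ext_canon | exact: canon_good].
Qed.

Lemma restrict_surjective (F : SI VR) : exists f : SI VP, restrict hQ f = F.
Proof.
have /asboolP[m [G [GP FE]]] := SI_valP F.
have ex i : exists f : pres -> k, (exists2 chi, character chi & semi_invariant (X := VP) chi f) /\
    forall M, f (canon hQ M) = G i M.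
  have [eta etaC GS] := GP i.
  have [chi [f [c s e]]] := semi_invariant_lift etaC GS.
  by exists f; split=> //; exists chi.
have [f fP] := choice ex.
have fS : (\sum_i f i : pt VP -> k) \in SI_pred (X := VP).
  by apply/asboolP; exists m, f; split=> // i; have [] := fP i.
exists (MkSI fS); apply: SI_eq; apply/funext => M.
rewrite FE /= !fct_sumE; apply: eq_bigr => i _.
by have [_ ->] := fP i.
Qed.

End Surjectivity.

(** * Necessity of the support condition *)
Section Necessity.
Variables (k : closedFieldType) (n : nat) (Q : quiver n).
Hypothesis hQ : acyclic Q.
Variable alpha : 'I_n -> nat.
Local Notation gamma := (coexp Q alpha).
Local Notation P gamma := (@projrep k n Q gamma).
Local Notation pres := (hom (P gamma) (P alpha)).
Local Notation VP := (pres_variety k Q alpha gamma).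
Local Notation VR := (rep_variety k Q alpha).
Local Notation gens := (@gens k n Q).

Lemma euler_formE d : euler_form Q alpha d =
  (\sum_v alpha v * d v)%N%:Z - (\sum_v gamma v * d v)%N%:Z.
Proof.
rewrite /euler_form -[X in _ *m X *m _]trmxK -trmx_mul.
have -> : (euler_mx Q)^T *m zvec alpha = zvec alpha - zvec gamma.
  by rewrite zvec_coexp // /zcoexp subKr.
have zE g : ((zvec g)^T *m zvec d) 0 0 = (\sum_v g v * d v)%N%:Z.
  by rewrite (big_morph Posz PoszD (erefl _)) mxE; apply: eq_bigr => v _; rewrite !mxE.
by rewrite linearB mulmxBl mxE [X in _ + X]mxE !zE.
Qed.

Section Injective.
Variable v : 'I_n.

Definition inj_dim (u : 'I_n) : nat := #|{: qpath Q u v}|.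

(** The injective representation at v, in the basis dual to the paths into v *)
Definition injrep : rep k Q inj_dim := fun a =>
  \matrix_(p', p) ((val (val (enum_val p)) : seq (arrow Q)) == a :: val (val (enum_val p')))%:R.

Lemma Pdim_inj g : Pdim Q g v = (\sum_u g u * inj_dim u)%N.
Proof.
rewrite /Pdim card_tagged sumnE big_map big_enum /=; apply: eq_bigr => u _.
by rewrite card_prod card_ord.
Qed.

Lemma euler_injrep : alpha v = 0%N -> euler_form Q alpha inj_dim = 0.
Proof.
by move=> av; rewrite euler_formE -!Pdim_inj (Pdim_coexp k hQ) av addn0 subrr.
Qed.

(** Hom(W, I_v) is the dual of W_v: the coordinate of h at a path into v is the
    functional at the trivial path, composed with the map of W along the path. *)
Lemma injrep_hom_eq0 d (W : rep k Q d) (h : hom W injrep) :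
  row (enum_rank (qpath_nil Q v)) (h v) = 0 -> forall u, h u = 0.
Proof.
move=> hv u; apply/row_matrixP => i; rewrite row0 -[i]enum_valK.
case: (enum_val i) => [[p sp] hp] /= {i}.
elim: p u sp hp => [|a p IH] u sp hp.
  have e : v = u by apply/esym/eqP.
  case: u / e hp => hp; rewrite -[RHS]hv; congr (row (enum_rank _) _).
  by apply: val_inj; apply: val_inj.
have [/eqP e hp'] : tl a == u /\ is_path (hd a) v p by move: hp => /= /andP[].
case: u / e hp => hp.
have sp' : (size p <= n)%N by exact: ltnW.
have := IH (hd a) sp' hp'; set q' := enum_rank _ => hq'.
have := congr1 (row q') (hom_comm h a); rewrite row_mul hq' mul0mx row_mul => e.
rewrite [RHS]e; apply/rowP => c; rewrite !mxE.
rewrite (bigD1 (enum_rank (exist _ (Bseq sp) hp : qpath Q (tl a) v))) //=.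
rewrite big1 ?addr0 => [|l lp]; rewrite !mxE ?enum_rankK ?eqxx ?mul1r //=.
case: eqP => [el|]; last by rewrite mul0r.
case/eqP: lp; rewrite -[l]enum_valK; congr enum_rank.
by apply: val_inj; apply: val_inj.
Qed.

End Injective.

Lemma det_cast_ker m m' (e : m = m') (B : 'M[k]_(m, m')) :
  (forall y : 'cV_m', B *m y = 0 -> y = 0) -> \det (castmx (e, erefl) B) != 0.
Proof.
case: m' / e B => B H; rewrite castmx_id -unitfE -unitmxE -unitmx_tr.
apply: unitmx_ker => x /(congr1 trmx); rewrite trmx_mul trmxK trmx0 => /H.
by move/(congr1 trmx); rewrite trmxK trmx0.
Qed.

Lemma det_zero m (A : 'M[k]_m) : (0 < m)%N -> A = 0 -> \det A = 0.
Proof. by case: m A => // m A _ ->; rewrite det0. Qed.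

(** The functor Hom(-, I_v) is the dual of evaluation at v, so c_(I_v) (M) is
    the determinant of the canonical presentation at v, which is invertible
    because M_v = 0. *)
Lemma detc_injrep v (hV : euler_form Q alpha (inj_dim v) = 0) M :
  alpha v = 0%N -> detc hQ (injrep v) hV M != 0.
Proof.
move=> av; apply: det_cast_ker => y; have [h <-] := Hcoord_surj hQ (injrep v) y.
rewrite -HmxE => h0.
have {}h0 : hom_comp h (canon hQ M) = lift hQ (injrep v) (fun u => 0).
  apply: (hom_gens_eq hQ) => u; rewrite lift_gens; apply/matrixP => r i; rewrite mul_gens.
  have /colP/(_ (enum_rank (Tagged (fun u => 'I_(gamma u) * 'I_(inj_dim v u))%type (i, r)))) := h0.
  by rewrite [LHS]mxE enum_rankK [RHS]mxE => e; rewrite [RHS]mxE; exact: e.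
have hc u : h u *m canon hQ M u = 0.
  rewrite -hom_compE h0; apply/matrixP => r c; rewrite [LHS]mxE /= mulmx0 !mxE.
  by [].
suff H u : h u = 0 by apply/colP => i; rewrite [LHS]mxE [RHS]mxE /= H mxE.
apply: injrep_hom_eq0; apply: (@canon_spans k n Q hQ alpha M v).
  by rewrite -row_mul hc row0.
by apply/matrixP => r c; have := ltn_ord c; rewrite [X in (_ < X)%N]av.
Qed.

Lemma detC_zero d (V : rep k Q d) (hV : euler_form Q alpha d = 0) :
  (0 < #|{: Hbasis alpha d}|)%N -> detC hQ V hV (lift hQ (P alpha) (fun u => 0)) = 0.
Proof.
move=> pos; apply: det_zero => //; set psi := lift _ _ _.
have psi0 u : psi u *m gens gamma u = 0 by exact: lift_gens.
have -> : Hmx V psi = 0; last by apply/matrixP => r c; rewrite castmxE !mxE.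
apply/matrixP => r c; rewrite mxE /= -mul_gens -mulmxA psi0 mulmx0 !mxE.
by [].
Qed.

(** If gamma v > 0 = alpha v then C_(I_v) vanishes at 0, so it is not a unit,
    while c_(I_v) is a regular function without zeros, hence a nonzero constant. *)
Lemma support_necessary (Phi : {rmorphism SI VP -> SI VR}) : bijective Phi ->
  (forall (d : 'I_n -> nat) (V : rep k Q d) (hV : euler_form Q alpha d = 0),
     exists2 f : SI VP, SI_val f = detC hQ V hV & SI_val (Phi f) = detc hQ V hV) ->
  forall v, (0 < gamma v)%N -> (0 < alpha v)%N.
Proof.
move=> bij H v gv; have [av|//] := posnP (alpha v).
have hV := euler_injrep av; have [f fE PfE] := H _ (injrep v) hV.
have pos : (0 < #|{: Hbasis alpha (inj_dim v)}|)%N.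
  move: gv; rewrite (coexpE hQ) => /card_gt0P[s]; rewrite inE => /eqP hs.
  have hp : is_path (tl (tag s)) v [:: tag s] by rewrite /= hs !eqxx.
  pose q : qpath Q (tl (tag s)) v := exist _ (Bseq (ltnW (path_size hQ hp))) hp.
  apply/card_gt0P.
  by exists (Tagged (fun u => 'I_(alpha u) * 'I_(inj_dim v u))%type (tagged s, enum_rank q)).
pose N : rep k Q alpha := fun a => 0.
pose c := detc hQ (injrep v) hV N.
have cE M : detc hQ (injrep v) hV M = c.
  apply: (@regular_nowhere_zero k VR (@rep_lines k n Q alpha) (detc hQ (injrep v) hV)).
    exact: regular_restrict (regular_detC hQ (injrep v) hV).
  by move=> L; exact: detc_injrep.
have cnz : c != 0 by exact: detc_injrep.
have gS : (fun=> c^-1 : k) \in SI_pred (X := VR).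
  apply/asboolP; exists 1%N, (fun _ _ => c^-1); split; last by rewrite big_ord1.
  move=> _; exists (fun=> 1); first by split=> *; rewrite ?oner_neq0 ?mulr1.
  split; first exact: (alg_const (regular_alg VR)).
  by move=> g x; rewrite mul1r.
pose g' : SI VR := MkSI gS.
have fg' : Phi f * g' = 1.
  apply: SI_eq; apply/funext => M.
  have -> : SI_val (Phi f * g') M = SI_val (Phi f) M * c^-1 by [].
  by rewrite PfE cE mulfV.
have [inv invK Kinv] := bij.
have fg : f * inv g' = 1.
  by apply: (bij_inj bij); rewrite rmorphM Kinv fg' rmorph1.
have := congr1 (fun x : SI VP => SI_val x (lift hQ (P alpha) (fun u => 0))) fg.
have -> : SI_val (f * inv g') (lift hQ (P alpha) (fun u => 0)) =
  SI_val f (lift hQ (P alpha) (fun u => 0)) *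
  SI_val (inv g') (lift hQ (P alpha) (fun u => 0)) by [].
rewrite fE detC_zero // mul0r => /esym/eqP.
by rewrite oner_eq0.
Qed.

End Necessity.

Theorem corollary4p2p7 (k : closedFieldType) (n : nat) (Q : quiver n)
    (hQ : acyclic Q) (alpha : 'I_n -> nat) :
  (exists Phi : {rmorphism SI (pres_variety k Q alpha (coexp Q alpha)) ->
                           SI (rep_variety k Q alpha)},
     bijective Phi /\
     forall (d : 'I_n -> nat) (V : rep k Q d)
            (hV : euler_form Q alpha d = 0%R),
       exists2 f : SI (pres_variety k Q alpha (coexp Q alpha)),
         SI_val f = detC hQ V hV & SI_val (Phi f) = detc hQ V hV)
  <-> support (coexp Q alpha) \subset support alpha.
Proof.
split=> [[Phi [bij H]]|/subsetP sub].
  apply/subsetP => v; rewrite !inE -!lt0n.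
  exact: (support_necessary (hQ := hQ) bij H).
have supp v : (0 < coexp Q alpha v)%N -> (0 < alpha v)%N.
  by have := sub v; rewrite !inE -!lt0n.
exists (GRing.RMorphism.clone _ _ (@restrict k n Q hQ alpha) _); split.
  have ex F : exists f, @restrict k n Q hQ alpha f = F by exact: restrict_surjective.
  have [inv invK] := choice ex.
  exists inv => f; last exact: invK.
  exact: (restrict_injective supp (invK (restrict hQ f))).
by move=> d V hV; exists (MkSI (detC_SI hQ V hV)).
Qed.
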